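(* Let $\lambda\ge1$. Then: (i) $W\cap\mathcal{S}^{\lambda}=\mathscr{S}^{\lambda}$. (ii) If $f,\tilde f\in W$, then $f,\tilde f\in C$. (iii) If $f\in\mathcal{S}^{\lambda}$ and $\tilde f\in W$, then $\tilde f\in\mathscr{S}^{\lambda}$. (iv) If $f\in HBV$ and $\tilde f\in W$, then $f,\tilde f\in\mathscr{U}$.
   Context: All functions are $2\pi$-periodic, and $L^1$ is the space of $2\pi$-periodic Lebesgue integrable functions. As usual in $L^1$, functions that agree almost everywhere are identified; thus $f\in W$, $f\in C$, $f\in HBV$, etc. mean that $f$ agrees a.e. with a function having the stated property. For $f\in L^1$, $s_nf$ is the $n$-th partial sum of its Fourier series and $\tilde f$ is its conjugate function (the periodic Hilbert transform of $f$), $\tilde f(x)=-\frac1\pi\lim_{\varepsilon\to0+}\int_{\varepsilon}^{\pi}\frac{f(x+t)-f(x-t)}{2\tan(t/2)}\,dt$ for a.e. $x$. A sequence of numbers $\{d_n\}$ is strongly convergent to $d$ with index $\lambda>0$, written $d_n\to d\ [I]_{\lambda}$, if (1) $d_n\to d$, and (2) $\sum_{k=1}^{n}k^{\lambda}|d_k-d_{k-1}|^{\lambda}=o(n)$ as $n\to\infty$. For sequences of functions, ''$s_nf\to f\ [I]_\lambda$ a.e.'' means this holds for a.e. $x$ with $d_n=s_nf(x)$, $d=f(x)$, and ''$s_nf\to f\ [I]_\lambda$ uniformly'' means that both (1) and (2) hold uniformly in $x$. Classes of functions: - $C$: the $2\pi$-periodic continuous functions. - $\mathcal{S}^{\lambda}=\{f\in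 L^1: s_nf\to f\ [I]_{\lambda}\text{ a.e.}\}$. - $\mathscr{S}^{\lambda}=\{f\in C: s_nf\to f\ [I]_{\lambda}\text{ uniformly}\}$. - $\mathscr{U}=\{f\in C: s_nf\to f\text{ uniformly}\}$. - $W$: the regulated functions, i.e. functions possessing (finite) one-sided limits at each point. - $HBV$: the functions of harmonic bounded variation, i.e. those with $\sup\{\sum_i|f(I_i)|/i\}<\infty$, where the supremum is over all finite collections of nonoverlapping subintervals $I_i$ of $(0,2\pi)$ and $f(I)=f(b)-f(a)$ for $I=(a,b)$. *)

(* Defs.v *)
From HB Require Import structures.
From mathcomp Require Import all_boot all_order all_algebra.
From mathcomp Require Import all_classical all_reals all_analysis.

Set Implicit Arguments.
Unset Strict Implicit.
Unset Printing Implicit Defensive.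

Import Order.TTheory GRing.Theory Num.Theory.
Import numFieldNormedType.Exports.

Local Open Scope classical_set_scope.
Local Open Scope ring_scope.

Section definitions.
Context {R : realType}.
Implicit Types (f g : R -> R) (d : nat -> R) (l lam : R) (n k : nat).

Local Notation mu := (@lebesgue_measure R).

Definition L1 : set (R -> R) :=
  [set f | periodic f (pi *+ 2) /\
           mu.-integrable `[- pi, pi] (fun x => (f x)%:E)].

(* Elements of L1 are functions, not classes of functions: [ae_class P] is the
   set of those that agree almost everywhere with a 2pi-periodic function
   having the property P. *)
Definition ae_class (P : set (R -> R)) : set (R -> R) :=
  [set f | L1 f /\
           exists g, [/\ periodic g (pi *+ 2), P g & f = g %[ae mu]]].

Definition fourier_cos f k : R :=
  pi^-1 * \int[mu]_(t in `[- pi, pi]) (f t * cos (k%:R * t)).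

Definition fourier_sin f k : R :=
  pi^-1 * \int[mu]_(t in `[- pi, pi]) (f t * sin (k%:R * t)).

Definition fourier_sum f n (x : R) : R :=
  fourier_cos f 0 / 2 +
  \sum_(1 <= k < n.+1)
    (fourier_cos f k * cos (k%:R * x) + fourier_sin f k * sin (k%:R * x)).

(* The principal value converges almost everywhere for every f in L1, so that
   [conjugate_of f] determines a function up to almost everywhere equality. *)
Definition conjugate_of f g : Prop :=
  \forall x \ae mu,
    - pi^-1 * \int[mu]_(t in `]e, pi[) ((f (x + t) - f (x - t)) /
                                        (2 * tan (t / 2)))
      @[e --> 0^'+] --> g x.

(* Condition (2) of strong convergence with index lam, that is
   sum_{k=1}^n k^lam |d_k - d_(k-1)|^lam = o(n),
   says that these means tend to 0. *)
Definition strong_mean lam d n : R :=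
  (\sum_(1 <= k < n.+1) k%:R `^ lam * `|d k - d k.-1| `^ lam) / n%:R.

Definition strong_cvg lam d l : Prop :=
  d @ \oo --> l /\ strong_mean lam d @ \oo --> (0 : R).

Definition strong_cvg_uniform lam (s : nat -> R -> R) g : Prop :=
  {uniform, s @ \oo --> g} /\
  {uniform, (fun n x => strong_mean lam (s ^~ x) n) @ \oo --> (fun=> 0 : R)}.

Definition regulated g : Prop :=
  forall x, cvg (g y @[y --> x^'+]) /\ cvg (g y @[y --> x^'-]).

(* A finite collection of nonoverlapping intervals ]a i, b i[, numbered in an
   arbitrary order; the i-th one has rank i.+1 as ordinals start at 0. *)
Definition harmonic_variations g : set R :=
  [set v | exists (n : nat) (a b : 'I_n -> R),
    [/\ forall i, a i < b i,
        forall i, `]a i, b i[ `<=` `]0, pi *+ 2[,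
        trivIset setT (fun i => `]a i, b i[%classic) &
        v = \sum_(i < n) `|g (b i) - g (a i)| / i.+1%:R]].

Definition harmonic_bounded_variation g : Prop :=
  has_ubound (harmonic_variations g).

Definition classC : set (R -> R) := ae_class [set g | continuous g].

Definition classW : set (R -> R) := ae_class regulated.

Definition classHBV : set (R -> R) := ae_class harmonic_bounded_variation.

Definition classU : set (R -> R) :=
  ae_class [set g | continuous g /\ {uniform, fourier_sum g @ \oo --> g}].

Definition classS_ae lam : set (R -> R) :=
  [set f | L1 f /\
           \forall x \ae mu, strong_cvg lam (fourier_sum f ^~ x) (f x)].

Definition classS_uniform lam : set (R -> R) :=
  ae_class [set g | continuous g /\ strong_cvg_uniform lam (fourier_sum g) g].

End definitions.

(* Main.v *)
(* Let rho_k be the amplitude of the k-th harmonic of f.  By Egorov's theorem,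
   strong convergence almost everywhere forces (1/n) sum_(k <= n) (k rho_k)^lam
   to tend to 0, hence also (1/n) sum_(k <= n) k rho_k.  This condition bears on
   the amplitudes only, so that it passes from f to its conjugate ft.  It makes
   the conjugate Fejer means of orders n and 2n asymptotically equal, which
   excludes jumps: a regulated function satisfying it is a.e. equal to a
   continuous one, and Fejer's theorem then yields uniform strong convergence.

   If f and ft are both regulated, the conjugate Fejer means of f are, up to a
   constant, the Fejer means of ft; they converge everywhere, so f has no jump,
   and symmetrically for ft.

   That the Fourier coefficients of ft are those of the conjugate series of f is
   obtained by regularization.  Let F_n be the analytic polynomial with real part
   the n-th Fejer mean of f = f+ - f-, and F+_n, F-_n those of f+, f-.  The
   function G = 1/((1 + eta F+_n)(1 + eta F-_n)) is a uniform limit of analytic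
   polynomials, |F_n G| is bounded by 4/eta, and F_n tends a.e. to F = f + i ft.
   So int F_n G e^{ikt} = 0 gives int F e^{ikt} = 0, by letting n tend to
   infinity and then eta to 0.

   A function of harmonic bounded variation is regulated, hence f is a.e. equal
   to a continuous h by the above, and the harmonic variation of h on small
   intervals is uniformly small.  Pairing consecutive blocks of the Dirichlet
   kernel gives uniform convergence of the Fourier series of h.  By Bernstein's
   inequality the derivatives of its partial sums are o(n) uniformly, so that the
   partial sums of ft are uniformly close to its Fejer means. *)

Require Import Defs.
From HB Require Import structures.
From mathcomp Require Import all_boot all_order all_algebra.
From mathcomp Require Import all_classical all_reals all_analysis.
From mathcomp Require Import measurable_realfun zify ring lra complex.

Set Implicit Arguments.
Unset Strict Implicit.
Unset Printing Implicit Defensive.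

Import Order.TTheory GRing.Theory Num.Theory.
Import numFieldNormedType.Exports.

Local Open Scope classical_set_scope.
Local Open Scope ring_scope.

(** * Integration on segments *)

(** The Fejer and conjugate Fejer means of f converge only almost everywhere and come with no
    integrable majorant, so the coefficients of [ft] cannot be read off by integrating to the limit;
    the factor G is there to supply a majorant. The splitting f = f+ - f- makes G possible: the
    Fejer kernel is nonnegative on [0, pi], so each denominator has real part at least 1 and an
    inverse that analytic polynomials approximate. A jump l - l' enters the difference of the
    conjugate Fejer means of orders 2n and n multiplied by the integral of the difference of their
    kernels. Each kernel has an integral of order log n and a main part of size 1/t. In the
    difference the main parts cancel, which leaves the decay of an approximate identity, while the
    integral stays above a positive constant. As f is known only up to null sets, one-sided limits
    are replaced by one-sided limits of averages of |f - l|: these ignore null sets, exist at every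
    point for a regulated representative, and have the value f x at almost every x. *)

Section integration_on_segments.
Context {R : realType}.
Implicit Types (f g : R -> R) (a b c x : R).
Local Notation mu := (@lebesgue_measure R).

Definition intble a b f := mu.-integrable `[a, b] (EFin \o f).

Definition Int a b f := \int[mu]_(t in `[a, b]) f t.

Lemma measurable_segment a b : measurable (`[a, b] : set (measurableTypeR R)).
Proof. exact: measurable_itv. Qed.
Hint Resolve measurable_segment : core.

Lemma intbleW a b c d f : a <= c -> d <= b -> intble a b f -> intble c d f.
Proof.
move=> ac db; apply: integrableS => // y/=; rewrite !in_itv/=.
by move=> /andP[cy yd]; rewrite (le_trans ac)//= (le_trans yd).
Qed.

Lemma intble_measurable a b f : intble a b f -> measurable_fun `[a, b] f.
Proof. by move=> /integrableP[/measurable_EFinP]. Qed.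

Lemma intble_continuous a b f : continuous f -> intble a b f.
Proof.
move=> cf; apply: continuous_compact_integrable; first exact: segment_compact.
exact: continuous_subspaceT.
Qed.

Lemma eq_intble a b f g : (forall t, a <= t <= b -> f t = g t) ->
  intble a b f -> intble a b g.
Proof.
move=> fg; apply: eq_integrable => // t; rewrite inE/= in_itv/= => tab.
by rewrite fg.
Qed.

Lemma intble_cst a b c : intble a b (fun=> c).
Proof. by apply: intble_continuous => y; exact: cvg_cst. Qed.

Lemma intbleD a b f g : intble a b f -> intble a b g ->
  intble a b (fun t => f t + g t).
Proof. by move=> fi gi; have := integrableD (measurable_segment a b) fi gi. Qed.

Lemma intbleB a b f g : intble a b f -> intble a b g ->
  intble a b (fun t => f t - g t).
Proof. by move=> fi gi; have := integrableB (measurable_segment a b) fi gi. Qed.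

Lemma intbleZ a b c f : intble a b f -> intble a b (fun t => c * f t).
Proof. by move=> fi; have := integrableZl (measurable_segment a b) c fi. Qed.

Lemma intbleN a b f : intble a b f -> intble a b (fun t => - f t).
Proof. by move=> fi; have := integrableN fi. Qed.

Lemma intble_norm a b f : intble a b f -> intble a b (fun t => `|f t|).
Proof. by move=> fi; have := integrable_norm fi. Qed.

Lemma intble_sum a b I (s : seq I) (P : pred I) (F : I -> R -> R) :
  (forall i, P i -> intble a b (F i)) ->
  intble a b (fun t => \sum_(i <- s | P i) F i t).
Proof.
move=> Fi; elim: s => [|i s IH].
  by under [X in intble _ _ X]eq_fun do rewrite big_nil; exact: intble_cst.
under [X in intble _ _ X]eq_fun do rewrite big_cons.
by case: (boolP (P i)) => // Pi; apply: intbleD => //; exact: Fi.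
Qed.

Lemma intbleM a b f g M : intble a b f -> measurable_fun `[a, b] g ->
  (forall t, a <= t <= b -> `|g t| <= M) -> intble a b (fun t => f t * g t).
Proof.
move=> fi mg gM.
have := @integrableMl _ _ _ mu _ (measurable_segment a b) _ g fi mg.
apply; exists M; split; first exact: num_real.
by move=> N MN t /=; rewrite in_itv/= => /gM /le_trans; apply; exact: ltW.
Qed.

Lemma segment_bounded a b g : continuous g ->
  exists2 M, 0 <= M & forall t, a <= t <= b -> `|g t| <= M.
Proof.
move=> cg; have : compact (g @` `[a, b]).
  apply: continuous_compact; last exact: segment_compact.
  exact: continuous_subspaceT.
move=> /compact_bounded[M [_ Mg]]; exists (`|M| + 1); first by rewrite addr_ge0.
move=> t tab; apply: (Mg (`|M| + 1)); last by exists t => //=; rewrite in_itv.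
by rewrite (le_lt_trans (ler_norm _))// ltrDl.
Qed.

Lemma intbleMc a b f g : intble a b f -> continuous g ->
  intble a b (fun t => f t * g t).
Proof.
move=> fi cg; have [M _ gM] := segment_bounded a b cg.
apply: intbleM gM => //; apply: measurable_funTS.
exact: continuous_measurable_fun.
Qed.

Lemma intble_le a b f g : measurable_fun `[a, b] f -> intble a b g ->
  (forall t, a <= t <= b -> `|f t| <= g t) -> intble a b f.
Proof.
move=> mf gi fg; apply: le_integrable gi => //; first exact/measurable_EFinP.
move=> t /=; rewrite in_itv/= => tab; rewrite lee_fin (le_trans (fg _ tab))//.
exact: ler_norm.
Qed.

Lemma eq_Int a b f g : (forall t, a <= t <= b -> f t = g t) ->
  Int a b f = Int a b g.
Proof. by move=> fg; apply: eq_Rintegral => t; rewrite inE/= in_itv/= => /fg. Qed.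

Lemma Int_cst a b c : a <= b -> Int a b (fun=> c) = c * (b - a).
Proof.
move=> ab; rewrite /Int Rintegral_cst//; congr (_ * _).
rewrite /= lebesgue_measure_itv/= lte_fin; case: ltP => // ba.
by rewrite (le_anti (introT andP (conj ab ba))) subrr.
Qed.

Lemma IntD a b f g : intble a b f -> intble a b g ->
  Int a b (fun t => f t + g t) = Int a b f + Int a b g.
Proof. by move=> fi gi; rewrite /Int RintegralD. Qed.

Lemma IntB a b f g : intble a b f -> intble a b g ->
  Int a b (fun t => f t - g t) = Int a b f - Int a b g.
Proof. by move=> fi gi; rewrite /Int RintegralB. Qed.

Lemma IntZ a b c f : intble a b f -> Int a b (fun t => c * f t) = c * Int a b f.
Proof. by move=> fi; rewrite /Int RintegralZl. Qed.

Lemma IntN a b f : intble a b f -> Int a b (fun t => - f t) = - Int a b f.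
Proof.
move=> fi; rewrite -mulN1r -IntZ//; apply: eq_Int => t _; exact/esym/mulN1r.
Qed.

Lemma Int_sum a b I (s : seq I) (P : pred I) (F : I -> R -> R) : a <= b ->
  (forall i, P i -> intble a b (F i)) ->
  Int a b (fun t => \sum_(i <- s | P i) F i t) =
  \sum_(i <- s | P i) Int a b (F i).
Proof.
move=> ab Fi; elim: s => [|i s IH].
  rewrite big_nil -[RHS](mul0r (b - a)) -Int_cst//.
  by apply: eq_Int => t _; rewrite big_nil.
rewrite big_cons -IH; case: ifPn => Pi.
  rewrite -IntD//; last 2 first.
  - exact: Fi.
  - exact: intble_sum.
  by apply: eq_Int => t _; rewrite big_cons Pi.
by apply: eq_Int => t _; rewrite big_cons (negbTE Pi).
Qed.

Lemma le_Int a b f g : intble a b f -> intble a b g ->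
  (forall t, a <= t <= b -> f t <= g t) -> Int a b f <= Int a b g.
Proof.
by move=> fi gi fg; apply: le_Rintegral => // t/=; rewrite in_itv/=; exact: fg.
Qed.

Lemma Int_ge0 a b f : (forall t, a <= t <= b -> 0 <= f t) -> 0 <= Int a b f.
Proof. by move=> f0; apply: Rintegral_ge0 => t/=; rewrite in_itv/=; exact: f0. Qed.

Lemma le_norm_Int a b f : intble a b f -> `|Int a b f| <= Int a b (fun t => `|f t|).
Proof. by move=> fi; exact: le_normr_Rintegral. Qed.

Lemma le_norm_Int2 a b f g : intble a b f -> intble a b g ->
  (forall t, a <= t <= b -> `|f t| <= g t) -> `|Int a b f| <= Int a b g.
Proof.
move=> fi gi fg; rewrite (le_trans (le_norm_Int fi))//.
by apply: le_Int => //; exact: intble_norm.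
Qed.

Lemma segment_splitE a b c : a <= b -> b <= c ->
  `[a, c]%classic = `[a, b]%classic `|` `]b, c]%classic :> set (measurableTypeR R).
Proof.
move=> ab bc; apply/seteqP; split=> y/=; rewrite !in_itv/=.
  move=> /andP[ay yc]; rewrite ay yc andbT/=.
  by case: (leP y b) => _; [left|right].
move=> [/andP[-> yb]|/andP[bY ->]]; first by rewrite (le_trans yb).
by rewrite (le_trans ab)// ltW.
Qed.

Lemma Int_cat b a c f : a <= b -> b <= c -> intble a c f ->
  Int a c f = Int a b f + Int b c f.
Proof.
move=> ab bc fi; rewrite {1}/Int (segment_splitE ab bc) Rintegral_setU//.
- rewrite -/(Int a b f); congr (_ + _).
  apply: Rintegral_itv_obnd_cbnd; apply: integrableS fi => // y/=.
  rewrite !in_itv/= => /andP[bY ->]; rewrite andbT.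
  by rewrite (le_trans ab)// ltW.
- by rewrite -(segment_splitE ab bc).
- apply/disj_setPS => y [] /=; rewrite !in_itv/= => /andP[_ yb] /andP[bY _].
  by move: (le_lt_trans yb bY); rewrite ltxx.
Qed.

Lemma intble_cat b a c f : a <= b -> b <= c -> intble a b f -> intble b c f ->
  intble a c f.
Proof.
move=> ab bc fi gi; rewrite /intble (segment_splitE ab bc).
have mJ : measurable (`]b, c] : set (measurableTypeR R)) by exact: measurable_itv.
have gi' : mu.-integrable `]b, c] (EFin \o f).
  apply: integrableS gi => // y/=; rewrite !in_itv/= => /andP[bY ->].
  by rewrite ltW.
have mU : measurable_fun (`[a, b]%classic `|` `]b, c]%classic : set (measurableTypeR R))
    (EFin \o f).
  rewrite measurable_funU//; split; [exact: measurable_int fi|].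
  exact: measurable_int gi'.
apply/integrableP; split => //.
rewrite ge0_integral_setU//; last 2 first.
- exact: measurableT_comp.
- apply/disj_setPS => y [] /=; rewrite !in_itv/= => /andP[_ yb] /andP[bY _].
  by move: (le_lt_trans yb bY); rewrite ltxx.
rewrite lte_add_pinfty//.
- by case/integrableP : fi.
- by case/integrableP : gi'.
Qed.

Lemma le_Int_dom a b c d f : a <= c -> c <= d -> d <= b -> intble a b f ->
  (forall t, a <= t <= b -> 0 <= f t) -> Int c d f <= Int a b f.
Proof.
move=> ac cd db fi f0; rewrite (@Int_cat c a)//; last exact: le_trans db.
rewrite (@Int_cat d c b)//; last exact: intbleW fi.
rewrite addrCA lerDl addr_ge0// Int_ge0// => t /andP[h1 h2]; apply: f0.
  by rewrite h1 (le_trans h2)// (le_trans cd).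
by rewrite h2 (le_trans _ h1)// (le_trans ac).
Qed.

(** Lebesgue measure is determined by its values on half-open intervals, so it is enough that
    preimages of these have the right length. This serves translations and the reflection t -> - t
    alike. *)
Let pushforward_lebesgue (phi : measurableTypeR R -> measurableTypeR R) :
  measurable_fun setT phi ->
  (forall a b, a <= b -> mu (phi @^-1` `]a, b]) = (b - a)%:E) ->
  forall A, measurable A -> pushforward mu phi A = mu A.
Proof.
move=> mphi phiE A mA; apply/esym.
pose nu : {measure set (measurableTypeR R) -> \bar R} := pushforward mu phi.
apply: (@lebesgue_measure_unique _ (nu mphi)) => // X [[u v] _ <-] /=.
have [uv|vu] := leP u v.
  rewrite [RHS]phiE// lebesgue_measure_itv/= lte_fin; case: ltP => // vu.
  by rewrite (le_anti (introT andP (conj uv vu))) subrr.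
rewrite set_itv_ge; last by rewrite bnd_simp -leNgt ltW.
by rewrite !measure0.
Qed.

Let change_of_variable (phi : measurableTypeR R -> measurableTypeR R) a b c d f :
  measurable_fun setT phi ->
  (forall u v, u <= v -> mu (phi @^-1` `]u, v]) = (v - u)%:E) ->
  phi @^-1` `[a, b] = `[c, d]%classic ->
  intble a b f ->
  intble c d (f \o phi) /\ Int c d (f \o phi) = Int a b f.
Proof.
move=> mphi phiE phiD fi.
pose nu : {measure set (measurableTypeR R) -> \bar R} := pushforward mu phi.
have nuE := pushforward_lebesgue mphi phiE.
(* The extension by 0 is measurable on the whole line, whereas [f] is known to be measurable on
   [a, b] only. *)
pose g := f \_ `[a, b].
have mg : measurable_fun setT g.
  by apply/(measurable_restrictT _ _).1 => //; exact: intble_measurable.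
have gphi t : t \in `[c, d]%classic -> g (phi t) = f (phi t).
  by rewrite -phiD inE/= => h; rewrite /g patchE ifT// inE.
have gf t : t \in `[a, b]%classic -> g t = f t.
  by move=> tab; rewrite /g patchE ifT.
have mgphi : measurable_fun setT (g \o phi) by exact: measurableT_comp.
have fphii : intble c d (f \o phi).
  apply: (@eq_integrable _ _ _ _ _ _ (EFin \o (g \o phi))) => //.
    by move=> t /gphi /= ->.
  apply/integrableP; split.
    by apply/measurable_EFinP; exact: measurable_funTS.
  rewrite -phiD -(@ge0_integral_pushforward _ _ _ _ _ phi mphi mu `[a, b]%classic
    (fun y => `|(EFin \o g) y|%E))//; last first.
    apply: measurableT_comp => //; apply/measurable_EFinP.
    exact: measurable_funTS.
  rewrite (@eq_measure_integral _ _ _ _ mu (nu mphi)) => [|A mA _].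
    rewrite (@eq_integral _ _ _ mu _ (fun y => `|(EFin \o f) y|%E)).
      by case/integrableP : fi.
    by move=> t /gf /= ->.
  exact: nuE.
split => //.
transitivity (fine (\int[mu]_(x in `[a, b]) (EFin \o g) x)%E); last first.
  by congr fine; apply: eq_integral => t /gf /= ->.
rewrite -(@eq_measure_integral _ _ _ _ mu (nu mphi)) => [|A mA _]; last exact: nuE.
rewrite (@integral_pushforward _ _ _ _ _ phi mphi mu)//.
- by rewrite phiD; congr fine; apply: eq_integral => t /gphi /= ->.
- exact/measurable_EFinP.
- by rewrite phiD; apply: eq_integrable fphii => // t /gphi /= ->.
Qed.

Let shift_preimage c u v : u <= v ->
  mu ((fun t : measurableTypeR R => c + t) @^-1` `]u, v]) = (v - u)%:E.
Proof.
move=> uv; rewrite (_ : _ @^-1` _ = `]u - c, v - c]%classic).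
  rewrite lebesgue_measure_itv/= lte_fin ltrD2r; case: ltP => [_|vu].
    by rewrite -EFinB; congr EFin; ring.
  by rewrite (le_anti (introT andP (conj uv vu))) subrr.
by apply/seteqP; split => y /=; rewrite !in_itv/= ltrBlDl lerBrDl.
Qed.

Lemma intble_shift c a b f : intble (c + a) (c + b) f ->
  intble a b (fun t => f (c + t)).
Proof.
move=> fi; have [] // := @change_of_variable (fun t => c + t) _ _ a b f _ _ _ fi.
- by apply: measurable_funD => //; exact: measurable_cst.
- exact: shift_preimage.
- by apply/seteqP; split => y /=; rewrite !in_itv/= !lerD2l.
Qed.

Lemma Int_shift c a b f : intble (c + a) (c + b) f ->
  Int a b (fun t => f (c + t)) = Int (c + a) (c + b) f.
Proof.
move=> fi; have [] // := @change_of_variable (fun t => c + t) _ _ a b f _ _ _ fi.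
- by apply: measurable_funD => //; exact: measurable_cst.
- exact: shift_preimage.
- by apply/seteqP; split => y /=; rewrite !in_itv/= !lerD2l.
Qed.

Let opp_preimage u v : u <= v ->
  mu ((fun t : measurableTypeR R => - t) @^-1` `]u, v]) = (v - u)%:E.
Proof.
move=> uv; rewrite (_ : _ @^-1` _ = `[- v, - u[%classic).
  rewrite lebesgue_measure_itv/= lte_fin ltrN2; case: ltP => [_|vu].
    by rewrite -EFinB; congr EFin; ring.
  by rewrite (le_anti (introT andP (conj uv vu))) subrr.
by apply/seteqP; split => y /=; rewrite !in_itv/= lerNl ltrNr andbC.
Qed.

Lemma intble_opp a b f : intble (- b) (- a) f -> intble a b (fun t => f (- t)).
Proof.
move=> fi; have [] // := @change_of_variable (fun t => - t) _ _ a b f _ _ _ fi.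
- exact: oppr_measurable.
- by apply/seteqP; split => y /=; rewrite !in_itv/= !lerN2 andbC.
Qed.

Lemma Int_opp a b f : intble (- b) (- a) f ->
  Int a b (fun t => f (- t)) = Int (- b) (- a) f.
Proof.
move=> fi; have [] // := @change_of_variable (fun t => - t) _ _ a b f _ _ _ fi.
- exact: oppr_measurable.
- by apply/seteqP; split => y /=; rewrite !in_itv/= !lerN2 andbC.
Qed.

End integration_on_segments.
#[export] Hint Resolve measurable_segment : core.

(** * Periodic functions and averages at a point *)

Section periodic_functions.
Context {R : realType}.
Implicit Types (f g k : R -> R) (a b c x l h e d : R).
Local Notation mu := (@lebesgue_measure R).

#[global] Instance ae_lebesgue_filter : Filter (nbhs (almost_everywhere mu)).
Proof. exact: (ae_filter_ringOfSetsType mu). Qed.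

Lemma periodicNn f T : periodic f T -> forall n a, f (a - T *+ n) = f a.
Proof. by move=> fT n a; rewrite -{2}(subrK (T *+ n) a) periodicn. Qed.

Lemma L1_intble a b f : L1 f -> intble a b f.
Proof.
have p0 := @pi_gt0 R; have p2 := @pi_ge2 R.
move=> [fT fi].
have H n : intble (- pi) (- pi + pi *+ 2 *+ n) f.
  elim: n => [|n IH].
    by apply: intbleW fi => //; rewrite mulr0n addr0 ge0_cp// ltW.
  have qn : 0 <= pi * n%:R :> R by rewrite mulr_ge0// ltW.
  apply: (@intble_cat _ (- pi + pi *+ 2 *+ n)) => //.
  - by rewrite lerDl mulrn_wge0// mulrn_wge0// ltW.
  - by rewrite lerD2l mulrSr; lra.
  - have -> : f = (fun t => f (- (pi *+ 2 *+ n) + t)).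
      by apply/funext => t; rewrite addrC periodicNn.
    apply: intble_shift; apply: intbleW fi; first lra.
    by rewrite mulrSr; lra.
have := archi_boundP (normr_ge0 a); set n := Num.bound _ => an.
have := archi_boundP (normr_ge0 b); set m := Num.bound _ => bm.
move: an bm; rewrite !ltr_norml => /andP[a1 a2] /andP[b1 b2].
(* As |a| < n and |b| < m, shifting by n + m periods moves [a, b] to the right of - pi, where [H]
   applies with 2 (n + m) + 1 periods. *)
have -> : f = (fun t => f (pi *+ 2 *+ (n + m) + t)).
  by apply/funext => t; rewrite addrC periodicn.
have q2 : 2 * (n + m)%:R <= pi * (n + m)%:R :> R by rewrite ler_wpM2r.
apply: intble_shift; apply: intbleW (H ((n + m).*2.+1)%N).
  rewrite -[pi *+ 2 *+ _]mulr_natr -[pi *+ 2]mulr_natr mulrAC.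
  move: q2; rewrite natrD; lra.
rewrite -[pi *+ 2 *+ (n + m)]mulr_natr -[pi *+ 2]mulr_natr mulrAC.
rewrite -[X in _ <= _ + X]mulr_natr mulrAC.
have -> : ((n + m).*2.+1)%:R = (n + m)%:R * 2 + 1 :> R.
  by rewrite -natr1 -muln2 natrM.
by move: q2; rewrite natrD; lra.
Qed.

Lemma L1_measurable f : L1 f -> measurable_fun setT f.
Proof.
move=> f1; have -> : [set: R] = \bigcup_n `[(- n%:R : R), n%:R]%classic.
  apply/seteqP; split=> // x _; have := archi_boundP (normr_ge0 x).
  by rewrite ltr_norml => /andP[? ?]; exists (Num.bound `|x|) => //=; rewrite in_itv/= !ltW.
apply/measurable_fun_bigcup => n; first exact: measurable_segment.
by apply: intble_measurable; exact: L1_intble.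
Qed.

Lemma intble_L1 f : periodic f (pi *+ 2) -> intble (- pi) pi f -> L1 f.
Proof. by []. Qed.

Lemma L1_continuous f : periodic f (pi *+ 2) -> continuous f -> L1 f.
Proof. by move=> fT cf; apply: intble_L1 => //; exact: intble_continuous. Qed.

Lemma L1_mulc f k : L1 f -> periodic k (pi *+ 2) -> continuous k ->
  L1 (fun t => f t * k t).
Proof.
move=> f1 kT ck; apply: intble_L1; first by move=> t; rewrite kT f1.1.
by apply: intbleMc => //; exact: L1_intble.
Qed.

Lemma L1_shift x f : L1 f -> L1 (fun t => f (x + t)).
Proof.
move=> f1; split; first by move=> t; rewrite addrA f1.1.
by apply: intble_shift; exact: L1_intble.
Qed.

Lemma L1_opp f : L1 f -> L1 (fun t => f (- t)).
Proof.
move=> f1; split; last by apply: intble_opp; exact: L1_intble.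
by move=> t; rewrite opprD -[X in _ + X]mulr1n; have := periodicNn f1.1 1 (- t).
Qed.

Lemma L1_rshift x f : L1 f -> L1 (fun t => f (x - t)).
Proof. by move=> f1; have := L1_opp (L1_shift x f1). Qed.

Lemma Int_period x f : L1 f -> Int (- pi) pi (fun t => f (x + t)) = Int (- pi) pi f.
Proof.
have p0 := @pi_gt0 R; move=> f1.
have fi a b : intble a b f by exact: L1_intble.
have Tab a b : Int (a + pi *+ 2) (b + pi *+ 2) f = Int a b f.
  rewrite ![_ + pi *+ 2]addrC -Int_shift//; apply: eq_Int => t _.
  by rewrite addrC f1.1.
(* The segment [a, b + 2 pi] is cut at b and at a + 2 pi; the pieces over [a, b] and over its
   translate agree. *)
have H a b : a <= b -> Int b (b + pi *+ 2) f = Int a (a + pi *+ 2) f.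
  move=> ab; have p2 : 0 <= (pi : R) *+ 2 by rewrite mulrn_wge0// ltW.
  have := @Int_cat _ (a + pi *+ 2) a (b + pi *+ 2) f.
  rewrite (@Int_cat _ b a)//; last by rewrite lerDl.
  rewrite Tab => E; apply: (addrI (Int a b f)).
  by rewrite E// ?lerDl// ?lerD2r// addrC.
rewrite Int_shift//.
have e1 : x + pi = (x - pi) + pi *+ 2 by rewrite mulr2n; ring.
have e2 : (pi : R) = - pi + pi *+ 2 by rewrite mulr2n; ring.
have -> : Int (- pi) pi f = Int (- pi) (- pi + pi *+ 2) f by rewrite -e2.
rewrite e1; have [xp|xp] := leP (x - pi) (- pi).
  by rewrite (H _ _ xp).
exact: (H _ _ (ltW xp)).
Qed.

Lemma Int_sym a f : 0 <= a -> intble (- a) a f ->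
  Int (- a) a f = Int 0 a (fun t => f t + f (- t)).
Proof.
move=> a0 fi; have a0' : - a <= 0 by rewrite oppr_le0.
rewrite (@Int_cat _ 0)// IntD//; last 2 first.
- exact: intbleW fi.
- by apply: intble_opp; rewrite oppr0; apply: intbleW fi.
rewrite addrC; congr (_ + _).
by rewrite Int_opp oppr0//; exact: intbleW fi.
Qed.

(** Folding onto [0, pi] makes an even kernel act on f (x + t) + f (x - t) and an odd one on f (x +
    t) - f (x - t). *)
Lemma Int_conv f k x : L1 f -> periodic k (pi *+ 2) -> continuous k ->
  Int (- pi) pi (fun t => f t * k (t - x)) =
  Int 0 pi (fun t => f (x + t) * k t + f (x - t) * k (- t)).
Proof.
move=> f1 kT ck.
have ck' : continuous (fun t => k (t - x)).
  move=> t; apply: continuous_comp => //=; last exact: ck.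
  by apply: cvgB; [exact: cvg_id|exact: cvg_cst].
have kT' : periodic (fun t => k (t - x)) (pi *+ 2).
  by move=> t; rewrite addrAC kT.
rewrite -(Int_period x (L1_mulc f1 kT' ck')) Int_sym//.
- by apply: eq_Int => t _; rewrite ![x + _]addrC !addrK.
- exact: pi_ge0.
- by apply: L1_intble; apply: (L1_shift x (L1_mulc f1 kT' ck')).
Qed.

(** A one-sided Lebesgue point with value l. Unlike a one-sided limit, this is insensitive to a
    change of f on a null set, so it can be transferred between f and any representative. *)
Definition ravg f x l := forall e, 0 < e -> exists2 d, 0 < d &
  forall h, 0 < h -> h <= d -> Int 0 h (fun t => `|f (x + t) - l|) <= e * h.

Definition lavg f x l := forall e, 0 < e -> exists2 d, 0 < d &
  forall h, 0 < h -> h <= d -> Int 0 h (fun t => `|f (x - t) - l|) <= e * h.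

Lemma ae_le_Int a b f g : intble a b f -> intble a b g ->
  (\forall t \ae mu, a <= t <= b -> f t <= g t) -> Int a b f <= Int a b g.
Proof.
move=> fi gi [N [mN N0 fgN]].
rewrite /Int /Rintegral (negligible_integral mN _ fi N0)//.
rewrite (negligible_integral mN _ gi N0)//.
have mD : measurable (`[a, b]%classic `\` N : set (measurableTypeR R)).
  exact: measurableD.
have fi' : mu.-integrable (`[a, b] `\` N) (EFin \o f) by apply: integrableS fi.
have gi' : mu.-integrable (`[a, b] `\` N) (EFin \o g) by apply: integrableS gi.
rewrite -/(Rintegral mu (`[a, b] `\` N) f) -/(Rintegral mu (`[a, b] `\` N) g).
apply: le_Rintegral => // t /= [tab tN].
apply: contrapT => nfg; apply: tN; apply: fgN => /= h.
by apply: nfg; apply: h; rewrite in_itv in tab.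
Qed.

Lemma ae_eq_Int a b f g : intble a b f -> intble a b g ->
  f = g %[ae mu] -> Int a b f = Int a b g.
Proof.
move=> fi gi fg; apply: le_anti; apply/andP; split; apply: ae_le_Int => //.
- by apply: filterS fg => t /(_ I) -> _.
- by apply: filterS fg => t /(_ I) -> _.
Qed.

Lemma ravg_cvg f g x l : L1 f -> f = g %[ae mu] -> g y @[y --> x^'+] --> l ->
  ravg f x l.
Proof.
move=> f1 fg gl e e0.
move/cvgrPdist_le : gl => /(_ _ e0) [d /= d0 gd].
exists (d / 2); first by rewrite divr_gt0.
move=> h h0 hd; have hd' : h < d.
  by rewrite (le_lt_trans hd)// ltr_pdivrMr// ltr_pMr// ltr1n.
have f'i : intble (x + 0) (x + h) (fun t => `|f t - l|).
  by apply/intble_norm/intbleB; [exact: L1_intble|exact: intble_cst].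
rewrite (Int_shift f'i) addr0 -[leRHS](_ : Int x (x + h) (fun=> e) = _); last first.
  by rewrite Int_cst ?lerDl 1?ltW// addrC addKr.
apply: ae_le_Int => //; [by rewrite -{1}[x]addr0|exact: intble_cst|].
have [N [mN N0 fgN]] := fg.
(* The one-sided limit says nothing about the value at x itself, hence the additional null set
   {x}. *)
exists (N `|` [set x]); split.
- by apply: measurableU => //; exact: measurable_set1.
- by rewrite measureU0//; exact: lebesgue_measure_set1.
move=> t /= nt; have [->|tx] := eqVneq t x; [by right|left].
apply: fgN => /= h1; apply: nt => /andP[xt th]; rewrite h1// distrC.
have xt' : x < t by rewrite lt_neqAle eq_sym tx.
apply: gd => //=; rewrite distrC ger0_norm ?subr_ge0//.
by rewrite (le_lt_trans _ hd')// lerBlDl.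
Qed.

Lemma lavg_cvg f g x l : L1 f -> f = g %[ae mu] -> g y @[y --> x^'-] --> l ->
  lavg f x l.
Proof.
move=> f1 fg gl e e0.
move/cvgrPdist_le : gl => /(_ _ e0) [d /= d0 gd].
exists (d / 2); first by rewrite divr_gt0.
move=> h h0 hd; have hd' : h < d.
  by rewrite (le_lt_trans hd)// ltr_pdivrMr// ltr_pMr// ltr1n.
have f'i a b : intble a b (fun t => `|f t - l|).
  by apply/intble_norm/intbleB; [exact: L1_intble|exact: intble_cst].
have -> : Int 0 h (fun t => `|f (x - t) - l|) = Int (x - h) x (fun t => `|f t - l|).
  have := @Int_shift _ x (- h) 0 (fun t => `|f t - l|) (f'i _ _).
  rewrite addr0 => <-.
  have := @Int_opp _ 0 h (fun t => `|f (x + t) - l|).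
  by rewrite oppr0 => ->//; apply: (@intble_shift _ x _ _ (fun t => `|f t - l|)).
rewrite -[leRHS](_ : Int (x - h) x (fun=> e) = _); last first.
  by rewrite Int_cst ?gerBl 1?ltW// opprB addrC subrK.
apply: ae_le_Int => //; [exact: intble_cst|].
have [N [mN N0 fgN]] := fg.
exists (N `|` [set x]); split.
- by apply: measurableU => //; exact: measurable_set1.
- by rewrite measureU0//; exact: lebesgue_measure_set1.
move=> t /= nt; have [->|tx] := eqVneq t x; [by right|left].
apply: fgN => /= h1; apply: nt => /andP[xt th]; rewrite h1// distrC.
have xt' : t < x by rewrite lt_neqAle tx.
apply: gd => //=; rewrite ger0_norm ?subr_ge0//.
by rewrite (le_lt_trans _ hd')// lerBlDl -lerBlDr.
Qed.

(** Lebesgue's differentiation theorem gives the averages over ]x - h, x + h[; the integral of |f -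
    f x| over either half is at most the integral over the whole. *)
Lemma ae_avg f : L1 f -> \forall x \ae mu, ravg f x (f x) /\ lavg f x (f x).
Proof.
move=> f1; have lf : locally_integrable setT f.
  split; [exact: L1_measurable|exact: openT|] => K _ cK.
  have [M [_ KM]] := compact_bounded cK.
  have KM' : K `<=` `[(- (M + 1)), M + 1].
    by move=> t Kt; rewrite /= in_itv/= -ler_norml; apply: KM Kt; rewrite ltrDl.
  have := L1_intble (- (M + 1)) (M + 1) f1 => /integrableP[_].
  apply: le_lt_trans; apply: ge0_subset_integral => //.
  - exact: compact_measurable.
  - apply/measurable_EFinP; apply: measurableT_comp => //.
    by apply: measurable_funTS; exact: L1_measurable.
have := lebesgue_differentiation lf; apply: filterS => x xf.
have H e : 0 < e -> exists2 d, 0 < d & forall h, 0 < h -> h <= d ->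
    Int (x - h) (x + h) (fun y => `|f y - f x|) <= e * h.
  move=> e0; move: xf => /fine_cvgP[[d1 /= d10 fin] /cvgrPdist_le].
  (* The ball has length 2 h, so an average of at most e / 2 means an integral of at most e h. *)
  move=> /(_ (e / 2)); rewrite divr_gt0// => /(_ isT)[d2 /= d20 Hd2].
  exists (Num.min d1 d2 / 2); first by rewrite divr_gt0// lt_min d10.
  move=> h h0; rewrite ler_pdivlMr// le_min => /andP[h1 h2].
  have hd1 : `|0 - h| < d1 by rewrite sub0r normrN gtr0_norm//; lra.
  have hd2 : `|0 - h| < d2 by rewrite sub0r normrN gtr0_norm//; lra.
  have := Hd2 h hd2 h0; have := fin h hd1 h0.
  rewrite /= sub0r normrN /davg /iavg.
  have f'i a b : intble a b (fun t => `|f t - f x|).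
    by apply/intble_norm/intbleB; [exact: L1_intble|exact: intble_cst].
  rewrite lebesgue_measure_ball; last exact: ltW.
  set J := (\int[_]_(_ in _) _)%E => fJ.
  have JE : J = (Int (x - h) (x + h) (fun y => `|f y - f x|))%:E.
    rewrite /J ball_itv -(@integral_itv_bndoo _ _ _ _ true false); last first.
      apply/measurable_EFinP/measurable_funTS; apply: measurableT_comp => //.
      by apply: measurable_funB => //; exact: L1_measurable.
    rewrite /Int /Rintegral fineK//; apply: integrable_fin_num => //.
    exact: f'i.
  rewrite JE inver mulrn_eq0/= gt_eqF//= -?EFinM/=.
  have h3 : 0 < h *+ 2 by rewrite mulrn_wgt0.
  move=> H; have := le_trans (ler_norm _) H.
  by rewrite ler_pdivrMl//; lra.
have f'i a b : intble a b (fun t => `|f t - f x|).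
  by apply/intble_norm/intbleB; [exact: L1_intble|exact: intble_cst].
split=> e /H[d d0 Hd]; exists d => // h h0 hd; apply: le_trans (Hd h h0 hd).
  rewrite (@Int_shift _ x 0 h (fun t => `|f t - f x|))// addr0.
  by apply: le_Int_dom => //; rewrite ?gerBl ?lerDl// ltW.
have := @Int_opp _ 0 h (fun t => `|f (x + t) - f x|).
rewrite oppr0 => ->; last first.
  exact: (@intble_shift _ x _ _ (fun t => `|f t - f x|)).
rewrite (@Int_shift _ x _ 0 (fun t => `|f t - f x|))// addr0.
by apply: le_Int_dom => //; rewrite ?gerBl ?lerDl// ltW.
Qed.

(** Near 0 only the averages of [psi] are small, not its values, so the integral is cut dyadically:
    by the decay of [k], the block [h / 2, h] contributes at most 4 C e / (N h), and these bounds
    form a geometric series. Below 1 / N the bound C N on [k] is used instead, and beyond d the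
    decay alone suffices. *)
Lemma approximate_identity (psi k : R -> R) N C e d : 0 < d -> d <= pi ->
  0 < N -> 0 <= e -> 0 <= C -> intble 0 pi psi ->
  (forall t, 0 <= t <= pi -> 0 <= psi t) ->
  (forall h, 0 < h -> h <= d -> Int 0 h psi <= e * h) ->
  (forall t, 0 <= t <= pi -> `|k t| <= C * N) ->
  (forall t, 0 <= t <= pi -> `|k t| * (N * t ^+ 2) <= C) ->
  intble 0 pi (fun t => psi t * k t) ->
  Int 0 pi (fun t => psi t * `|k t|) <= C * (9 * e + Int 0 pi psi / (N * d ^+ 2)).
Proof.
move=> d0 dpi N0 e0 C0 psii psi0 avg kN kt pk.
have pki : intble 0 pi (fun t => psi t * `|k t|).
  apply: eq_intble (intble_norm pk) => t tpi.
  by rewrite normrM ger0_norm// psi0.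
have sub a b : 0 <= a -> b <= pi -> intble a b (fun t => psi t * `|k t|).
  by move=> a0 bp; exact: intbleW pki.
have sub' a b : 0 <= a -> b <= pi -> intble a b psi.
  by move=> a0 bp; exact: intbleW psii.
have tail a b : 0 < a -> a <= b -> b <= pi ->
    Int a b (fun t => psi t * `|k t|) <= C / (N * a ^+ 2) * Int 0 b psi.
  move=> a0 ab bp; apply: (@le_trans _ _ (Int a b (fun t => C / (N * a ^+ 2) * psi t))).
    apply: le_Int; [exact/sub/bp/ltW|apply/intbleZ/sub' => //; exact: ltW|].
    move=> t /andP[at_ tb]; have t0 : 0 < t by exact: lt_le_trans at_.
    have tp : 0 <= t <= pi by rewrite ltW//= (le_trans tb).
    rewrite mulrC ler_wpM2r ?psi0//.
    rewrite ler_pdivlMr; last by rewrite mulr_gt0// exprn_gt0.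
    apply: le_trans (kt t tp); rewrite ler_wpM2l// ler_wpM2l ?(ltW N0)//.
    by rewrite lerXn2r ?nnegrE// ltW.
  rewrite IntZ; last by apply: sub' => //; exact: ltW.
  apply: ler_wpM2l; first by rewrite divr_ge0// mulr_ge0 ?sqr_ge0// ltW.
  apply: le_Int_dom => //; [exact: ltW|exact: sub'|].
  by move=> t /andP[t0 tb]; rewrite psi0// t0 (le_trans tb).
(* The constant is 1 for N h <= 1, plus 4 / 2 ^+ i for each doubling i < j, which sums to 9 - 8 / 2
   ^+ j. *)
have near_part j : forall h, 0 < h -> h <= d -> N * h <= 2 ^+ j ->
    Int 0 h (fun t => psi t * `|k t|) <= C * e * (9 - 8 / 2 ^+ j).
  have Ce : 0 <= C * e by rewrite mulr_ge0.
  elim: j => [|j IH] h h0 hd Nh.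
    have hp : h <= pi by exact: le_trans dpi.
    rewrite expr0 divr1 (_ : 9 - 8 = 1); last by ring.
    apply: (@le_trans _ _ (Int 0 h (fun t => C * N * psi t))).
      apply: le_Int; [exact: sub|apply/intbleZ/sub' => //|].
      move=> t /andP[t0 th]; have tp : 0 <= t <= pi by rewrite t0 (le_trans th).
      by rewrite mulrC ler_wpM2r ?psi0// kN.
    rewrite IntZ; last exact: sub'.
    apply: (@le_trans _ _ (C * N * (e * h))).
      by rewrite ler_wpM2l ?mulr_ge0 ?(ltW N0)// avg.
    rewrite mulr1 (_ : _ * _ = C * e * (N * h)); last by ring.
    by rewrite ler_piMr// -(expr0 2).
  have hp : h <= pi by exact: le_trans dpi.
  have h2 : 0 < h / 2 by rewrite divr_gt0.
  have h2h : h / 2 <= h by rewrite ler_pdivrMr// ler_pMr// ler1n.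
  have IH2 := IH (h / 2) h2 (le_trans h2h hd).
  have p2 : 0 < 2 ^+ j :> R by rewrite exprn_gt0.
  have [Nh2|Nh2] := leP (N * h) (2 ^+ j).
    apply: le_trans (IH h h0 hd Nh2) _; rewrite ler_wpM2l// lerD2l lerN2.
    rewrite ler_wpM2l// lef_pV2 ?posrE ?exprn_gt0//.
    by rewrite exprS ler_peMl ?(ltW p2)// ler1n.
  have h2pi : h / 2 <= pi by exact: le_trans hp.
  rewrite (@Int_cat _ (h / 2))//; [|exact: ltW|exact: sub].
  apply: (@le_trans _ _ (C * e * (9 - 8 / 2 ^+ j) + C * e * (4 / 2 ^+ j))).
    apply: lerD; first by apply: IH2; move: Nh; rewrite exprS; lra.
    apply: le_trans (tail _ _ h2 h2h hp) _.
    apply: (@le_trans _ _ (C / (N * (h / 2) ^+ 2) * (e * h))).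
      by rewrite ler_wpM2l ?avg// divr_ge0// mulr_ge0 ?sqr_ge0// ltW.
    rewrite (_ : _ * _ = C * e * (4 / (N * h))); last by field; rewrite !gt_eqF.
    rewrite ler_wpM2l// ler_wpM2l// lef_pV2 ?posrE ?mulr_gt0//.
    exact: ltW.
  rewrite -mulrDr ler_wpM2l// exprS invfM; lra.
rewrite (@Int_cat _ d)//; last exact: ltW.
rewrite mulrDr; apply: lerD; last first.
  apply: le_trans (tail _ _ d0 dpi (lexx _)) _.
  by rewrite mulrAC -mulrA.
have [j Nj] : exists j, N * d <= 2 ^+ j.
  exists (Num.bound (N * d)); apply/ltW/(lt_trans (archi_boundP _)).
    by rewrite mulr_ge0// ltW.
  by rewrite -natrX ltr_nat ltn_expl.
apply: le_trans (near_part j d d0 (lexx _) Nj) _.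
by rewrite -mulrA ler_wpM2l// mulrC ler_wpM2r// gerBl divr_ge0.
Qed.

End periodic_functions.

(** [Q x d] stands for a property that holds within distance d of x. If no uniform radius existed,
    each radius 1 / (n + 1) would fail at some y n; but the radius granted at a cluster point of
    these covers the neighbourhood of y n for some large n. *)
Lemma lebesgue_number {R : realType} (a b : R) (Q : R -> R -> Prop) :
  (forall x, exists2 d, 0 < d & Q x d) ->
  exists2 d, 0 < d & forall y, a <= y <= b ->
    exists x e, Q x e /\ forall z, `|z - y| <= d -> `|z - x| < e.
Proof.
move=> HQ; apply: contrapT => nH.
have /choice[y Hy] : forall n : nat, exists y, a <= y <= b /\
    ~ exists x e, Q x e /\ forall z, `|z - y| <= n.+1%:R^-1 -> `|z - x| < e.
  move=> n; apply: contrapT => H; apply: nH; exists n.+1%:R^-1 => // y yab.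
  by apply: contrapT => H'; apply: H; exists y.
have cab := @segment_compact R a b.
have [x [_ xc]] : `[a, b]%classic `&` cluster (y @ \oo) !=set0.
  apply: cab; exists 0%N => // n _ /=; rewrite in_itv/=; exact: (Hy n).1.
have [e e0 Qe] := HQ x.
have e2 : 0 < e / 2 by rewrite divr_gt0.
have [_ [[n nN <-] xn]] :=
  xc [set y n | n in [set n | (Num.bound (e / 2)^-1 <= n)%N]] (ball x (e / 2))
  (ex_intro2 _ _ (Num.bound (e / 2)^-1) I (fun n hn => ex_intro2 _ _ n hn erefl))
  (nbhsx_ballx _ _ e2).
apply: (Hy n).2; exists x, e; split=> // z zy.
have ne : n.+1%:R^-1 < e / 2.
  rewrite -[e / 2]invrK ltf_pV2 ?posrE ?invr_gt0//.
  apply: lt_le_trans (archi_boundP _) _; first by rewrite invr_ge0 ltW.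
  by rewrite ler_nat leqW.
have -> : z - x = (z - y n) + (y n - x) by ring.
apply: le_lt_trans (ler_normD _ _) _; rewrite [e]splitr; apply: ltrD.
  exact: le_lt_trans zy _.
by move: xn; rewrite /ball/= distrC.
Qed.

Lemma periodicz {R : realType} (f : R -> R) T : periodic f T ->
  forall (m : int) a, f (a + T *~ m) = f a.
Proof. by move=> fT [n|n] a; [exact: periodicn|exact: periodicNn]. Qed.

Lemma period_reduce {R : realType} (x : R) :
  exists m : int, - pi <= x + (pi *+ 2) *~ m <= pi.
Proof.
have p0 := @pi_gt0 R; have T0 : 0 < (pi : R) *+ 2 by rewrite mulrn_wgt0.
set q := (x + pi) / (pi *+ 2); exists (- Num.floor q).
have qE : x = q * (pi *+ 2) - pi by rewrite /q divfK ?gt_eqF// addrK.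
have /andP[q1 q2] := mem_rg1_floor q.
have h1 : (Num.floor q)%:~R * (pi *+ 2) <= q * (pi *+ 2) :> R by rewrite ler_pM2r.
have h2 : q * (pi *+ 2) <= ((Num.floor q)%:~R + 1) * (pi *+ 2) :> R.
  by rewrite ler_pM2r// ltW.
rewrite mulrNz -mulrzl; move: h1 h2 qE.
set u := _%:~R * _; set v := q * _; rewrite mulrDl mul1r -/u => h1 h2 qE.
by apply/andP; split; lra.
Qed.

Lemma periodic_bounded {R : realType} (f : R -> R) : periodic f (pi *+ 2) ->
  continuous f -> exists2 M, 0 <= M & forall x, `|f x| <= M.
Proof.
move=> fT cf; have [M M0 fM] := segment_bounded (- pi) pi cf; exists M => // x.
by have [m /fM] := period_reduce x; rewrite (periodicz fT).
Qed.

Lemma periodic_unif_continuous {R : realType} (f : R -> R) :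
  periodic f (pi *+ 2) -> continuous f ->
  forall e, 0 < e -> exists2 d, 0 < d & forall x y, `|x - y| <= d -> `|f x - f y| <= e.
Proof.
move=> fT cf e e0; have e2 : 0 < e / 2 by rewrite divr_gt0.
have [] := @lebesgue_number _ (- pi) pi
    (fun x d => forall z, `|z - x| < d -> `|f x - f z| <= e / 2).
  move=> x; have /cvgrPdist_le/(_ _ e2)[d /= d0 xd] := cf x.
  by exists d => // z zx; apply: xd; rewrite /= distrC.
move=> d d0 Hd; exists d => // x y xy.
have [m /Hd[z [r [zr zd]]]] := period_reduce x.
rewrite -(periodicz fT m x) -(periodicz fT m y) [e]splitr.
set X := x + _; set Y := y + _.
have -> : f X - f Y = (f z - f Y) - (f z - f X) by ring.
apply: le_trans (ler_normB _ _) _; apply: lerD; apply: zr; apply: zd.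
  by rewrite /X /Y opprD addrACA subrr addr0 distrC.
by rewrite subrr normr0 ltW.
Qed.

Lemma cvg_seqP {R : realType} (u : nat -> R) l : u @ \oo --> l <->
  forall e, 0 < e -> exists N, forall n, (N <= n)%N -> `|u n - l| <= e.
Proof.
split=> [/cvgrPdist_le H e /H [N _ HN]|H].
  by exists N => n Nn; rewrite distrC; exact: HN.
apply/cvgrPdist_le => e /H [N HN]; exists N => // n Nn.
by rewrite /= distrC; exact: HN.
Qed.

Lemma approximate_identity_cvg {R : realType} (psi : R -> R) (k : nat -> R -> R) C :
  0 <= C -> intble 0 pi psi -> (forall t, 0 <= t <= pi -> 0 <= psi t) ->
  (forall e, 0 < e -> exists2 d, 0 < d &
    forall h, 0 < h -> h <= d -> Int 0 h psi <= e * h) ->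
  (forall n, continuous (k n)) ->
  (forall n t, 0 <= t <= pi -> `|k n t| <= C * n.+1%:R) ->
  (forall n t, 0 <= t <= pi -> `|k n t| * (n.+1%:R * t ^+ 2) <= C) ->
  forall e, 0 < e -> exists N, forall n, (N <= n)%N ->
    Int 0 pi (fun t => psi t * `|k n t|) <= e.
Proof.
move=> C0 psii psi0 avg ck kN kt e e0.
have p0 := @pi_gt0 R.
have C1 : 0 < C + 1 by rewrite ltr_wpDl.
(* Nine times this is half of e / (C + 1), the other half being left to the part beyond d'. Dividing
   by C + 1 rather than C allows C = 0. *)
have e1 : 0 < e / (C + 1) / 18 by rewrite !divr_gt0.
have [d d0 Hd] := avg _ e1.
pose d' := Num.min d pi.
have d'0 : 0 < d' by rewrite lt_min d0 p0.
have d'p : d' <= pi by rewrite ge_min lexx orbT.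
set J := Int 0 pi psi; have J0 : 0 <= J by exact: Int_ge0.
have e2 : 0 < e / (C + 1) / 2 by rewrite !divr_gt0.
pose B := J / d' ^+ 2 / (e / (C + 1) / 2).
have B0 : 0 <= B by rewrite !divr_ge0// ltW// exprn_gt0.
exists (Num.bound B) => n Nn.
have nB : B <= n.+1%:R.
  by apply/ltW/(lt_le_trans (archi_boundP B0)); rewrite ler_nat leqW.
apply: le_trans (@approximate_identity _ psi (k n) n.+1%:R C _ d'
  d'0 d'p _ (ltW e1) C0 psii psi0 _ (kN n) (kt n) _) _ => //.
- by move=> h h0; rewrite le_min => /andP[hd _]; exact: Hd.
- exact: intbleMc.
rewrite -/J; have H : J / (n.+1%:R * d' ^+ 2) <= e / (C + 1) / 2.
  rewrite invfM mulrCA mulrC ler_pdivrMr//.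
  by move: nB; rewrite /B ler_pdivrMr// [leRHS]mulrC.
apply: (@le_trans _ _ (C * (e / (C + 1)))).
  apply: ler_wpM2l => //; move: H; set z := e / (C + 1); set y := J / _; lra.
rewrite mulrCA ger_pMr// ler_pdivrMr//; lra.
Qed.

(** * Trigonometric kernels *)

Section trigonometric_kernels.
Context {R : realType}.
Implicit Types (f g : R -> R) (u v : nat -> R) (x t l : R) (k n N : nat).
Local Notation mu := (@lebesgue_measure R).

Lemma continuous_cosM x : continuous (fun t => cos (x * t) : R).
Proof.
move=> t; apply: continuous_comp; last exact: continuous_cos.
by apply: cvgM; [exact: cvg_cst|exact: cvg_id].
Qed.

Lemma continuous_sinM x : continuous (fun t => sin (x * t) : R).
Proof.
move=> t; apply: continuous_comp; last exact: continuous_sin.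
by apply: cvgM; [exact: cvg_cst|exact: cvg_id].
Qed.

Lemma cosM_periodic k : periodic (fun t => cos (k%:R * t) : R) (pi *+ 2).
Proof.
by move=> t; rewrite mulrDr [k%:R * (pi *+ 2)]mulr_natl periodicn//; exact: cosD2pi.
Qed.

Lemma sinM_periodic k : periodic (fun t => sin (k%:R * t) : R) (pi *+ 2).
Proof.
by move=> t; rewrite mulrDr [k%:R * (pi *+ 2)]mulr_natl periodicn//; exact: sinD2pi.
Qed.

Lemma Int_FTC F f (a b : R) : a < b -> (forall x, is_derive x 1 F (f x)) ->
  continuous f -> Int a b f = F b - F a.
Proof.
move=> ab Ff cf; rewrite /Int /Rintegral (@continuous_FTC2 _ f F)//.
- exact: continuous_subspaceT.
- have cF x : {for x, continuous F}.
    by apply: differentiable_continuous; apply/derivable1_diffP; case: (Ff x).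
  split=> [x _||].
  + by case: (Ff x).
  + exact/cvg_at_right_filter/cF.
  + exact/cvg_at_left_filter/cF.
- by move=> x _; rewrite derive1E; case: (Ff x).
Qed.

Lemma is_derive_sinM (c x : R) :
  is_derive x 1 (fun t => sin (c * t)) (c * cos (c * x)).
Proof.
have h : is_derive x 1 ( *%R c : R -> R) c.
  by have := is_deriveZ c (is_derive_id x 1); rewrite /GRing.scale/= mulr1.
by rewrite mulrC; exact: (is_derive1_comp (is_derive_sin _) h).
Qed.

Lemma is_derive_cosM (c x : R) :
  is_derive x 1 (fun t => - cos (c * t)) (c * sin (c * x)).
Proof.
have h : is_derive x 1 ( *%R c : R -> R) c.
  by have := is_deriveZ c (is_derive_id x 1); rewrite /GRing.scale/= mulr1.
have h2 : is_derive x 1 (fun t => cos (c * t)) (- sin (c * x) * c).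
  exact: (is_derive1_comp (is_derive_cos _) h).
have := is_deriveN h2; rewrite mulNr opprK mulrC; exact.
Qed.

Lemma sin_natpi k : sin (k%:R * pi) = 0 :> R.
Proof.
elim: k => [|k IH]; first by rewrite mul0r sin0.
by rewrite -addn1 natrD mulrDl mul1r sinDpi IH oppr0.
Qed.

Lemma cos_natpi k : cos (k%:R * pi) = (-1) ^+ k :> R.
Proof.
elim: k => [|k IH]; first by rewrite mul0r cos0 expr0.
by rewrite -addn1 natrD mulrDl mul1r cosDpi IH exprD expr1 mulrN1.
Qed.

Lemma Int_cosM k : (0 < k)%N -> Int 0 pi (fun t => cos (k%:R * t) : R) = 0.
Proof.
move=> k0; have k0' : (k%:R : R) != 0 by rewrite pnatr_eq0 -lt0n.
apply: (mulfI k0'); rewrite -IntZ; last exact/intble_continuous/continuous_cosM.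
have cf : continuous (fun t : R => k%:R * cos (k%:R * t)).
  by move=> t; apply: cvgM; [exact: cvg_cst|exact: continuous_cosM].
rewrite (Int_FTC (@pi_gt0 R) (is_derive_sinM k%:R) cf).
by rewrite sin_natpi !mulr0 sin0 subr0.
Qed.

Lemma Int_sinM k : (0 < k)%N ->
  Int 0 pi (fun t => sin (k%:R * t) : R) = (1 - (-1) ^+ k) / k%:R.
Proof.
move=> k0; have k0' : (k%:R : R) != 0 by rewrite pnatr_eq0 -lt0n.
apply: (mulfI k0'); rewrite -IntZ; last exact/intble_continuous/continuous_sinM.
have cf : continuous (fun t : R => k%:R * sin (k%:R * t)).
  by move=> t; apply: cvgM; [exact: cvg_cst|exact: continuous_sinM].
rewrite (Int_FTC (@pi_gt0 R) (is_derive_cosM k%:R) cf).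
by rewrite cos_natpi mulr0 cos0 opprK addrC mulrCA mulfV// mulr1.
Qed.

Lemma half_mulcos_le_sin (x : R) : 0 <= x -> x <= pi / 4 -> x * cos x <= sin x.
Proof.
move=> x0 xp; have p0 := @pi_gt0 R.
have [c] := @MVT_segment R sin cos 0 x x0 (fun y _ => is_derive_sin y)
   (continuous_subspaceT (@continuous_sin R)).
rewrite in_itv/= sin0 !subr0 => /andP[c0 cx] ->.
rewrite mulrC ler_wpM2r//.
have [->//|cx'] := eqVneq c x.
by apply/ltW; rewrite ltr_cos ?in_itv/= ?c0 ?x0/=; [rewrite lt_neqAle cx' cx|lra|lra].
Qed.

(** The closed forms of the Fejer kernels have denominator 1 - cos t, so this is the source of their
    decay. With v = t / 4 one has 1 - cos t = 8 (sin v cos v)^2, and sin v cos v >= v (cos v)^2 >= v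
    / 2. *)
Lemma sqr_le_1subcos (t : R) : 0 <= t <= pi -> t ^+ 2 <= 8 * (1 - cos t).
Proof.
move=> /andP[t0 tp]; have p0 := @pi_gt0 R.
set v := t / 4; have v0 : 0 <= v by rewrite divr_ge0.
have vp : v <= pi / 4 by rewrite /v; lra.
have c2 : 1 / 2 <= cos v ^+ 2.
  have := cos_mulr2n v; have -> : v *+ 2 = t / 2 by rewrite /v mulr2n; field.
  have : 0 <= cos (t / 2) by apply: cos_ge0_pihalf; apply/andP; split; lra.
  by rewrite -mulr_natr; lra.
have cv : 0 <= cos v by apply: cos_ge0_pihalf; apply/andP; split; lra.
have s1 := half_mulcos_le_sin v0 vp.
have s2 : v / 2 <= sin v * cos v.
  apply: (@le_trans _ _ (v * cos v * cos v)); last by rewrite ler_wpM2r.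
  by rewrite -mulrA ler_wpM2l// -expr2; lra.
have E1 : 1 - cos t = 2 * sin (t / 2) ^+ 2.
  have -> : cos t = cos ((t / 2) *+ 2) by congr cos; rewrite mulr2n; field.
  by rewrite cos_mulr2n sin2cos2 -mulr_natr; ring.
have E2 : sin (t / 2) = 2 * (sin v * cos v).
  have -> : t / 2 = v + v by rewrite /v; field.
  by rewrite sinD; ring.
rewrite E1 E2.
have : v ^+ 2 / 4 <= (sin v * cos v) ^+ 2.
  have -> : v ^+ 2 / 4 = (v / 2) ^+ 2 by field.
  by rewrite lerXn2r ?nnegrE ?divr_ge0// mulr_ge0// (le_trans _ s1)// mulr_ge0.
have -> : t ^+ 2 = 16 * v ^+ 2 by rewrite /v; field.
by rewrite exprMn; lra.
Qed.

Lemma cos_rec k t : cos (k.+2%:R * t) = 2 * cos t * cos (k.+1%:R * t) - cos (k%:R * t) :> R.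
Proof.
have -> : k.+2%:R * t = k.+1%:R * t + t by rewrite -natr1 mulrDl mul1r.
have -> : k%:R * t = k.+1%:R * t - t by rewrite -natr1 mulrDl mul1r addrK.
by rewrite cosD cosB; ring.
Qed.

Lemma sin_rec k t : sin (k.+2%:R * t) = 2 * cos t * sin (k.+1%:R * t) - sin (k%:R * t) :> R.
Proof.
have -> : k.+2%:R * t = k.+1%:R * t + t by rewrite -natr1 mulrDl mul1r.
have -> : k%:R * t = k.+1%:R * t - t by rewrite -natr1 mulrDl mul1r addrK.
by rewrite sinD sinB; ring.
Qed.

(** * Dirichlet and Fejer kernels and their conjugates *)

Definition cos_sum u N t := \sum_(1 <= k < N) u k * cos (k%:R * t).

Definition sin_sum u N t := \sum_(1 <= k < N) u k * sin (k%:R * t).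

Definition fejer_weight n k : R := 1 - k%:R / n.+1%:R.

Definition fejer_kernel n t := 2^-1 + cos_sum (fejer_weight n) n.+1 t.

Definition conj_fejer_kernel n t := sin_sum (fejer_weight n) n.+1 t.

Lemma dirichlet_sumE n t :
  (2^-1 + cos_sum (fun=> 1) n.+1 t) * (2 * (1 - cos t)) =
  cos (n%:R * t) - cos (n.+1%:R * t).
Proof.
rewrite /cos_sum; elim: n => [|n IH].
  by rewrite big_nil addr0 mul0r cos0 mul1r; field.
rewrite big_nat_recr//= addrA mulrDl IH cos_rec mul1r; ring.
Qed.

Lemma conj_dirichlet_sumE n t :
  sin_sum (fun=> 1) n.+1 t * (2 * (1 - cos t)) =
  sin t + sin (n%:R * t) - sin (n.+1%:R * t).
Proof.
rewrite /sin_sum; elim: n => [|n IH].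
  by rewrite big_nil !mul0r sin0 mul1r; ring.
rewrite big_nat_recr//= mulrDl IH sin_rec mul1r; ring.
Qed.

(** n + 1 times the Cesaro mean of order n is the sum of the partial sums of orders 0 to n, so
    raising the order adds one partial sum. The closed forms of the Fejer kernels follow by
    induction from those of the Dirichlet kernels. *)
Lemma fejer_weight_rec (c : nat -> R) n :
  n.+2%:R * \sum_(1 <= k < n.+2) fejer_weight n.+1 k * c k =
  n.+1%:R * (\sum_(1 <= k < n.+1) fejer_weight n k * c k) + \sum_(1 <= k < n.+2) 1 * c k.
Proof.
have w0 : fejer_weight n n.+1 = 0 by rewrite /fejer_weight mulfV ?subrr// pnatr_eq0.
have -> : \sum_(1 <= k < n.+1) fejer_weight n k * c k =
          \sum_(1 <= k < n.+2) fejer_weight n k * c k.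
  by rewrite [RHS]big_nat_recr//= w0 mul0r addr0.
rewrite !mulr_sumr -big_split/=; apply: eq_bigr => k _.
rewrite /fejer_weight -[n.+2%:R]natr1; field.
by rewrite ![1 + n%:R]addrC !natr1 !pnatr_eq0.
Qed.

Lemma fejer_kernelE n t :
  fejer_kernel n t * (2 * n.+1%:R * (1 - cos t)) = 1 - cos (n.+1%:R * t).
Proof.
rewrite /fejer_kernel /cos_sum; elim: n => [|n IH].
  by rewrite big_nil addr0 mul1r; field.
have := fejer_weight_rec (fun k => cos (k%:R * t)) n => E.
have D := dirichlet_sumE n.+1 t; rewrite /cos_sum in D.
move: E D IH; set a := \sum_(1 <= k < n.+2) _ * _; set b := \sum_(1 <= k < n.+1) _.
set d := \sum_(1 <= k < n.+2) 1 * _.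
move=> E D IH.
have -> : (2^-1 + a) * (2 * n.+2%:R * (1 - cos t)) =
  (2^-1 * n.+2%:R + n.+2%:R * a) * (2 * (1 - cos t)) by ring.
rewrite E.
have -> : (2^-1 * n.+2%:R + (n.+1%:R * b + d)) * (2 * (1 - cos t)) =
  (2^-1 + b) * (2 * n.+1%:R * (1 - cos t)) + (2^-1 + d) * (2 * (1 - cos t)).
  by rewrite -[n.+2%:R]natr1; ring.
by rewrite IH D; ring.
Qed.

Lemma conj_fejer_kernelE n t :
  conj_fejer_kernel n t * (2 * n.+1%:R * (1 - cos t)) =
  n.+1%:R * sin t - sin (n.+1%:R * t).
Proof.
rewrite /conj_fejer_kernel /sin_sum; elim: n => [|n IH].
  by rewrite big_nil !mul1r mul0r subrr.
have := fejer_weight_rec (fun k => sin (k%:R * t)) n => E.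
have D := conj_dirichlet_sumE n.+1 t; rewrite /sin_sum in D.
move: E D IH; set a := \sum_(1 <= k < n.+2) _ * _; set b := \sum_(1 <= k < n.+1) _.
set d := \sum_(1 <= k < n.+2) 1 * _.
move=> E D IH.
have -> : a * (2 * n.+2%:R * (1 - cos t)) = (n.+2%:R * a) * (2 * (1 - cos t)) by ring.
rewrite E.
have -> : (n.+1%:R * b + d) * (2 * (1 - cos t)) =
  b * (2 * n.+1%:R * (1 - cos t)) + d * (2 * (1 - cos t)) by ring.
by rewrite IH D -[n.+2%:R]natr1; ring.
Qed.

Lemma continuous_bigsum I (s : seq I) (F : I -> R -> R) :
  (forall i, continuous (F i)) -> continuous (fun t => \sum_(i <- s) F i t).
Proof.
move=> cF; elim: s => [|i s IH].
  by under eq_fun do rewrite big_nil; move=> t; exact: cvg_cst.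
under eq_fun do rewrite big_cons; move=> t; apply: cvgD; [exact: cF|exact: IH].
Qed.

Lemma continuous_cos_sum u N : continuous (cos_sum u N).
Proof.
apply: continuous_bigsum => k t; apply: cvgM; first exact: cvg_cst.
exact: continuous_cosM.
Qed.

Lemma continuous_sin_sum u N : continuous (sin_sum u N).
Proof.
apply: continuous_bigsum => k t; apply: cvgM; first exact: cvg_cst.
exact: continuous_sinM.
Qed.

Lemma continuous_fejer_kernel n : continuous (fejer_kernel n).
Proof. by move=> t; apply: cvgD; [exact: cvg_cst|exact: continuous_cos_sum]. Qed.

Lemma fejer_weight_itv n k : (k <= n.+1)%N -> 0 <= fejer_weight n k <= 1.
Proof.
move=> kn; rewrite /fejer_weight subr_ge0 ler_pdivrMr ?ltr0n// mul1r ler_nat kn.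
by rewrite gerBl divr_ge0.
Qed.

Lemma norm_cos_le1 t : `|cos t| <= 1.
Proof. by rewrite ler_norml cos_geN1 cos_le1. Qed.

Lemma norm_sin_le1 t : `|sin t| <= 1.
Proof. by rewrite ler_norml sin_geN1 sin_le1. Qed.

Lemma norm_weighted_sum_le (w c : nat -> R) N :
  (forall k, (0 < k)%N -> (k < N.+1)%N -> `|w k| <= 1) -> (forall k, `|c k| <= 1) ->
  `|\sum_(1 <= k < N.+1) w k * c k| <= N%:R.
Proof.
move=> w1 c1; apply: le_trans (ler_norm_sum _ _ _) _.
have -> : N%:R = \sum_(1 <= k < N.+1) 1 :> R by rewrite big_const_nat iter_addr addr0 subn1.
rewrite big_nat_cond [X in _ <= X]big_nat_cond.
apply: ler_sum => k /andP[/andP[k0 kn] _]; rewrite normrM -[X in _ <= X]mulr1.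
by rewrite ler_pM// w1.
Qed.

Lemma norm_fejer_weight_le1 n k : (k < n.+1)%N -> `|fejer_weight n k| <= 1.
Proof. by move=> /ltnW/fejer_weight_itv/andP[w0 w1]; rewrite ger0_norm. Qed.

Lemma norm_fejer_kernel_le n t : `|fejer_kernel n t| <= n.+1%:R.
Proof.
rewrite /fejer_kernel; apply: le_trans (ler_normD _ _) _.
rewrite -[n.+1%:R]natr1 [leLHS]addrC; apply: lerD.
  apply: norm_weighted_sum_le => k; last exact: norm_cos_le1.
  by move=> _; exact: norm_fejer_weight_le1.
by rewrite ger0_norm// invf_le1// ler1n.
Qed.

Lemma norm_conj_fejer_kernel_le n t : `|conj_fejer_kernel n t| <= n%:R.
Proof.
by apply: norm_weighted_sum_le => k; [move=> _; exact: norm_fejer_weight_le1|exact: norm_sin_le1].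
Qed.

Lemma cos_lt1 t : 0 < t <= pi -> cos t < 1 :> R.
Proof.
move=> /andP[t0 tp]; have := @sqr_le_1subcos t; rewrite ltW//= tp => /(_ isT).
have : 0 < t ^+ 2 by rewrite exprn_gt0.
lra.
Qed.

Lemma fejer_kernel_ge0 n t : 0 <= t <= pi -> 0 <= fejer_kernel n t.
Proof.
move=> /andP[]; rewrite le_eqVlt => /predU1P[<- _|t0 tp].
  rewrite /fejer_kernel addr_ge0// /cos_sum big_nat_cond sumr_ge0// => k.
  move=> /andP[/andP[k0 kn] _]; rewrite mulr0 cos0 mulr1.
  by case/andP: (fejer_weight_itv (ltnW kn)).
have c1 : cos t < 1 by apply: cos_lt1; rewrite t0.
have := fejer_kernelE n t.
have : 0 < 2 * n.+1%:R * (1 - cos t) by rewrite mulr_gt0// subr_gt0.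
have : 0 <= 1 - cos (n.+1%:R * t) by rewrite subr_ge0 cos_le1.
by move=> h1 h2 h3; rewrite -(pmulr_lge0 _ h2) h3.
Qed.

Lemma fejer_kernel_decay n t : 0 <= t <= pi ->
  `|fejer_kernel n t| * (n.+1%:R * t ^+ 2) <= 8.
Proof.
move=> tp; have K0 := fejer_kernel_ge0 n tp; rewrite ger0_norm//.
apply: (@le_trans _ _ (fejer_kernel n t * (n.+1%:R * (8 * (1 - cos t))))).
  by rewrite ler_wpM2l// ler_wpM2l// sqr_le_1subcos.
have -> : fejer_kernel n t * (n.+1%:R * (8 * (1 - cos t))) =
  4 * (fejer_kernel n t * (2 * n.+1%:R * (1 - cos t))) by ring.
by rewrite fejer_kernelE; have := cos_geN1 (n.+1%:R * t); lra.
Qed.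

Lemma cot_halfE t : 0 < t <= pi ->
  (2 * tan (t / 2))^-1 = sin t / (2 * (1 - cos t)) :> R.
Proof.
move=> tp; have c1 := cos_lt1 tp; case/andP: tp => t0 tp.
have c1' : 1 - cos t != 0 by rewrite subr_eq0 eq_sym lt_eqF.
have tE : t = t / 2 + t / 2 by field.
have E1 : 1 - cos t = 2 * sin (t / 2) ^+ 2.
  have -> : cos t = cos ((t / 2) *+ 2) by congr cos; rewrite mulr2n; field.
  by rewrite cos_mulr2n sin2cos2 -mulr_natr; ring.
have s0 : sin (t / 2) != 0.
  by move: c1'; rewrite E1; apply: contra => /eqP ->; rewrite expr0n/= mulr0.
have -> : sin t = 2 * (sin (t / 2) * cos (t / 2)) by rewrite [in LHS]tE sinD; ring.
(* At t = pi the tangent has a vanishing denominator; with the convention 1 / 0 = 0 both sides are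
   0. *)
rewrite E1 /tan; have [->|c0] := eqVneq (cos (t / 2)) 0.
  by rewrite !(mulr0, mul0r, invr0, addr0).
by field; rewrite s0 c0.
Qed.

(** The conjugate Fejer kernel is the kernel of the conjugate function up to an error of size 1 / (n
    t^2), the same decay as that of the Fejer kernel. *)
Lemma conj_fejer_kernel_cot n t : 0 < t <= pi ->
  conj_fejer_kernel n t - (2 * tan (t / 2))^-1 =
  - sin (n.+1%:R * t) / (2 * n.+1%:R * (1 - cos t)).
Proof.
move=> tp; rewrite cot_halfE//.
have c1' : 1 - cos t != 0 by rewrite subr_eq0 eq_sym lt_eqF// cos_lt1.
have n0 : (n.+1%:R : R) != 0 by rewrite pnatr_eq0.
have -> : conj_fejer_kernel n t =
    (n.+1%:R * sin t - sin (n.+1%:R * t)) / (2 * n.+1%:R * (1 - cos t)).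
  by rewrite -conj_fejer_kernelE mulfK// !mulf_neq0// pnatr_eq0.
by field; rewrite c1' addrC natr1.
Qed.

Lemma conj_fejer_kernel_cot_decay n t : 0 < t <= pi ->
  `|conj_fejer_kernel n t - (2 * tan (t / 2))^-1| * (n.+1%:R * t ^+ 2) <= 4.
Proof.
move=> tp; rewrite conj_fejer_kernel_cot// mulNr normrN.
have c1 : 0 < 1 - cos t by rewrite subr_gt0 cos_lt1.
have t2 : t ^+ 2 <= 8 * (1 - cos t) by apply: sqr_le_1subcos; case/andP: tp => /ltW ->.
rewrite normrM; set s := `|sin _|.
have s1 : s <= 1 by exact: norm_sin_le1.
rewrite gtr0_norm; last by rewrite invr_gt0 mulr_gt0.
rewrite mulrAC ler_pdivrMr; last by rewrite mulr_gt0.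
rewrite (_ : 4 * _ = 1 * (n.+1%:R * (8 * (1 - cos t)))); last by ring.
apply: ler_pM => //; [exact: normr_ge0|by rewrite mulr_ge0// sqr_ge0|].
exact: ler_wpM2l.
Qed.

(** The common main part (2 tan (t / 2))^-1 cancels. Neither kernel alone has this decay; their
    difference meets the requirements of [approximate_identity]. *)
Lemma conj_fejer_kernel2_decay n t : 0 <= t <= pi ->
  `|conj_fejer_kernel n.*2 t - conj_fejer_kernel n t| * (n.+1%:R * t ^+ 2) <= 8.
Proof.
move=> /andP[]; rewrite le_eqVlt => /predU1P[<- _|t0 tp].
  by rewrite expr0n/= !mulr0.
have tp' : 0 < t <= pi by rewrite t0.
have H1 := conj_fejer_kernel_cot_decay n tp'.
have H2 := conj_fejer_kernel_cot_decay n.*2 tp'.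
set c := (2 * tan (t / 2))^-1 in H1 H2 *.
set a := conj_fejer_kernel n.*2 t in H2 *; set b := conj_fejer_kernel n t in H1 *.
have -> : a - b = (a - c) - (b - c) by ring.
apply: le_trans (_ : (`|a - c| + `|b - c|) * (n.+1%:R * t ^+ 2) <= _).
  apply: ler_wpM2r; first by rewrite mulr_ge0// sqr_ge0.
  exact: ler_normB.
rewrite mulrDl (_ : 8 = 4 + 4); last by ring.
rewrite lerD//; apply: le_trans H2; apply: ler_wpM2l => //.
apply: ler_wpM2r; first exact: sqr_ge0.
by rewrite ler_nat ltnS -addnn leq_addr.
Qed.

Lemma norm_conj_fejer_kernel2_le n t :
  `|conj_fejer_kernel n.*2 t - conj_fejer_kernel n t| <= 8 * n.+1%:R.
Proof.
have H1 := norm_conj_fejer_kernel_le n t; have H2 := norm_conj_fejer_kernel_le n.*2 t.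
apply: le_trans (ler_normB _ _) _; apply: le_trans (lerD H2 H1) _.
rewrite -muln2 natrM -[n.+1%:R]natr1; have : 0 <= n%:R :> R by []; lra.
Qed.

Lemma Int_cos_kernel u N : Int 0 pi (fun t => 2^-1 + cos_sum u N t) = pi / 2.
Proof.
rewrite IntD; last 2 first.
- exact: intble_cst.
- exact/intble_continuous/continuous_cos_sum.
rewrite Int_cst ?pi_ge0// subr0 [X in _ + X](_ : _ = 0) ?addr0 1?mulrC//.
rewrite /cos_sum Int_sum ?pi_ge0//; last first.
  by move=> k _; apply/intbleZ/intble_continuous/continuous_cosM.
rewrite big_nat_cond big1// => k /andP[/andP[k0 _] _].
rewrite IntZ; last exact/intble_continuous/continuous_cosM.
by rewrite Int_cosM// mulr0.
Qed.

Lemma Int_fejer_kernel n : Int 0 pi (fejer_kernel n) = pi / 2.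
Proof. exact: Int_cos_kernel. Qed.

Lemma Int_conj_fejer_kernel n : Int 0 pi (conj_fejer_kernel n) =
  \sum_(1 <= k < n.+1) fejer_weight n k * ((1 - (-1) ^+ k) / k%:R).
Proof.
rewrite /conj_fejer_kernel /sin_sum Int_sum ?pi_ge0//; last first.
  by move=> k _; apply/intbleZ/intble_continuous/continuous_sinM.
rewrite big_nat_cond [RHS]big_nat_cond; apply: eq_bigr => k /andP[/andP[k0 _] _].
rewrite IntZ; last exact/intble_continuous/continuous_sinM.
by rewrite Int_sinM.
Qed.

Lemma sum_odd m n : (m <= n)%N ->
  \sum_(m <= k < n) (1 - (-1) ^+ k) = (n - m)%:R + ((-1) ^+ n - (-1) ^+ m) / 2 :> R.
Proof.
elim: n => [|n IH].
  by rewrite leqn0 => /eqP ->; rewrite big_geq// subrr mul0r addr0.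
rewrite leq_eqVlt => /predU1P[->|]; first by rewrite big_geq// subnn subrr mul0r addr0.
rewrite ltnS => mn; rewrite big_nat_recr//= IH// subSn// exprS -natr1; by field.
Qed.

(** Each integral grows like log n, so the difference is close to log 2 for large p; a crude bound
    suffices. The weights increase with the order, so all terms of the difference are nonnegative,
    and only those with 2 p < k <= 3 p are kept: there the weight of order 4 p is at least 1 / 4 and
    1 / k is at least 1 / (3 p). *)
Lemma Int_conj_fejer_kernel2_ge p : (2 <= p)%N ->
  24^-1 <= Int 0 pi (conj_fejer_kernel (p.*2).*2) - Int 0 pi (conj_fejer_kernel p.*2).
Proof.
move=> p2; rewrite !Int_conj_fejer_kernel.
set e := fun k : nat => (1 - (-1) ^+ k) / k%:R : R.
have e0 k : 0 <= e k.
  rewrite divr_ge0// subr_ge0 -signr_odd; case: odd => //=; rewrite ?expr0// expr1.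
  by rewrite (le_trans (lerN10 _)).
rewrite (@big_cat_nat _ _ _ p.*2.+1)//=; last by rewrite ltnS -[X in (_ <= X)%N]addnn leq_addr.
rewrite addrAC; apply: ler_wpDl.
  rewrite subr_ge0; apply: ler_sum_nat => k _.
  apply: ler_wpM2r; first exact: e0.
  rewrite /fejer_weight lerD2l lerN2; apply: ler_wpM2l => //.
  rewrite lef_pV2 ?posrE ?ltr0n// ler_nat ltnS.
  by rewrite -[X in (_ <= X)%N]addnn leq_addr.
rewrite (@big_cat_nat _ _ _ (p.*2 + p).+1)//=; last 2 first.
- by rewrite ltnS leq_addr.
- by rewrite ltnS -[X in (_ <= X)%N]addnn leq_add2l -addnn leq_addr.
apply: ler_wpDr.
  rewrite big_nat_cond sumr_ge0// => k /andP[/andP[_ kn] _].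
  apply: mulr_ge0; last exact: e0.
  by case/andP: (fejer_weight_itv (ltnW kn)).
apply: (@le_trans _ _ (\sum_(p.*2.+1 <= k < (p.*2 + p).+1) (12 * p%:R)^-1 * (1 - (-1) ^+ k))).
  rewrite -mulr_sumr sum_odd; last by rewrite ltnS leq_addr.
  rewrite subSS addKn; have p0 : 0 < p%:R :> R by rewrite ltr0n (leq_trans _ p2).
  have P2 : 2 <= p%:R :> R by rewrite ler_nat.
  rewrite ler_pdivlMl; last by rewrite mulr_gt0.
  have : -1 <= (-1) ^+ (p.*2 + p).+1 :> R.
    by rewrite -signr_odd; case: odd; rewrite ?expr0 ?expr1// lerN10.
  have -> : (-1) ^+ p.*2.+1 = -1 :> R by rewrite -signr_odd /= odd_double expr1.
  lra.
apply: ler_sum_nat => k /andP[k1 k2].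
have p0 : 0 < p%:R :> R by rewrite ltr0n (leq_trans _ p2).
have k0 : 0 < k%:R :> R by rewrite ltr0n (leq_ltn_trans _ k1).
have kp : k%:R <= 3 * p%:R :> R.
  by move: k2; rewrite ltnS -(ler_nat R) natrD -muln2 natrM; lra.
rewrite /e mulrA [leRHS]mulrAC; apply: ler_wpM2r.
  rewrite subr_ge0 -signr_odd; case: odd => //=; rewrite ?expr0// expr1.
  by rewrite (le_trans (lerN10 _)).
have -> : (12 * p%:R)^-1 = 4^-1 / (3 * p%:R) :> R by field; rewrite gt_eqF.
have w4 : 4^-1 <= fejer_weight (p.*2).*2 k.
  rewrite /fejer_weight -[(_.*2).+1%:R]natr1 -muln2 natrM -muln2 natrM.
  by rewrite lerBrDr -lerBrDl ler_pdivrMr; lra.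
have k3 : (3 * p%:R)^-1 <= k%:R^-1 :> R by rewrite lef_pV2 ?posrE// mulr_gt0.
by apply: ler_pM; rewrite // invr_ge0// mulr_ge0// ltW.
Qed.

End trigonometric_kernels.

(** * Fejer means *)

Section fejer_means.
Context {R : realType}.
Implicit Types (f g : R -> R) (u v : nat -> R) (x t l : R) (k n N : nat).
Local Notation mu := (@lebesgue_measure R).

Definition harm f k x :=
  fourier_cos f k * cos (k%:R * x) + fourier_sin f k * sin (k%:R * x).

(** With a and b the k-th coefficients, [harm] and [conj_harm] are the real and imaginary parts of
    (a - i b) e^{ikx}. *)
Definition conj_harm f k x :=
  fourier_cos f k * sin (k%:R * x) - fourier_sin f k * cos (k%:R * x).

Definition fejer_sum f n x :=
  fourier_cos f 0 / 2 + \sum_(1 <= k < n.+1) fejer_weight n k * harm f k x.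

Definition conj_fejer_sum f n x :=
  \sum_(1 <= k < n.+1) fejer_weight n k * conj_harm f k x.

Lemma harmE f k x : L1 f ->
  harm f k x = pi^-1 * Int 0 pi (fun t => (f (x + t) + f (x - t)) * cos (k%:R * t)).
Proof.
move=> f1; rewrite /harm /fourier_cos /fourier_sin -!/(Int _ _ _).
have I1 : intble (- pi) pi (fun t => f t * cos (k%:R * t)).
  by apply: intbleMc; [exact: L1_intble|exact: continuous_cosM].
have I2 : intble (- pi) pi (fun t => f t * sin (k%:R * t)).
  by apply: intbleMc; [exact: L1_intble|exact: continuous_sinM].
rewrite -!mulrA -mulrDr; congr (_ * _).
rewrite mulrC -IntZ// [X in _ + X]mulrC -IntZ// -IntD; try exact: intbleZ.
rewrite -[LHS](_ : Int (- pi) pi (fun t => f t * cos (k%:R * (t - x))) = _); last first.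
  by apply: eq_Int => t _; rewrite mulrBr cosB; ring.
rewrite (@Int_conv _ f (fun t => cos (k%:R * t)))//; last 2 first.
- exact: cosM_periodic.
- exact: continuous_cosM.
by apply: eq_Int => t _; rewrite mulrN cosN; ring.
Qed.

Lemma conj_harmE f k x : L1 f ->
  conj_harm f k x =
  - pi^-1 * Int 0 pi (fun t => (f (x + t) - f (x - t)) * sin (k%:R * t)).
Proof.
move=> f1; rewrite /conj_harm /fourier_cos /fourier_sin -!/(Int _ _ _).
have I1 : intble (- pi) pi (fun t => f t * cos (k%:R * t)).
  by apply: intbleMc; [exact: L1_intble|exact: continuous_cosM].
have I2 : intble (- pi) pi (fun t => f t * sin (k%:R * t)).
  by apply: intbleMc; [exact: L1_intble|exact: continuous_sinM].
rewrite -!mulrA -mulrBr mulNr -mulrN; congr (_ * _).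
rewrite mulrC -IntZ// [X in _ - X]mulrC -IntZ// -IntB; try exact: intbleZ.
rewrite -[LHS]opprK -IntN; last by apply: intbleB; exact: intbleZ.
congr (- _).
rewrite -[LHS](_ : Int (- pi) pi (fun t => f t * sin (k%:R * (t - x))) = _); last first.
  by apply: eq_Int => t _; rewrite mulrBr sinB; ring.
rewrite (@Int_conv _ f (fun t => sin (k%:R * t)))//; last 2 first.
- exact: sinM_periodic.
- exact: continuous_sinM.
by apply: eq_Int => t _; rewrite mulrN sinN; ring.
Qed.

Lemma harm_sumE f u N x : L1 f ->
  \sum_(1 <= k < N) u k * harm f k x =
  pi^-1 * Int 0 pi (fun t => (f (x + t) + f (x - t)) * cos_sum u N t).
Proof.
move=> f1; have I0 : intble 0 pi (fun t => f (x + t) + f (x - t)).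
  by apply: intbleD; apply: L1_intble; [exact: L1_shift|exact: L1_rshift].
have Ik k : intble 0 pi (fun t => (f (x + t) + f (x - t)) * cos (k%:R * t)).
  by apply: intbleMc => //; exact: continuous_cosM.
under [X in _ = _ * Int _ _ X]eq_fun do rewrite /cos_sum mulr_sumr.
rewrite Int_sum ?pi_ge0//; last first.
  by move=> k _; apply: eq_intble (intbleZ (u k) (Ik k)) => t _; ring.
rewrite mulr_sumr; apply: eq_bigr => k _; rewrite harmE// mulrCA -IntZ//.
by congr (_ * _); apply: eq_Int => t _; ring.
Qed.

Lemma conj_harm_sumE f u N x : L1 f ->
  \sum_(1 <= k < N) u k * conj_harm f k x =
  - pi^-1 * Int 0 pi (fun t => (f (x + t) - f (x - t)) * sin_sum u N t).
Proof.
move=> f1; have I0 : intble 0 pi (fun t => f (x + t) - f (x - t)).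
  by apply: intbleB; apply: L1_intble; [exact: L1_shift|exact: L1_rshift].
have Ik k : intble 0 pi (fun t => (f (x + t) - f (x - t)) * sin (k%:R * t)).
  by apply: intbleMc => //; exact: continuous_sinM.
under [X in _ = _ * Int _ _ X]eq_fun do rewrite /sin_sum mulr_sumr.
rewrite Int_sum ?pi_ge0//; last first.
  by move=> k _; apply: eq_intble (intbleZ (u k) (Ik k)) => t _; ring.
rewrite mulr_sumr; apply: eq_bigr => k _; rewrite conj_harmE// mulrCA -IntZ//.
by congr (_ * _); apply: eq_Int => t _; ring.
Qed.

Lemma fourier_cos0E f x : L1 f ->
  fourier_cos f 0 / 2 = pi^-1 * Int 0 pi (fun t => (f (x + t) + f (x - t)) * 2^-1).
Proof.
move=> f1; have := harmE 0 x f1.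
rewrite /harm mul0r cos0 sin0 mulr0 addr0 mulr1 => ->.
rewrite -mulrA; congr (_ * _); rewrite mulrC -IntZ.
  by apply: eq_Int => t _; rewrite mul0r cos0; ring.
apply: (@eq_intble _ _ _ (fun t => f (x + t) + f (x - t))).
  by move=> t _; rewrite mul0r cos0 mulr1.
by apply: intbleD; apply: L1_intble; [exact: L1_shift|exact: L1_rshift].
Qed.

(** The weights are left free so that the same formula gives the Fejer means and, with u = 1, the
    partial sums. *)
Lemma even_sumE f u N x : L1 f ->
  fourier_cos f 0 / 2 + \sum_(1 <= k < N) u k * harm f k x =
  pi^-1 * Int 0 pi (fun t => (f (x + t) + f (x - t)) * (2^-1 + cos_sum u N t)).
Proof.
move=> f1; rewrite (fourier_cos0E x f1) harm_sumE// -mulrDr; congr (_ * _).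
have I0 : intble 0 pi (fun t => f (x + t) + f (x - t)).
  by apply: intbleD; apply: L1_intble; [exact: L1_shift|exact: L1_rshift].
rewrite -IntD; last 2 first.
- by apply: intbleMc => // t; exact: cvg_cst.
- by apply: intbleMc => //; exact: continuous_cos_sum.
by apply: eq_Int => t _; rewrite mulrDr.
Qed.

Lemma fejer_sumE f n x : L1 f ->
  fejer_sum f n x =
  pi^-1 * Int 0 pi (fun t => (f (x + t) + f (x - t)) * fejer_kernel n t).
Proof. exact: even_sumE. Qed.

Lemma conj_fejer_sumE f n x : L1 f ->
  conj_fejer_sum f n x =
  - pi^-1 * Int 0 pi (fun t => (f (x + t) - f (x - t)) * conj_fejer_kernel n t).
Proof. exact: conj_harm_sumE. Qed.

(** A common majorant of the error made on f (x + t) + f (x - t) and on f (x + t) - f (x - t) when f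
    is replaced by l to the right of x and by l' to the left. *)
Definition gap f x l l' t := `|f (x + t) - l| + `|f (x - t) - l'|.

Lemma gap_ge0 f x l l' t : 0 <= gap f x l l' t.
Proof. by rewrite addr_ge0. Qed.

Lemma intble_gap f x l l' a b : L1 f -> intble a b (gap f x l l').
Proof.
move=> f1; apply: intbleD; apply/intble_norm/intbleB; try exact: intble_cst.
  by apply: L1_intble; exact: L1_shift.
by apply: L1_intble; exact: L1_rshift.
Qed.

Lemma gap_avg f x l l' : L1 f -> ravg f x l -> lavg f x l' ->
  forall e, 0 < e -> exists2 d, 0 < d &
    forall h, 0 < h -> h <= d -> Int 0 h (gap f x l l') <= e * h.
Proof.
move=> f1 rf lf e e0; have e2 : 0 < e / 2 by rewrite divr_gt0.
have [d d0 Hd] := rf _ e2; have [d' d'0 Hd'] := lf _ e2.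
exists (Num.min d d'); first by rewrite lt_min d0.
move=> h h0; rewrite le_min => /andP[hd hd']; rewrite IntD.
- have := Hd _ h0 hd; have := Hd' _ h0 hd'; lra.
- apply/intble_norm/intbleB; last exact: intble_cst.
  by apply: L1_intble; exact: L1_shift.
- apply/intble_norm/intbleB; last exact: intble_cst.
  by apply: L1_intble; exact: L1_rshift.
Qed.

Lemma fejer_sum_sub f n x l l' : L1 f ->
  `|fejer_sum f n x - (l + l') / 2| <=
  pi^-1 * Int 0 pi (fun t => gap f x l l' t * `|fejer_kernel n t|).
Proof.
move=> f1; have p0 := @pi_gt0 R.
have ck := @continuous_fejer_kernel R n.
have -> : (l + l') / 2 = pi^-1 * Int 0 pi (fun t => (l + l') * fejer_kernel n t).
  rewrite IntZ; last exact: intble_continuous.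
  by rewrite Int_fejer_kernel mulrCA mulKf// gt_eqF.
have I0 : intble 0 pi (fun t => f (x + t) + f (x - t)).
  by apply: intbleD; apply: L1_intble; [exact: L1_shift|exact: L1_rshift].
have I1 : intble 0 pi (fun t => (f (x + t) + f (x - t)) * fejer_kernel n t).
  exact: intbleMc.
have I2 : intble 0 pi (fun t => (l + l') * fejer_kernel n t).
  exact/intbleZ/intble_continuous.
rewrite fejer_sumE// -mulrBr normrM gtr0_norm ?invr_gt0// ler_wpM2l ?invr_ge0 ?(ltW p0)//.
rewrite -IntB//; apply: le_norm_Int2; first exact: intbleB.
  apply: eq_intble (intble_norm (intbleMc (intble_gap x l l' 0 pi f1) ck)) => t _.
  by rewrite normrM ger0_norm ?gap_ge0.
move=> t _; rewrite -mulrBl normrM ler_wpM2r// /gap.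
have -> : f (x + t) + f (x - t) - (l + l') = (f (x + t) - l) + (f (x - t) - l') by ring.
exact: ler_normD.
Qed.

Lemma fejer_sum_cvg f x l l' : L1 f -> ravg f x l -> lavg f x l' ->
  fejer_sum f n x @[n --> \oo] --> (l + l') / 2.
Proof.
move=> f1 rf lf; have p0 := @pi_gt0 R; apply/cvg_seqP => e e0.
have [||||N HN] := @approximate_identity_cvg _ (gap f x l l') fejer_kernel 8 _
  (intble_gap x l l' 0 pi f1) (fun t _ => gap_ge0 f x l l' t) (gap_avg f1 rf lf)
  (@continuous_fejer_kernel R) _ _ (pi * e).
- by [].
- move=> n t _; apply: le_trans (norm_fejer_kernel_le n t) _.
  by rewrite ler_peMl// ler1n.
- by move=> n t; exact: fejer_kernel_decay.
- by rewrite mulr_gt0.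
exists N => n /HN H; apply: le_trans (fejer_sum_sub n x l l' f1) _.
by rewrite ler_pdivrMl.
Qed.

(** Replacing f by l on the right of x and by l' on the left turns the difference of the means into
    l - l' times the integral of [L n], which is bounded below along even n. The replacement error
    tends to 0 because [L] acts as an approximate identity. *)
Lemma conj_fejer_jump f x l l' : L1 f -> ravg f x l -> lavg f x l' ->
  conj_fejer_sum f n.*2 x - conj_fejer_sum f n x @[n --> \oo] --> (0 : R) -> l = l'.
Proof.
move=> f1 rf lf /cvg_seqP dif; have p0 := @pi_gt0 R.
pose L n t : R := conj_fejer_kernel n.*2 t - conj_fejer_kernel n t.
have cK n : continuous (@conj_fejer_kernel R n) by exact: continuous_sin_sum.
have cL n : continuous (L n) by move=> t; apply: cvgB; exact: cK.
pose phi t := f (x + t) - f (x - t).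
have I0 : intble 0 pi phi.
  by apply: intbleB; apply: L1_intble; [exact: L1_shift|exact: L1_rshift].
have difE n : conj_fejer_sum f n.*2 x - conj_fejer_sum f n x =
    - pi^-1 * Int 0 pi (fun t => phi t * L n t).
  rewrite !conj_fejer_sumE// -mulrBr; congr (_ * _).
  rewrite -IntB; try exact: intbleMc.
  by apply: eq_Int => t _; rewrite -mulrBr.
have key n : `|(l - l') * Int 0 pi (L n)| <= `|Int 0 pi (fun t => phi t * L n t)| +
    Int 0 pi (fun t => gap f x l l' t * `|L n t|).
  have I1 : intble 0 pi (fun t => phi t * L n t) by exact: intbleMc.
  have I2 : intble 0 pi (fun t => (l - l') * L n t) by exact/intbleZ/intble_continuous.
  rewrite -IntZ; last exact: intble_continuous.
  have -> : Int 0 pi (fun t => (l - l') * L n t) = Int 0 pi (fun t => phi t * L n t) -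
      Int 0 pi (fun t => (phi t - (l - l')) * L n t).
    rewrite -IntB//; first by apply: eq_Int => t _; ring.
    by apply: intbleMc => //; apply: intbleB => //; exact: intble_cst.
  apply: le_trans (ler_normB _ _) _; rewrite lerD2l.
  apply: le_norm_Int2.
  - by apply: intbleMc => //; apply: intbleB => //; exact: intble_cst.
  - apply: eq_intble (intble_norm (intbleMc (intble_gap x l l' 0 pi f1) (cL n))) => t _.
    by rewrite normrM ger0_norm ?gap_ge0.
  - move=> t _; rewrite normrM ler_wpM2r// /gap /phi.
    have -> : f (x + t) - f (x - t) - (l - l') = (f (x + t) - l) - (f (x - t) - l') by ring.
    exact: ler_normB.
apply/eqP; rewrite -subr_eq0; apply/negPn/negP => d0.
(* 24^-1 bounds the integral of [L] from below; allowing a quarter of |l - l'| / 24 to each of the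
   two terms of [key] is contradictory. *)
have d0' : 0 < `|l - l'| / 24 / 4 by rewrite !divr_gt0// normr_gt0.
have [||||N HN] := @approximate_identity_cvg _ (gap f x l l') L 8 _
  (intble_gap x l l' 0 pi f1) (fun t _ => gap_ge0 f x l l' t) (gap_avg f1 rf lf)
  cL _ _ (`|l - l'| / 24 / 4).
- by [].
- by move=> n t _; exact: norm_conj_fejer_kernel2_le.
- by move=> n t; exact: conj_fejer_kernel2_decay.
- by [].
have [|M HM] := dif (pi^-1 * (`|l - l'| / 24 / 4)); first by rewrite mulr_gt0// invr_gt0.
pose p := (N + M + 2)%N.
have pN : (N <= p.*2)%N by rewrite /p; lia.
have pM : (M <= p.*2)%N by rewrite /p; lia.
have H3 := HN _ pN; have := HM _ pM.
rewrite subr0 difE normrM normrN [`|pi^-1|]gtr0_norm ?invr_gt0//.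
rewrite ler_pM2l ?invr_gt0// => H2.
have := key p.*2; rewrite normrM => H1.
have : 24^-1 <= `|Int 0 pi (L p.*2)|.
  rewrite /L IntB; try exact: intble_continuous.
  by apply: le_trans (ler_norm _); apply: Int_conj_fejer_kernel2_ge; rewrite /p leq_addl.
move=> H4.
have H5 : `|l - l'| / 24 <= `|l - l'| * `|Int 0 pi (L p.*2)| by rewrite ler_wpM2l.
have n0 : 0 < `|l - l'| by rewrite normr_gt0.
lra.
Qed.

Lemma Rintegral_oo_Int (a b : R) f : intble a b f ->
  \int[mu]_(t in `]a, b[) f t = Int a b f.
Proof.
move=> fi; have [ab|ba] := leP a b; last first.
  by rewrite /Int !set_itv_ge// bnd_simp -?leNgt -?ltNge// ltW.
have fi' : mu.-integrable `]a, b] (EFin \o f).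
  by apply: integrableS fi => // t/=; rewrite !in_itv/= => /andP[/ltW -> ->].
rewrite Rintegral_itv_bndo_bndc; last first.
  by apply: integrableS fi' => // t/=; rewrite !in_itv/= => /andP[-> /ltW ->].
by rewrite Rintegral_itv_obnd_cbnd.
Qed.

(** At a Lebesgue point, the conjugate Fejer mean of order n is the principal value truncated at 1 /
    (n + 1), up to o(1). Below the truncation the kernel is at most n and the averages of the gap
    are small; above it the kernel differs from the cotangent by [K], which has the decay of an
    approximate identity. *)
Lemma conj_fejer_sum_cvg f x l (c : R) : L1 f -> ravg f x l -> lavg f x l ->
  - pi^-1 * \int[mu]_(t in `]e, pi[) ((f (x + t) - f (x - t)) / (2 * tan (t / 2)))
    @[e --> 0^'+] --> c ->
  conj_fejer_sum f n x @[n --> \oo] --> c.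
Proof.
move=> f1 rf lf /cvg_at_rightP pv; have p0 := @pi_gt0 R; have p2 := @pi_ge2 R.
pose phi t := f (x + t) - f (x - t).
have I0 a b : intble a b phi.
  by apply: intbleB; apply: L1_intble; [exact: L1_shift|exact: L1_rshift].
pose e_ n : R := n.+1%:R^-1.
have e0 n : 0 < e_ n by rewrite invr_gt0.
have e1 n : e_ n <= 1 by rewrite invf_le1// ler1n.
have ep n : e_ n <= pi by rewrite (le_trans (e1 n))// (le_trans _ p2)// ler1n.
have {pv} := pv e_ (conj e0 (@cvg_harmonic R)).
(* Bounding 1 - cos t from below by its value at [e_ n] removes the singularity at 0, so that [C]
   and [K] below are continuous everywhere; on [e_ n, pi] nothing changes. *)
pose q n t : R := Num.max (1 - cos t) (1 - cos (e_ n)).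
have cq n : continuous (q n).
  move=> t; apply: (@continuous_max _ _ (fun t => 1 - cos t)).
    by apply: cvgB; [exact: cvg_cst|exact: continuous_cos].
  exact: cvg_cst.
have ce n : 0 < 1 - cos (e_ n) by rewrite subr_gt0 cos_lt1// e0 ep.
have q0 n t : 0 < q n t by rewrite lt_max ce orbT.
have qE n t : e_ n <= t <= pi -> q n t = 1 - cos t.
  move=> /andP[et tp]; apply: max_l; rewrite lerB//.
  have [->//|en] := eqVneq t (e_ n).
  apply/ltW; rewrite ltr_cos ?in_itv/=.
  - by rewrite lt_neqAle eq_sym en et.
  - by rewrite ep ltW.
  - by rewrite tp (le_trans _ et)// ltW.
pose C n t : R := sin t / (2 * q n t).
have cC n : continuous (C n).
  move=> t; apply: cvgM; first exact: continuous_sin.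
  apply: cvgV; first by rewrite mulf_neq0// gt_eqF.
  by apply: cvgM; [exact: cvg_cst|exact: cq].
pose K n t : R := - sin (n.+1%:R * t) / (2 * n.+1%:R * q n t).
have cK n : continuous (K n).
  move=> t; apply: cvgM; first by apply: cvgN; exact: continuous_sinM.
  apply: cvgV; first by rewrite !mulf_neq0// ?gt_eqF// pnatr_eq0.
  by apply: cvgM; [exact: cvg_cst|exact: cq].
have CE n t : e_ n <= t <= pi -> (2 * tan (t / 2))^-1 = C n t.
  move=> tp; rewrite cot_halfE ?/C ?qE//; case/andP: tp => et ->.
  by rewrite (lt_le_trans _ et).
have KE n t : e_ n <= t <= pi -> conj_fejer_kernel n t = C n t + K n t.
  move=> tp; rewrite -CE// /K qE// -conj_fejer_kernel_cot; first by ring.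
  by case/andP: tp => et ->; rewrite (lt_le_trans _ et).
have pvE n : \int[mu]_(t in `]e_ n, pi[) (phi t / (2 * tan (t / 2))) =
    Int (e_ n) pi (fun t => phi t * C n t).
  rewrite Rintegral_oo_Int; first by apply: eq_Int => t /CE ->.
  by apply: eq_intble (intbleMc (I0 _ _) (cC n)) => t /CE ->.
pose S n := Int 0 (e_ n) (fun t => phi t * conj_fejer_kernel n t) +
            Int (e_ n) pi (fun t => phi t * K n t).
have ck n : continuous (@conj_fejer_kernel R n) by exact: continuous_sin_sum.
have sE n : conj_fejer_sum f n x =
    - pi^-1 * \int[mu]_(t in `]e_ n, pi[) (phi t / (2 * tan (t / 2))) - pi^-1 * S n.
  rewrite conj_fejer_sumE// pvE.
  have -> : Int 0 pi (fun t => phi t * conj_fejer_kernel n t) =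
      S n + Int (e_ n) pi (fun t => phi t * C n t).
    rewrite (@Int_cat _ (e_ n)) ?(ltW (e0 n))//; last exact: intbleMc.
    rewrite /S -addrA; congr (_ + _); rewrite -IntD; try exact: intbleMc.
    by apply: eq_Int => t /KE ->; ring.
  by ring.
move=> /cvg_seqP pv; apply/cvg_seqP => e e_gt0.
have gapE t : `|phi t| <= gap f x l l t.
  rewrite /phi /gap; have -> : f (x + t) - f (x - t) = (f (x + t) - l) - (f (x - t) - l) by ring.
  exact: ler_normB.
have e4 : 0 < pi * e / 4 by rewrite divr_gt0// mulr_gt0.
have [||||N1 H1] := @approximate_identity_cvg _ (gap f x l l) K 4 _
  (intble_gap x l l 0 pi f1) (fun t _ => gap_ge0 f x l l t) (gap_avg f1 rf lf)
  cK _ _ (pi * e / 4) _.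
- by [].
- move=> n t tp; rewrite /K mulNr normrN normrM.
  rewrite [X in _ * X]gtr0_norm ?invr_gt0 ?mulr_gt0//.
  rewrite ler_pdivrMr ?mulr_gt0//; apply: le_trans (norm_sin_le1 _) _.
  have : (e_ n) ^+ 2 <= 8 * q n t.
    apply: le_trans (sqr_le_1subcos _) _; first by rewrite ep ltW.
    by rewrite ler_wpM2l// le_max lexx orbT.
  move=> h; have n0 : (n.+1%:R : R) != 0 by rewrite pnatr_eq0.
  have E : n.+1%:R ^+ 2 * e_ n ^+ 2 = 1 by rewrite -exprMn /e_ mulfV// expr1n.
  rewrite -[leLHS]E.
  have -> : 4 * n.+1%:R * (2 * n.+1%:R * q n t) = n.+1%:R ^+ 2 * (8 * q n t) by ring.
  by rewrite ler_wpM2l// sqr_ge0.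
- move=> n t tp; rewrite /K mulNr normrN normrM.
  rewrite (@gtr0_norm _ (2 * n.+1%:R * q n t)^-1) ?invr_gt0 ?mulr_gt0//.
  rewrite mulrAC ler_pdivrMr ?mulr_gt0//.
  have h : t ^+ 2 <= 8 * q n t.
    apply: le_trans (sqr_le_1subcos tp) _.
    by rewrite ler_wpM2l// le_max lexx.
  rewrite (_ : 4 * _ = 1 * (n.+1%:R * (8 * q n t))); last by ring.
  apply: ler_pM => //; [by rewrite mulr_ge0// sqr_ge0|exact: norm_sin_le1|].
  exact: ler_wpM2l.
- by [].
have [d d0 Hd] := gap_avg f1 rf lf e4.
have [|N3 H3] := pv (e / 2); first by rewrite divr_gt0.
exists (N1 + N3 + Num.bound d^-1)%N => n nN.
have nN1 : (N1 <= n)%N by apply: leq_trans nN; rewrite -addnA leq_addr.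
have nN3 : (N3 <= n)%N by apply: leq_trans nN; rewrite addnAC leq_addl.
have nd : e_ n <= d.
  rewrite /e_ -[d]invrK lef_pV2 ?posrE ?invr_gt0//; apply/ltW.
  apply: lt_le_trans (archi_boundP _) _; first by rewrite invr_ge0 ltW.
  by rewrite ler_nat leqW// (leq_trans _ nN)// leq_addl.
have S1 : `|Int 0 (e_ n) (fun t => phi t * conj_fejer_kernel n t)| <= pi * e / 4.
  apply: (@le_trans _ _ (Int 0 (e_ n) (fun t => n.+1%:R * gap f x l l t))).
    apply: le_norm_Int2; [exact: intbleMc|exact/intbleZ/intble_gap|].
    move=> t _; rewrite normrM mulrC ler_pM//.
    by apply: le_trans (norm_conj_fejer_kernel_le n t) _; rewrite ler_nat.
  rewrite IntZ; last exact: intble_gap.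
  rewrite -ler_pdivlMl//; apply: le_trans (Hd _ (e0 n) nd) _.
  by rewrite mulrC.
have S2 : `|Int (e_ n) pi (fun t => phi t * K n t)| <= pi * e / 4.
  have IK : intble 0 pi (fun t => gap f x l l t * `|K n t|).
    apply: eq_intble (intble_norm (intbleMc (intble_gap x l l 0 pi f1) (cK n))) => t _.
    by rewrite normrM ger0_norm ?gap_ge0.
  apply: le_trans (H1 n nN1).
  apply: (@le_trans _ _ (Int (e_ n) pi (fun t => gap f x l l t * `|K n t|))).
    apply: le_norm_Int2; [exact: intbleMc|exact: (intbleW (ltW (e0 n)) (lexx _) IK)|].
    by move=> t _; rewrite normrM ler_wpM2r.
  apply: le_Int_dom => //; first exact: ltW.
  by move=> t _; rewrite mulr_ge0// gap_ge0.
have := H3 n nN3; rewrite sE -/phi; set P := - pi^-1 * _ => HP.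
have HS : `|pi^-1 * S n| <= e / 2.
  rewrite normrM gtr0_norm ?invr_gt0// ler_pdivrMl//.
  by apply: le_trans (ler_normD _ _) _; lra.
have -> : P - pi^-1 * S n - c = (P - c) - pi^-1 * S n by ring.
by apply: le_trans (ler_normB _ _) _; lra.
Qed.

Lemma fejer_sum_ge0 f n x : L1 f -> (forall t, 0 <= f t) -> 0 <= fejer_sum f n x.
Proof.
move=> f1 f0; rewrite fejer_sumE// mulr_ge0 ?invr_ge0 ?pi_ge0//.
by apply: Int_ge0 => t /fejer_kernel_ge0 k0; rewrite mulr_ge0// addr_ge0.
Qed.

Lemma fejer_sum_unif f : periodic f (pi *+ 2) -> continuous f ->
  forall e, 0 < e -> exists N, forall n, (N <= n)%N ->
    forall x, `|fejer_sum f n x - f x| <= e.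
Proof.
move=> fT cf e e0; have f1 := L1_continuous fT cf; have p0 := @pi_gt0 R.
have [M M0 fM] := periodic_bounded fT cf.
(* Multiplied by 8 (decay of the kernel), 9 ([approximate_identity]) and 2 (the two terms of [gap]),
   this is pi * e / 2. None of the choices depends on x. *)
have e1 : 0 < pi * e / 8 / 18 / 2 by rewrite !divr_gt0// mulr_gt0.
have [d d0 Hd] := periodic_unif_continuous fT cf e1.
pose d' := Num.min d pi.
have d'0 : 0 < d' by rewrite lt_min d0 p0.
have d'p : d' <= pi by rewrite ge_min lexx orbT.
have e2 : 0 < pi * e / 16 by rewrite !divr_gt0// mulr_gt0.
pose B := (M *+ 4 * pi) / d' ^+ 2 / (pi * e / 16).
have B0 : 0 <= B.
  apply: divr_ge0; last exact: ltW.
  apply: divr_ge0; last exact: sqr_ge0.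
  by apply: mulr_ge0; [exact: mulrn_wge0|exact: ltW].
exists (Num.bound B) => n Nn x.
have nB : B <= n.+1%:R.
  by apply/ltW/(lt_le_trans (archi_boundP B0)); rewrite ler_nat leqW.
have -> : f x = (f x + f x) / 2 by field.
apply: le_trans (fejer_sum_sub n x (f x) (f x) f1) _.
rewrite ler_pdivrMl//.
have I0 a b := intble_gap x (f x) (f x) a b f1.
have e3 : 0 <= pi * e / 8 / 18 by rewrite ltW// !divr_gt0// mulr_gt0.
have I1 : intble 0 pi (fun t => gap f x (f x) (f x) t * fejer_kernel n t).
  by apply: intbleMc => //; exact: continuous_fejer_kernel.
apply: le_trans (@approximate_identity _ (gap f x (f x) (f x)) (fejer_kernel n)
  n.+1%:R 8 _ d' d'0 d'p _ e3 _ (I0 _ _) _ _ _ _ I1) _ => //.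
- by move=> t _; exact: gap_ge0.
- move=> h h0; rewrite le_min => /andP[hd _].
  rewrite -[leRHS](_ : Int 0 h (fun=> pi * e / 8 / 18) = _); last first.
    by rewrite Int_cst ?subr0// ltW.
  apply: le_Int => //; first exact: intble_cst.
  move=> t /andP[t0 th]; rewrite /gap.
  have h1 : `|f (x + t) - f x| <= pi * e / 8 / 18 / 2.
    by apply: Hd; rewrite addrAC subrr add0r ger0_norm// (le_trans th).
  have h2 : `|f (x - t) - f x| <= pi * e / 8 / 18 / 2.
    by apply: Hd; rewrite addrAC subrr add0r normrN ger0_norm// (le_trans th).
  lra.
- move=> t _; apply: le_trans (norm_fejer_kernel_le n t) _.
  by rewrite ler_peMl// ler1n.
- by move=> t; exact: fejer_kernel_decay.
set J := Int 0 pi _.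
have JM : J <= M *+ 4 * pi.
  rewrite -[leRHS](_ : Int 0 pi (fun=> M *+ 4) = _); last first.
    by rewrite Int_cst ?subr0// ltW.
  apply: le_Int => //; first exact: intble_cst.
  move=> t _; rewrite /gap; have := ler_normB (f (x + t)) (f x).
  have := ler_normB (f (x - t)) (f x).
  have := fM x; have := fM (x + t); have := fM (x - t).
  by rewrite -mulr_natr; lra.
have HJ : J / (n.+1%:R * d' ^+ 2) <= pi * e / 16.
  apply: (@le_trans _ _ ((M *+ 4 * pi) / (n.+1%:R * d' ^+ 2))).
    by apply: ler_wpM2r JM; rewrite invr_ge0 mulr_ge0// sqr_ge0.
  rewrite invfM mulrCA mulrC ler_pdivrMr//.
  by move: nB; rewrite /B ler_pdivrMr// [leRHS]mulrC.
move: HJ; set y := J / _; set z := pi * e; lra.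
Qed.

End fejer_means.

(** * Analytic trigonometric polynomials *)

Section analytic_polynomials.
Context {R : realType}.
Implicit Types (p q w : {poly R[i]}) (z : R[i]) (t e : R).
Local Notation mu := (@lebesgue_measure R).
Local Notation cn := (@Normc.normc R).
Local Notation Re := (@complex.Re R).
Local Notation Im := (@complex.Im R).

Lemma RecM z z' : Re (z * z') = Re z * Re z' - Im z * Im z'.
Proof. by case: z; case: z'. Qed.

Lemma ImcM z z' : Im (z * z') = Re z * Im z' + Im z * Re z'.
Proof. by case: z => a b; case: z' => c d /=; rewrite [b * c]mulrC. Qed.

Lemma RecD z z' : Re (z + z') = Re z + Re z'.
Proof. by case: z; case: z'. Qed.

Lemma ImcD z z' : Im (z + z') = Im z + Im z'.
Proof. by case: z; case: z'. Qed.

Lemma RecN z : Re (- z) = - Re z. Proof. by case: z. Qed.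

Lemma ImcN z : Im (- z) = - Im z. Proof. by case: z. Qed.

Lemma Rec_sum I (s : seq I) (P : pred I) (F : I -> R[i]) :
  Re (\sum_(i <- s | P i) F i) = \sum_(i <- s | P i) Re (F i).
Proof. by apply: (big_morph Re RecD). Qed.

Lemma normc_sqr z : cn z ^+ 2 = Re z ^+ 2 + Im z ^+ 2.
Proof. by case: z => a b /=; rewrite sqr_sqrtr// addr_ge0// sqr_ge0. Qed.

Lemma normc_ge0 z : 0 <= cn z.
Proof. by case: z => a b /=; exact: sqrtr_ge0. Qed.

Lemma norm_Re_le z : `|Re z| <= cn z.
Proof.
rewrite -(ler_pXn2r (n := 2)) ?nnegrE ?normc_ge0// normc_sqr real_normK ?num_real//.
by rewrite lerDl sqr_ge0.
Qed.

Lemma normc_le z : cn z <= `|Re z| + `|Im z|.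
Proof.
rewrite -(ler_pXn2r (n := 2)) ?nnegrE ?normc_ge0 ?addr_ge0// normc_sqr sqrrD.
by rewrite !real_normK ?num_real// addrAC lerDl mulrn_wge0// mulr_ge0.
Qed.

Lemma normcM z z' : cn (z * z') = cn z * cn z'.
Proof. exact: Normc.normcM. Qed.

Lemma normcD z z' : cn (z + z') <= cn z + cn z'.
Proof. exact: le_normcD. Qed.

Lemma normcN1 z : cn (- z) = cn z.
Proof. exact: normcN. Qed.

Lemma normcB z z' : cn (z - z') <= cn z + cn z'.
Proof. by rewrite -[X in _ <= _ + X]normcN1; exact: normcD. Qed.

Lemma normc_one : cn 1 = 1.
Proof. exact: Normc.normc1. Qed.

Lemma normcX z n : cn (z ^+ n) = cn z ^+ n.
Proof.
elim: n => [|n IH]; first by rewrite !expr0 normc_one.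
by rewrite !exprS normcM IH.
Qed.

Lemma normc_inv z : cn z^-1 = (cn z)^-1.
Proof. exact: Normc.normcV. Qed.

Definition expi t : R[i] := Complex (cos t) (sin t).

Lemma normc_expi t : cn (expi t) = 1.
Proof. by rewrite /expi /= cos2Dsin2 sqrtr1. Qed.

Lemma expiX t k : expi t ^+ k = expi (k%:R * t).
Proof.
elim: k => [|k IH]; first by rewrite expr0 mul0r /expi cos0 sin0.
rewrite exprS IH; apply/eqP; rewrite eq_complex RecM ImcM /=.
by rewrite -natr1 mulrDl mul1r cosD sinD; apply/andP; split; apply/eqP; ring.
Qed.

Lemma Re_hornerE p t : Re p.[expi t] =
  \sum_(k < size p) (Re p`_k * cos (k%:R * t) - Im p`_k * sin (k%:R * t)).
Proof.
by rewrite horner_coef Rec_sum; apply: eq_bigr => k _; rewrite expiX RecM.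
Qed.

Lemma continuous_Re_horner p : continuous (fun t => Re p.[expi t]).
Proof.
under eq_fun do rewrite Re_hornerE.
apply: continuous_bigsum => k t; apply: cvgB; apply: cvgM; try exact: cvg_cst.
  exact: continuous_cosM.
exact: continuous_sinM.
Qed.

Lemma Im_Re z : Im z = Re (- (Complex 0 1) * z).
Proof. by rewrite RecM RecN ImcN /= oppr0 mul0r sub0r mulN1r opprK. Qed.

Lemma continuous_Im_horner p : continuous (fun t => Im p.[expi t]).
Proof.
have -> : (fun t => Im p.[expi t]) = (fun t => Re (- (Complex 0 1) *: p).[expi t]).
  by apply/funext => t; rewrite hornerZ -Im_Re.
exact: continuous_Re_horner.
Qed.

Lemma Int_cosM_sym k : (0 < k)%N -> Int (- pi) pi (fun t => cos (k%:R * t) : R) = 0.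
Proof.
move=> k0; rewrite Int_sym ?pi_ge0//; last exact/intble_continuous/continuous_cosM.
transitivity (Int 0 pi (fun t => 2 * cos (k%:R * t) : R)).
  by apply: eq_Int => t _; rewrite mulrN cosN; ring.
by rewrite IntZ ?Int_cosM ?mulr0//; exact/intble_continuous/continuous_cosM.
Qed.

Lemma Int_sinM_sym k : Int (- pi) pi (fun t => sin (k%:R * t) : R) = 0.
Proof.
rewrite Int_sym ?pi_ge0//; last exact/intble_continuous/continuous_sinM.
rewrite -[RHS](mul0r (pi - 0)) -Int_cst ?pi_ge0//.
by apply: eq_Int => t _; rewrite mulrN sinN subrr.
Qed.

Lemma Int_poly p : Int (- pi) pi (fun t => Re p.[expi t]) = 2 * pi * Re p`_0.
Proof.
have pp : - pi <= pi :> R by rewrite ge0_cp// pi_ge0.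
under [X in Int _ _ X]eq_fun do rewrite Re_hornerE.
have Ic k : intble (- pi) pi (fun t => Re p`_k * cos (k%:R * t)).
  exact/intbleZ/intble_continuous/continuous_cosM.
have Is k : intble (- pi) pi (fun t => Im p`_k * sin (k%:R * t)).
  exact/intbleZ/intble_continuous/continuous_sinM.
rewrite Int_sum//; last by move=> k _; exact: intbleB.
have E (k : nat) : Int (- pi) pi (fun t => Re p`_k * cos (k%:R * t) - Im p`_k * sin (k%:R * t))
    = if k == 0%N then 2 * pi * Re p`_0 else 0.
  rewrite IntB// !IntZ; try exact/intble_continuous/continuous_cosM;
    try exact/intble_continuous/continuous_sinM.
  rewrite Int_sinM_sym mulr0 subr0; case: eqP => [->|/eqP]; last first.
    by rewrite -lt0n => k0; rewrite Int_cosM_sym// mulr0.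
  rewrite (@eq_Int _ _ _ _ (fun=> 1)) ?Int_cst//; first by ring.
  by move=> t _; rewrite mul0r cos0.
under eq_bigr do rewrite E.
have [s0|] := eqVneq (size p) 0%N.
  rewrite s0 big_ord0 nth_default ?s0//=; by rewrite mulr0.
case: (size p) => // n _.
by rewrite big_ord_recl/= big1 ?addr0.
Qed.

Lemma horner_bounded p : exists2 B, 1 <= B & forall t, cn p.[expi t] <= B.
Proof.
exists (1 + \sum_(k < size p) cn p`_k).
  by rewrite lerDl sumr_ge0// => k _; exact: normc_ge0.
move=> t; apply: (@le_trans _ _ (\sum_(k < size p) cn p`_k)); last by rewrite lerDr.
rewrite horner_coef; elim/big_ind2 : _ => [|x a y b xa yb|k _].
- by rewrite Normc.normc0.
- by apply: le_trans (normcD _ _) _; exact: lerD.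
- by rewrite normcM normcX normc_expi expr1n mulr1.
Qed.

Lemma expr_small (r e : R) : 0 <= r < 1 -> 0 < e -> exists n, r ^+ n <= e.
Proof.
move=> /andP[r0 r1] e0.
have /cvg_expr/cvg_seqP/(_ _ e0)[n Hn] : `|r| < 1 by rewrite ger0_norm.
by exists n; have := Hn n (leqnn n); rewrite subr0 ger0_norm// exprn_ge0.
Qed.

(** Neumann series. If |w| <= B and c = 1 / B^2, then |1 - c w|^2 = 1 - 2 c Re w + c^2 |w|^2 <= 1 -
    c, so the partial sums of c (1 - c w)^i converge uniformly to 1 / w on the circle. *)
Lemma inverse_approx w e : (forall t, 1 <= Re w.[expi t]) -> 0 < e ->
  exists q, forall t, cn (q.[expi t] - w.[expi t]^-1) <= e.
Proof.
move=> w1 e0; have [B B1 wB] := horner_bounded w.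
have B0 : 0 < B by exact: lt_le_trans B1.
pose c := (B ^+ 2)^-1.
have c0 : 0 < c by rewrite invr_gt0 exprn_gt0.
have c1 : c <= 1 by rewrite invf_le1 ?exprn_gt0// exprn_ege1.
(* The bound 1 - c is on the squared modulus, hence the square of e. *)
have [n rn] : exists n, (1 - c) ^+ n <= e ^+ 2.
  by apply: expr_small; rewrite ?exprn_gt0// subr_ge0 c1 ltrBlDr ltrDl c0.
pose x := 1 - (Complex c 0) *: w; exists ((Complex c 0) *: \sum_(i < n) x ^+ i) => t.
have wn0 : w.[expi t] != 0.
  by apply/eqP => w0; have := w1 t; rewrite w0 /= ler10.
have xE : x.[expi t] = 1 - (Complex c 0) * w.[expi t] by rewrite /x !hornerE.
have sE : (Complex c 0 *: \sum_(i < n) x ^+ i).[expi t] * w.[expi t] = 1 - x.[expi t] ^+ n.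
  rewrite hornerZ horner_sum; under eq_bigr do rewrite horner_exp.
  rewrite mulrAC -[RHS]opprB subrX1 -mulNr opprB; congr (_ * _).
  by rewrite xE opprB addrC subrK.
have -> : (Complex c 0 *: \sum_(i < n) x ^+ i).[expi t] - w.[expi t]^-1 =
    - (x.[expi t] ^+ n / w.[expi t]).
  by rewrite -[X in X - _](mulfK wn0) sE mulrBl mul1r; ring.
rewrite normcN1 normcM normcX normc_inv.
have wge1 : 1 <= cn w.[expi t].
  by apply: le_trans (w1 t) _; apply: le_trans (ler_norm _) _; exact: norm_Re_le.
have xr : cn x.[expi t] ^+ 2 <= 1 - c.
  rewrite xE normc_sqr !RecD !ImcD !RecN !ImcN !RecM !ImcM /= !mul0r subr0 addr0.
  have := wB t; have := w1 t; have := normc_sqr w.[expi t].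
  set u := Re _; set v := Im _; set m := cn _ => mE u1 mB.
  have m2 : m ^+ 2 <= B ^+ 2 by rewrite lerXn2r ?nnegrE ?normc_ge0// (le_trans _ mB)// normc_ge0.
  have cB : c * (c * m ^+ 2) <= c.
    rewrite ger_pMr// mulrC ler_pdivrMr ?mul1r// exprn_gt0//.
  have -> : (1 - c * u) ^+ 2 + (0 - c * v) ^+ 2 =
      1 - 2 * (c * u) + c * (c * (u ^+ 2 + v ^+ 2)) by ring.
  rewrite -mE; have : c <= c * u by rewrite ler_peMr// ltW.
  lra.
apply: (@le_trans _ _ (cn x.[expi t] ^+ n)).
  by rewrite ler_pdivrMr ?(lt_le_trans _ wge1)// ler_peMr// exprn_ge0// normc_ge0.
rewrite -(ler_pXn2r (n := 2)) ?nnegrE ?exprn_ge0 ?normc_ge0 ?(ltW e0)//.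
apply: le_trans rn; rewrite -exprM mulnC exprM lerXn2r ?nnegrE ?sqr_ge0//.
by rewrite subr_ge0.
Qed.

End analytic_polynomials.

Section conjugate_coefficients.
Context {R : realType}.
Implicit Types (p q w : {poly R[i]}) (z : R[i]) (f g : R -> R) (t e x : R).
Local Notation mu := (@lebesgue_measure R).
Local Notation cn := (@Normc.normc R).
Local Notation Re := (@complex.Re R).
Local Notation Im := (@complex.Im R).

Let pp : - pi <= pi :> R. Proof. by rewrite ge0_cp// pi_ge0. Qed.

Lemma small_eq0 (x B : R) : 0 <= B -> (forall e, 0 < e -> e <= 1 -> `|x| <= B * e) -> x = 0.
Proof.
move=> B0 H; apply/eqP; rewrite -normr_eq0 eq_le normr_ge0 andbT.
apply/ler_addgt0Pl => e e0; rewrite addr0.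
have B1 : 0 < B + 1 by rewrite ltr_wpDl.
have d0 : 0 < Num.min (e / (B + 1)) 1 by rewrite lt_min divr_gt0//=.
apply: le_trans (H _ d0 _) _; first by rewrite ge_min lexx orbT.
apply: (@le_trans _ _ (B * (e / (B + 1)))).
  by apply: ler_wpM2l => //; rewrite ge_min lexx.
rewrite mulrCA ger_pMr// ler_pdivrMr// mul1r lerDl.
exact: ler01.
Qed.

Lemma continuous_Re_inv w : (forall t, w.[expi t] != 0) ->
  continuous (fun t => Re w.[expi t]^-1) /\ continuous (fun t => Im w.[expi t]^-1).
Proof.
move=> w0; have n0 t : Re w.[expi t] ^+ 2 + Im w.[expi t] ^+ 2 != 0.
  rewrite -normc_sqr expf_eq0/=; apply/eqP => /Normc.eq0_normc w00.
  by have := w0 t; rewrite w00 eqxx.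
have cN t : {for t, continuous (fun t => (Re w.[expi t] ^+ 2 + Im w.[expi t] ^+ 2)^-1)}.
  apply: cvgV => //; apply: cvgD; apply: cvgM; try exact: continuous_Re_horner;
    exact: continuous_Im_horner.
have E t : w.[expi t]^-1 = Complex (Re w.[expi t] / (Re w.[expi t] ^+ 2 + Im w.[expi t] ^+ 2))
    (- Im w.[expi t] / (Re w.[expi t] ^+ 2 + Im w.[expi t] ^+ 2)).
  by case: w.[_] => a b /=; rewrite mulNr.
split=> t.
  under eq_fun do rewrite E /=.
  by apply: cvgM; [exact: continuous_Re_horner|exact: cN].
under eq_fun do rewrite E /=.
by apply: cvgM; [apply: cvgN; exact: continuous_Im_horner|exact: cN].
Qed.

(** * Inverses of polynomials with values in the half-plane Re >= 1 *)

Section right_half_plane.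
Variable w : {poly R[i]}.
Hypothesis w1 : forall t, 1 <= Re w.[expi t].

Let wn0 t : w.[expi t] != 0.
Proof. by apply/eqP => w0; have := w1 t; rewrite w0 /= ler10. Qed.

Lemma normc_ge1 t : 1 <= cn w.[expi t].
Proof. by apply: le_trans (w1 t) _; apply: le_trans (ler_norm _) _; exact: norm_Re_le. Qed.

Lemma normc_inv_le1 t : cn w.[expi t]^-1 <= 1.
Proof. by rewrite normc_inv invf_le1 ?normc_ge1// (lt_le_trans _ (normc_ge1 t)). Qed.

(** For |z| <= 1 one has |1 - z|^2 <= 2 (1 - Re z). The distance of 1 / w to 1 is thus controlled by
    a real part, whose mean can be estimated. *)
Lemma normc_1sub_inv t : cn (1 - w.[expi t]^-1) ^+ 2 <= 2 * (1 - Re w.[expi t]^-1).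
Proof.
rewrite normc_sqr !RecD !ImcD !RecN !ImcN /=.
have : cn w.[expi t]^-1 ^+ 2 <= 1 by rewrite expr_le1 ?normc_inv_le1// normc_ge0.
rewrite normc_sqr; set u := Re _; set v := Im _; nra.
Qed.

(** By the mean value property the mean of 1 / w should be 1 / (1 + m) >= 1 - m. It is applied to a
    polynomial q close to 1 / w: the constant coefficient of w q is close to 1. *)
Lemma Int_1sub_inv (m : R) : 0 <= m -> w`_0 = Complex (1 + m) 0 ->
  Int (- pi) pi (fun t => 1 - Re w.[expi t]^-1) <= 2 * pi * m.
Proof.
move=> m0 w0; have p0 := @pi_gt0 R.
have [cR _] := continuous_Re_inv wn0.
have [B B1 wB] := horner_bounded w.
apply/ler_addgt0Pl => e e0.
(* An error d on 1 / w costs B d on the constant coefficient of q and d on the mean of 1 / w. *)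
pose d := e / (2 * pi * (B + 1)).
have BB : 0 < B + 1 by lra.
have d0 : 0 < d by rewrite divr_gt0// !mulr_gt0.
have [q qw] := inverse_approx w1 d0.
have q0 : 1 - m - B * d <= Re q`_0.
  have H : `|Int (- pi) pi (fun t => Re (w * q - 1).[expi t])| <=
     Int (- pi) pi (fun=> B * d).
    apply: le_norm_Int2.
    - exact/intble_continuous/continuous_Re_horner.
    - exact: intble_cst.
    - move=> t _; apply: le_trans (norm_Re_le _) _.
      have -> : (w * q - 1).[expi t] = w.[expi t] * (q.[expi t] - w.[expi t]^-1).
        by rewrite !hornerE mulrBr mulfV.
      rewrite normcM; apply: ler_pM => //; exact: normc_ge0.
  move: H; rewrite Int_poly Int_cst// coefB coef1/= coef0M w0 RecD RecM RecN /= mul0r subr0.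
  rewrite (_ : B * d * (pi - - pi) = 2 * pi * (B * d)); last by ring.
  rewrite normrM gtr0_norm ?mulr_gt0// ler_pM2l ?mulr_gt0//.
  set r := Re _; rewrite ler_norml => /andP[h1 h2].
  have Bd : 0 <= B * d by rewrite mulr_ge0//; lra.
  have : (1 + m) * (1 - m - B * d) <= (1 + m) * r.
    by apply: le_trans (_ : _ <= 1 - B * d) _; nra.
  by rewrite ler_pM2l// ltr_wpDr.
have H : Int (- pi) pi (fun t => Re q.[expi t] - d) <= Int (- pi) pi (fun t => Re w.[expi t]^-1).
  apply: le_Int.
  - by apply: intbleB; [exact/intble_continuous/continuous_Re_horner|exact: intble_cst].
  - exact: intble_continuous.
  - move=> t _; have := le_trans (norm_Re_le _) (qw t).
    by rewrite RecD RecN ler_norml => /andP[h1 h2]; lra.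
move: H; rewrite IntB; [|exact/intble_continuous/continuous_Re_horner|exact: intble_cst].
rewrite Int_poly Int_cst// => H.
rewrite IntB; [|exact: intble_cst|exact: intble_continuous].
rewrite Int_cst//.
have ed : e = 2 * pi * (B * d) + 2 * pi * d.
  have dE : d * (2 * pi * (B + 1)) = e by rewrite /d divfK// gt_eqF// !mulr_gt0.
  by rewrite -[LHS]dE; ring.
have : 2 * pi * (1 - m - B * d) <= 2 * pi * Re q`_0 by rewrite ler_pM2l// mulr_gt0.
rewrite ed; lra.
Qed.

End right_half_plane.

(** Once the two inverses are replaced by polynomials, the integrand is the real part of a
    polynomial divisible by 'X^k, whose constant coefficient vanishes. *)
Lemma Int_analytic_quotient p w w' k : (0 < k)%N ->
  (forall t, 1 <= Re w.[expi t]) -> (forall t, 1 <= Re w'.[expi t]) ->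
  Int (- pi) pi (fun t => Re (p.[expi t] * expi t ^+ k *
    (w.[expi t]^-1 * w'.[expi t]^-1))) = 0.
Proof.
move=> k0 w1 w'1; have p0 := @pi_gt0 R.
have wn0 t : w.[expi t] != 0.
  by apply/eqP => w0; have := w1 t; rewrite w0 /= ler10.
have w'n0 t : w'.[expi t] != 0.
  by apply/eqP => w0; have := w'1 t; rewrite w0 /= ler10.
have [cR cI] := continuous_Re_inv wn0; have [cR' cI'] := continuous_Re_inv w'n0.
pose h := p * 'X^k.
have hE t : h.[expi t] = p.[expi t] * expi t ^+ k by rewrite /h hornerM hornerXn.
have [B B1 hB] := horner_bounded h.
have IG : intble (- pi) pi (fun t => Re (p.[expi t] * expi t ^+ k *
    (w.[expi t]^-1 * w'.[expi t]^-1))).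
  apply: intble_continuous => t; under eq_fun do rewrite -hE RecM RecM ImcM.
  apply: cvgB; apply: cvgM; try exact: continuous_Re_horner; try exact: continuous_Im_horner.
    by apply: cvgB; apply: cvgM; [exact: cR|exact: cR'|exact: cI|exact: cI'].
  by apply: cvgD; apply: cvgM; [exact: cR|exact: cI'|exact: cI|exact: cR'].
(* With each inverse approximated within e <= 1, their product is off by at most e + 2 e, the factor
   2 bounding |q|. *)
apply: (@small_eq0 _ (2 * pi * (B * 3))).
  by rewrite !mulr_ge0// ?(ltW p0)//; lra.
move=> e e0 e1; have [q qw] := inverse_approx w1 e0; have [q' qw'] := inverse_approx w'1 e0.
have I0 : Int (- pi) pi (fun t => Re (h * (q * q')).[expi t]) = 0.
  by rewrite Int_poly coef0M /h coefMXn k0 mul0r mulr0.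
rewrite -[Int _ _ _]subr0 -I0 -IntB//; last exact/intble_continuous/continuous_Re_horner.
have -> : 2 * pi * (B * 3) * e = Int (- pi) pi (fun=> B * (3 * e)).
  by rewrite Int_cst//; ring.
apply: le_norm_Int2; [|exact: intble_cst|].
  by apply: intbleB => //; exact/intble_continuous/continuous_Re_horner.
move=> t _; rewrite -RecN -RecD -hE (hornerM h) (hornerM q) -mulrBr.
apply: le_trans (norm_Re_le _) _; rewrite normcM; apply: ler_pM; rewrite ?normc_ge0//.
set a := w.[_]^-1; set a' := w'.[_]^-1; set b := q.[_]; set b' := q'.[_].
have -> : a * a' - b * b' = - ((b - a) * a' + b * (b' - a')) by ring.
rewrite normcN1; apply: le_trans (normcD _ _) _; rewrite !normcM.
have a1 : cn a' <= 1 by exact: normc_inv_le1.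
have aa1 : cn a <= 1 by exact: normc_inv_le1.
have b1 : cn b <= 2.
  rewrite -[b](subrK a); apply: le_trans (normcD _ _) _.
  by have := qw t; rewrite -/a -/b; lra.
apply: (@le_trans _ _ (e * 1 + 2 * e)); last by lra.
apply: lerD; apply: ler_pM; rewrite ?normc_ge0//; [exact: qw|exact: qw'].
Qed.

Lemma Int_dominated_cvg0 (a b : R) (u : nat -> R -> R) g : intble a b g ->
  (forall n, measurable_fun `[a, b] (u n)) ->
  (\forall t \ae mu, a <= t <= b -> u n t @[n --> \oo] --> (0 : R)) ->
  (forall n t, a <= t <= b -> `|u n t| <= g t) ->
  Int a b (u n) @[n --> \oo] --> (0 : R).
Proof.
move=> gi mu_ u0 ug.
have [|||||_ _ H] := @dominated_convergence _ _ _ mu `[a, b]%classic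
    (measurable_segment a b) (fun n t => (u n t)%:E) (cst 0%E) (EFin \o g).
- by move=> n; apply/measurable_EFinP; exact: mu_.
- exact: measurable_cst.
- apply: filterS u0 => t H tab.
  have {}H : u n t @[n --> \oo] --> (0 : R) by apply: H; rewrite /= in_itv in tab.
  by apply: cvg_EFin => //; exact: nearW.
- exact: gi.
- by apply/aeW => t n tab; rewrite lee_fin; apply: ug; rewrite /= in_itv in tab.
rewrite integral0 in H; exact: (fine_cvg H).
Qed.

End conjugate_coefficients.

(** * Fourier coefficients of the conjugate function *)

Section conjugate_function.
Context {R : realType}.
Implicit Types (p q w : {poly R[i]}) (z : R[i]) (f g : R -> R) (t e x : R).
Local Notation mu := (@lebesgue_measure R).
Local Notation cn := (@Normc.normc R).
Local Notation Re := (@complex.Re R).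
Local Notation Im := (@complex.Im R).

Let pp : - pi <= pi :> R. Proof. by rewrite ge0_cp// pi_ge0. Qed.

Definition continuousC (h : R -> R[i]) :=
  continuous (fun t => Re (h t)) /\ continuous (fun t => Im (h t)).

Lemma continuousC_cst z : continuousC (fun=> z).
Proof. by split=> t; exact: cvg_cst. Qed.

Lemma continuousCM h h' : continuousC h -> continuousC h' ->
  continuousC (fun t => h t * h' t).
Proof.
move=> [c1 c2] [c3 c4]; split=> t.
  under eq_fun do rewrite RecM.
  by apply: cvgB; apply: cvgM; [exact: c1|exact: c3|exact: c2|exact: c4].
under eq_fun do rewrite ImcM.
by apply: cvgD; apply: cvgM; [exact: c1|exact: c4|exact: c2|exact: c3].
Qed.

Lemma continuousC_horner p : continuousC (fun t => p.[expi t]).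
Proof. by split; [exact: continuous_Re_horner|exact: continuous_Im_horner]. Qed.

Lemma continuousC_expiX k : continuousC (fun t => expi t ^+ k).
Proof.
have := continuousC_horner 'X^k.
by under eq_fun do rewrite hornerXn.
Qed.

Lemma intble_ReM f g h : L1 f -> L1 g -> continuousC h ->
  intble (- pi) pi (fun t => Re (Complex (f t) (g t) * h t)).
Proof.
move=> f1 g1 [cR cI]; apply: (@eq_intble _ _ _ (fun t => f t * Re (h t) - g t * Im (h t))).
  by move=> t _; rewrite RecM.
by apply: intbleB; apply: intbleMc => //; exact: L1_intble.
Qed.

Definition fejer_poly f n : {poly R[i]} := \poly_(k < n.+1)
  if k == 0%N then Complex (fourier_cos f 0 / 2) 0
  else Complex (fejer_weight n k * fourier_cos f k) (- (fejer_weight n k * fourier_sin f k)).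

Lemma fejer_polyE f n t :
  (fejer_poly f n).[expi t] = Complex (fejer_sum f n t) (conj_fejer_sum f n t).
Proof.
rewrite horner_poly big_ord_recl /= expr0 mulr1 /fejer_sum /conj_fejer_sum.
rewrite !big_add1 /= !big_mkord.
apply/eqP; rewrite eq_complex; apply/andP; split; apply/eqP.
  rewrite RecD /= Rec_sum; congr (_ + _); apply: eq_bigr => k _.
  by rewrite expiX RecM /= /harm; ring.
rewrite ImcD /= add0r (big_morph Im ImcD (erefl _)); apply: eq_bigr => k _.
by rewrite expiX ImcM /= /conj_harm; ring.
Qed.

Lemma fejer_poly0 f n : (fejer_poly f n)`_0 = Complex (fourier_cos f 0 / 2) 0.
Proof. by rewrite coef_poly. Qed.

Lemma L1B f g : L1 f -> L1 g -> L1 (fun t => f t - g t).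
Proof.
move=> f1 g1; apply: intble_L1; first by move=> t; rewrite f1.1 g1.1.
by apply: intbleB; exact: L1_intble.
Qed.

Lemma fejer_sumB f g n x : L1 f -> L1 g ->
  fejer_sum (fun t => f t - g t) n x = fejer_sum f n x - fejer_sum g n x.
Proof.
move=> f1 g1; have f1g1 := L1B f1 g1; rewrite !fejer_sumE// -mulrBr; congr (_ * _).
rewrite -IntB.
- by apply: eq_Int => t _; ring.
- apply: intbleMc; last exact: continuous_fejer_kernel.
  by apply: intbleD; apply: L1_intble; [exact: L1_shift|exact: L1_rshift].
- apply: intbleMc; last exact: continuous_fejer_kernel.
  by apply: intbleD; apply: L1_intble; [exact: L1_shift|exact: L1_rshift].
Qed.

Lemma conj_fejer_sumB f g n x : L1 f -> L1 g ->
  conj_fejer_sum (fun t => f t - g t) n x = conj_fejer_sum f n x - conj_fejer_sum g n x.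
Proof.
move=> f1 g1; have f1g1 := L1B f1 g1; rewrite !conj_fejer_sumE// -mulrBr; congr (_ * _).
rewrite -IntB.
- by apply: eq_Int => t _; ring.
- apply: intbleMc; last exact: continuous_sin_sum.
  by apply: intbleB; apply: L1_intble; [exact: L1_shift|exact: L1_rshift].
- apply: intbleMc; last exact: continuous_sin_sum.
  by apply: intbleB; apply: L1_intble; [exact: L1_shift|exact: L1_rshift].
Qed.

Lemma L1_pos f : L1 f -> L1 (fun t => Num.max (f t) 0).
Proof.
move=> f1; apply: intble_L1; first by move=> t; rewrite f1.1.
apply: (@intble_le _ _ _ _ (fun t => `|f t|)).
- apply: measurable_maxr; last exact: measurable_cst.
  by apply: measurable_funTS; exact: L1_measurable.
- by apply: intble_norm; exact: L1_intble.
- by move=> t _; have [f0|f0] := leP (f t) 0; rewrite ?normr0.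
Qed.

Lemma fourier_cos0_ge0 f : (forall t, 0 <= f t) -> 0 <= fourier_cos f 0.
Proof.
move=> f0; rewrite /fourier_cos mulr_ge0 ?invr_ge0 ?pi_ge0//.
by apply: Rintegral_ge0 => t _; rewrite mul0r cos0 mulr1.
Qed.

(* For f >= 0 the values of the regularizer lie in the half-plane Re >= 1, where
   the inverse is bounded and approximable by polynomials. *)
Definition regularizer (eta : R) f n : {poly R[i]} :=
  1 + Complex eta 0 *: fejer_poly f n.

Lemma regularizerE (eta : R) f n t : (regularizer eta f n).[expi t] =
  1 + Complex eta 0 * (fejer_poly f n).[expi t].
Proof. by rewrite !hornerE. Qed.

Lemma regularizer_ge1 (eta : R) f n t : 0 <= eta -> L1 f -> (forall s, 0 <= f s) ->
  1 <= Re (regularizer eta f n).[expi t].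
Proof.
move=> eta0 f1 f0; rewrite regularizerE RecD RecM fejer_polyE /= mul0r subr0 lerDl.
by rewrite mulr_ge0// fejer_sum_ge0.
Qed.

Lemma regularizer0 (eta : R) f n : (regularizer eta f n)`_0 =
  Complex (1 + eta * (fourier_cos f 0 / 2)) 0.
Proof.
rewrite coefD coef1 coefZ fejer_poly0 /=.
apply/eqP; rewrite eq_complex; apply/andP; split; apply/eqP.
  by rewrite RecD RecM /= mul0r subr0.
by rewrite ImcD ImcM /= mulr0 mul0r !addr0.
Qed.

(** Dominated convergence. Truncation at a height makes up for f + i ft being integrable but
    possibly unbounded. *)
Lemma intble_tail g : L1 g -> (forall t, 0 <= g t) ->
  (forall M : R, intble (- pi) pi (fun t => Num.max (g t - M) 0)) /\
  forall e, 0 < e -> exists n : nat, Int (- pi) pi (fun t => Num.max (g t - n%:R) 0) <= e.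
Proof.
move=> g1 g0; have gm : measurable_fun `[- pi, pi]%classic g.
  by apply: measurable_funTS; exact: L1_measurable.
have mm (M : R) : measurable_fun `[- pi, pi]%classic (fun t => Num.max (g t - M) 0).
  apply: measurable_maxr; last exact: measurable_cst.
  by apply: measurable_funB => //; exact: measurable_cst.
have bnd (M : R) t : 0 <= M -> `|Num.max (g t - M) 0| <= g t.
  move=> M0; rewrite ger0_norm; last by rewrite le_max lexx orbT.
  by rewrite ge_max g0 andbT gerBl.
split=> [M|e e0].
  apply: (@intble_le _ _ _ _ (fun t => g t + `|M|)) => //.
    by apply: intbleD; [exact: L1_intble|exact: intble_cst].
  move=> t _; rewrite ger0_norm; last by rewrite le_max lexx orbT.
  by rewrite ge_max addr_ge0// andbT lerD2l -normrN ler_norm.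
have H : Int (- pi) pi (fun t => Num.max (g t - n%:R) 0) @[n --> \oo] --> (0 : R).
  apply: (@Int_dominated_cvg0 _ _ _ (fun n t => Num.max (g t - n%:R) 0) g).
  - exact: L1_intble.
  - by move=> n; exact: mm.
  - apply/aeW => t _; apply/cvg_seqP => d d0; exists (Num.bound (g t)) => n gn.
    rewrite max_r ?subrr ?normr0; first exact: ltW.
    rewrite subr_le0; apply/ltW/(lt_le_trans (archi_boundP (g0 t))).
    by rewrite ler_nat.
  - by move=> n t _; exact: bnd.
have /cvg_seqP/(_ _ e0)[N HN] := H; exists N; have := HN N (leqnn N).
by rewrite subr0; apply: le_trans; exact: ler_norm.
Qed.

Lemma normc_1sub_le2 z : cn z <= 1 -> cn (1 - z) <= 2.
Proof. by move=> z1; apply: le_trans (normcB _ _) _; rewrite normc_one; lra. Qed.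

(** P is split at height M: on the excess c <= 2 is enough, and below M the inequality c_i <= s / 2
    + c_i^2 / (2 s) replaces a square root by u and v, whose integrals are known. The free parameter
    s plays the role of an application of Cauchy-Schwarz. *)
Lemma error_bound (P M c c1 c2 u v s : R) : 0 < s -> 0 <= M -> 0 <= P ->
  0 <= c <= 2 -> c <= c1 + c2 -> c1 ^+ 2 <= 2 * u -> c2 ^+ 2 <= 2 * v ->
  P * c <= 2 * Num.max (P - M) 0 + M * (s + s^-1 * (u + v)).
Proof.
move=> s0 M0 P0 /andP[c0 c2'] cc cu cv.
have ca (y d : R) : d ^+ 2 <= 2 * y -> d <= s / 2 + s^-1 * y.
  move=> cy; rewrite -(ler_pM2l s0) mulrDr mulrA [s * (s^-1 * y)]mulrA mulfV ?gt_eqF// mul1r.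
  have := sqr_ge0 (s - d); rewrite !expr2 in cy *; lra.
have h1 := ca _ _ cu; have h2 := ca _ _ cv.
have h3 : c <= s + s^-1 * (u + v) by rewrite mulrDr; lra.
set B := s + _ in h3 *.
have MB : M * c <= M * B by exact: ler_wpM2l.
have [PM|PM] := leP (P - M) 0.
  rewrite mulr0 add0r; apply: le_trans MB; apply: ler_wpM2r => //; lra.
have : (P - M) * c <= (P - M) * 2 by apply: ler_wpM2l => //; exact: ltW.
lra.
Qed.

(** * Vanishing of the integral of (f + i ft) e^{ikt} for k > 0 *)

Section vanishing.
Variables (f ft : R -> R) (k : nat) (z : R[i]).
Hypotheses (f1 : L1 f) (ft1 : L1 ft) (fft : conjugate_of f ft).
Hypotheses (k0 : (0 < k)%N) (z1 : cn z = 1).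

Let fp t := Num.max (f t) 0.
Let fm t := Num.max (- f t) 0.

Let fp1 : L1 fp. Proof. exact: L1_pos. Qed.

Let fm1 : L1 fm.
Proof.
apply: L1_pos; apply: intble_L1; first by move=> t; rewrite f1.1.
by apply: intbleN; exact: L1_intble.
Qed.

Let fp0 t : 0 <= fp t. Proof. by rewrite le_max lexx orbT. Qed.

Let fm0 t : 0 <= fm t. Proof. by rewrite le_max lexx orbT. Qed.

Let fE : f = fun t => fp t - fm t.
Proof.
apply/funext => t; rewrite /fp /fm; have [h|h] := leP (f t) 0.
  by rewrite max_l ?oppr_ge0// sub0r opprK.
by rewrite max_r ?subr0// oppr_le0 ltW.
Qed.

Let F t : R[i] := Complex (f t) (ft t).
Let Fn n t : R[i] := (fejer_poly f n).[expi t].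
Let Wp eta n := regularizer eta fp n.
Let Wm eta n := regularizer eta fm n.
Let G eta n t : R[i] := (Wp eta n).[expi t]^-1 * (Wm eta n).[expi t]^-1.

Let FnE n t : Fn n t = (fejer_poly fp n).[expi t] - (fejer_poly fm n).[expi t].
Proof.
have E1 : fejer_sum f n t = fejer_sum fp n t - fejer_sum fm n t.
  by rewrite {1}fE fejer_sumB.
have E2 : conj_fejer_sum f n t = conj_fejer_sum fp n t - conj_fejer_sum fm n t.
  by rewrite {1}fE conj_fejer_sumB.
rewrite /Fn !fejer_polyE; apply/eqP; rewrite eq_complex RecD ImcD RecN ImcN /=.
by rewrite E1 E2 !eqxx.
Qed.

Let Phi t := `|f t| + `|ft t|.

Let Phi1 : L1 Phi.
Proof.
apply: intble_L1; first by move=> t; rewrite /Phi f1.1 ft1.1.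
by apply: intbleD; apply: intble_norm; exact: L1_intble.
Qed.

Let Phi0 t : 0 <= Phi t. Proof. by rewrite addr_ge0. Qed.

Let cnF t : cn (F t) <= Phi t. Proof. exact: normc_le. Qed.

Let cn_unit t : cn (z * expi t ^+ k) = 1.
Proof. by rewrite normcM normcX normc_expi expr1n mulr1. Qed.

Section fixed_eta.
Variables (eta : R).
Hypothesis eta0 : 0 < eta.

Let Wp1 n t : 1 <= Re (Wp eta n).[expi t].
Proof. by apply: regularizer_ge1 => //; exact: ltW. Qed.

Let Wm1 n t : 1 <= Re (Wm eta n).[expi t].
Proof. by apply: regularizer_ge1 => //; exact: ltW. Qed.

Let Wpn0 n t : (Wp eta n).[expi t] != 0.
Proof. by apply/eqP => w0; have := Wp1 n t; rewrite w0 /= ler10. Qed.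

Let Wmn0 n t : (Wm eta n).[expi t] != 0.
Proof. by apply/eqP => w0; have := Wm1 n t; rewrite w0 /= ler10. Qed.

Let cG n : continuousC (G eta n).
Proof.
by apply: continuousCM; exact: continuous_Re_inv.
Qed.

Let cH n : continuousC (fun t => z * expi t ^+ k * G eta n t).
Proof.
apply: continuousCM => //; apply: continuousCM; first exact: continuousC_cst.
exact: continuousC_expiX.
Qed.

Let cnG n t : cn (G eta n t) <= 1.
Proof.
rewrite /G normcM -[leRHS]mulr1; apply: ler_pM; rewrite ?normc_ge0//.
  exact: (normc_inv_le1 (Wp1 n)).
exact: (normc_inv_le1 (Wm1 n)).
Qed.

(** With W = 1 + eta P one has P / W = (1 - 1 / W) / eta, and |1 / W| <= 1. *)
Let eta_quotient g n t : L1 g -> (forall s, 0 <= g s) ->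
  cn ((fejer_poly g n).[expi t] * (regularizer eta g n).[expi t]^-1) <= 2 / eta.
Proof.
move=> g1 g0; have w1 s : 1 <= Re (regularizer eta g n).[expi s].
  by apply: regularizer_ge1 => //; exact: ltW.
have wn0 : (regularizer eta g n).[expi t] != 0.
  by apply/eqP => w0; have := w1 t; rewrite w0 /= ler10.
set P := (fejer_poly g n).[_]; set W := _.[expi t] in wn0 *.
have en0 : Complex eta 0 != 0 by rewrite eq_complex /= eqxx andbT gt_eqF.
have PE : P / W = (Complex eta 0)^-1 * (1 - W^-1).
  have -> : P = (Complex eta 0)^-1 * (W - 1).
    by rewrite /W regularizerE -/P addrC addKr mulKf.
  by rewrite -mulrA mulrBl mulfV// mul1r.
rewrite PE normcM normc_inv mulrC.
have -> : cn (Complex eta 0) = eta.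
  by rewrite /= expr0n/= addr0 sqrtr_sqr gtr0_norm.
apply: ler_wpM2r; first by rewrite invr_ge0 ltW.
apply: le_trans (normcB _ _) _; rewrite normc_one.
by have := normc_inv_le1 w1 t; rewrite -/W; lra.
Qed.

Let cnFnG n t : cn (Fn n t * G eta n t) <= 4 / eta.
Proof.
rewrite FnE /G mulrBl.
set P := _.[expi t]; set Q := (fejer_poly fm n).[expi t]; set a := _^-1; set b := _^-1.
have -> : P * (a * b) - Q * (a * b) = P * a * b - Q * b * a by ring.
apply: le_trans (normcB _ _) _; rewrite (normcM (P * a) b) (normcM (Q * b) a).
have h1 : cn (P * a) <= 2 / eta by exact: eta_quotient.
have h2 : cn (Q * b) <= 2 / eta by exact: eta_quotient.
have ha : cn a <= 1 by exact: (normc_inv_le1 (Wp1 n)).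
have hb : cn b <= 1 by exact: (normc_inv_le1 (Wm1 n)).
have -> : 4 / eta = 2 / eta * 1 + 2 / eta * 1 by ring.
by apply: lerD; apply: ler_pM; rewrite ?normc_ge0.
Qed.

Let dominated_part : Int (- pi) pi (fun t =>
  Re ((F t - Fn n t) * (z * expi t ^+ k * G eta n t))) @[n --> \oo] --> (0 : R).
Proof.
apply: (@Int_dominated_cvg0 _ _ _ (fun n t =>
  Re ((F t - Fn n t) * (z * expi t ^+ k * G eta n t))) (fun t => Phi t + 4 / eta)).
- by apply: intbleD; [exact: L1_intble|exact: intble_cst].
- move=> n; apply: (@intble_measurable _ (- pi) pi).
  apply: (@eq_intble _ _ _ (fun t => Re (F t * (z * expi t ^+ k * G eta n t)) -
    Re (Fn n t * (z * expi t ^+ k * G eta n t)))).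
    by move=> t _; rewrite -RecN -RecD -mulrBl.
  apply: intbleB; first exact: intble_ReM.
  apply: intble_continuous; apply: (proj1 (continuousCM _ (cH n))).
  exact: continuousC_horner.
- have := ae_avg f1; apply: filterS2 fft => t pv [rf lf] _.
  have h1 := fejer_sum_cvg f1 rf lf.
  have h2 := conj_fejer_sum_cvg f1 rf lf pv.
  move: h1; rewrite (_ : (f t + f t) / 2 = f t); last by field.
  move=> /cvg_seqP h1; move/cvg_seqP : h2 => h2.
  apply/cvg_seqP => e e0; have e2 : 0 < e / 2 by rewrite divr_gt0.
  have [N1 H1] := h1 _ e2; have [N2 H2] := h2 _ e2.
  exists (N1 + N2)%N => n nN; rewrite subr0.
  apply: le_trans (norm_Re_le _) _; rewrite normcM [cn (z * _ * _)]normcM cn_unit mul1r.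
  rewrite -[leRHS]mulr1; apply: ler_pM; rewrite ?normc_ge0 ?cnG//.
  apply: le_trans (normc_le _) _; rewrite RecD ImcD RecN ImcN /Fn fejer_polyE /=.
  rewrite [e]splitr; apply: lerD; rewrite distrC.
    by apply: H1; rewrite (leq_trans _ nN)// leq_addr.
  by apply: H2; rewrite (leq_trans _ nN)// leq_addl.
- move=> n t _; apply: le_trans (norm_Re_le _) _.
  have -> : (F t - Fn n t) * (z * expi t ^+ k * G eta n t) =
     (F t * G eta n t - Fn n t * G eta n t) * (z * expi t ^+ k) by ring.
  rewrite normcM cn_unit mulr1; apply: le_trans (normcB _ _) _; apply: lerD => //.
  rewrite normcM -[leRHS]mulr1; apply: ler_pM; rewrite ?normc_ge0//.
Qed.

Let analytic_part n :
  Int (- pi) pi (fun t => Re (Fn n t * (z * expi t ^+ k * G eta n t))) = 0.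
Proof.
rewrite -[RHS](@Int_analytic_quotient _ (z *: fejer_poly f n) (Wp eta n) (Wm eta n) k)//.
by apply: eq_Int => t _; congr Re; rewrite hornerZ /Fn /G; ring.
Qed.

(** The mean of |f| over a period. *)
Let m_ := fourier_cos fp 0 / 2 + fourier_cos fm 0 / 2.

Let error_part (s M : R) n : 0 < s -> 0 <= M ->
  `|Int (- pi) pi (fun t => Re (F t * (z * expi t ^+ k)) -
      Re (F t * (z * expi t ^+ k * G eta n t)))| <=
  2 * Int (- pi) pi (fun t => Num.max (Phi t - M) 0) +
  M * (2 * pi * s + 2 * pi * (eta * m_) / s).
Proof.
move=> s0 M0.
have [It _] := intble_tail Phi1 Phi0.
have cGp := (continuous_Re_inv (Wpn0 n)).1; have cGm := (continuous_Re_inv (Wmn0 n)).1.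
pose u t := 1 - Re (Wp eta n).[expi t]^-1; pose v t := 1 - Re (Wm eta n).[expi t]^-1.
have Iu : intble (- pi) pi u by apply: intbleB; [exact: intble_cst|exact: intble_continuous].
have Iv : intble (- pi) pi v by apply: intbleB; [exact: intble_cst|exact: intble_continuous].
have Hu : Int (- pi) pi u <= 2 * pi * (eta * (fourier_cos fp 0 / 2)).
  apply: Int_1sub_inv => //; last exact: regularizer0.
  by rewrite mulr_ge0 ?divr_ge0 ?fourier_cos0_ge0// ltW.
have Hv : Int (- pi) pi v <= 2 * pi * (eta * (fourier_cos fm 0 / 2)).
  apply: Int_1sub_inv => //; last exact: regularizer0.
  by rewrite mulr_ge0 ?divr_ge0 ?fourier_cos0_ge0// ltW.
pose b t := 2 * Num.max (Phi t - M) 0 + M * (s + s^-1 * (u t + v t)).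
have Iuv : intble (- pi) pi (fun t => s + s^-1 * (u t + v t)).
  by apply: intbleD; [exact: intble_cst|apply: intbleZ; exact: intbleD].
have Ib : Int (- pi) pi b <= 2 * Int (- pi) pi (fun t => Num.max (Phi t - M) 0) +
    M * (2 * pi * s + 2 * pi * (eta * m_) / s).
  rewrite IntD; [|exact: intbleZ|exact: intbleZ].
  rewrite !IntZ// lerD2l ler_wpM2l// IntD; [|exact: intble_cst|apply: intbleZ; exact: intbleD].
  rewrite Int_cst// IntZ; last exact: intbleD.
  rewrite IntD// mulrC (_ : (pi - - pi) = 2 * pi); last by ring.
  rewrite lerD2l mulrC ler_wpM2r ?invr_ge0 ?(ltW s0)// /m_.
  by apply: le_trans (lerD Hu Hv) _; rewrite -!mulrDr.
apply: le_trans Ib; apply: le_norm_Int2.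
- apply: intbleB; last exact: intble_ReM.
  apply: intble_ReM => //; apply: continuousCM; first exact: continuousC_cst.
  exact: continuousC_expiX.
- by apply: intbleD; exact: intbleZ.
move=> t _; rewrite -RecN -RecD.
have -> : F t * (z * expi t ^+ k) - F t * (z * expi t ^+ k * G eta n t) =
  F t * (1 - G eta n t) * (z * expi t ^+ k) by ring.
apply: le_trans (norm_Re_le _) _; rewrite normcM cn_unit mulr1 normcM.
set a := 1 - (Wp eta n).[expi t]^-1; set a' := 1 - (Wm eta n).[expi t]^-1.
apply: le_trans (ler_wpM2r (normc_ge0 _) (cnF t)) _.
apply: (@error_bound _ _ _ (cn a) (cn a')) => //.
- by rewrite normc_ge0 normc_1sub_le2.
- have -> : 1 - G eta n t = a + (Wp eta n).[expi t]^-1 * a' by rewrite /a /a' /G; ring.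
  apply: le_trans (normcD _ _) _; rewrite lerD2l normcM -[leRHS]mul1r.
  by apply: ler_wpM2r; [exact: normc_ge0|exact: (normc_inv_le1 (Wp1 n))].
- exact: (normc_1sub_inv (Wp1 n)).
- exact: (normc_1sub_inv (Wm1 n)).
Qed.

(** The bound of [error_part] does not involve n, so n may be taken large enough to make the
    dominated part negligible while eta, s and M stay fixed. *)
Lemma vanishing_bound (s M : R) : 0 < s -> 0 <= M ->
  `|Int (- pi) pi (fun t => Re (F t * (z * expi t ^+ k)))| <=
  2 * Int (- pi) pi (fun t => Num.max (Phi t - M) 0) +
  M * (2 * pi * s + 2 * pi * (eta * m_) / s).
Proof.
move=> s0 M0; apply/ler_addgt0Pl => e e0.
have /cvg_seqP/(_ _ e0)[n /(_ _ (leqnn n))] := dominated_part.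
rewrite subr0 => Hn; have He := error_part n s0 M0.
have I1 : intble (- pi) pi (fun t => Re (F t * (z * expi t ^+ k * G eta n t))).
  exact: intble_ReM.
have I2 : intble (- pi) pi (fun t => Re (Fn n t * (z * expi t ^+ k * G eta n t))).
  apply: intble_continuous; apply: (proj1 (continuousCM _ (cH n))).
  exact: continuousC_horner.
have I3 : intble (- pi) pi (fun t => Re (F t * (z * expi t ^+ k))).
  apply: intble_ReM => //; apply: continuousCM; first exact: continuousC_cst.
  exact: continuousC_expiX.
move: Hn; rewrite (@eq_Int _ _ _ _ (fun t => Re (F t * (z * expi t ^+ k * G eta n t)) -
    Re (Fn n t * (z * expi t ^+ k * G eta n t)))); last first.
  by move=> t _; rewrite mulrBl RecD RecN.
rewrite IntB// analytic_part subr0 => Hn.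
move: He; rewrite IntB//; set x := Int _ _ _ in Hn *; set y := Int _ _ _ => He.
rewrite -[y](subrK x) addrC; apply: le_trans (ler_normD _ _) _.
exact: lerD.
Qed.

End fixed_eta.

(** The unimodular z selects a component with real integrals only: z = 1 and z = - i yield the two
    relations between the coefficients of f and ft. *)
Lemma analytic_vanishing : Int (- pi) pi (fun t => Re (F t * (z * expi t ^+ k))) = 0.
Proof.
have p0 := @pi_gt0 R.
apply: (@small_eq0 _ _ (2 + 4 * pi)); first by rewrite addr_ge0// mulr_ge0// ltW.
move=> e e0 e1; have [_ Ht] := intble_tail Phi1 Phi0; have [N HN] := Ht _ e0.
set m := fourier_cos fp 0 / 2 + fourier_cos fm 0 / 2.
have m0 : 0 <= m by rewrite addr_ge0// divr_ge0// fourier_cos0_ge0.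
have N0 : 0 < N.+1%:R :> R by [].
(* The order of choice matters: the height N comes from the tail of [Phi], then s makes N s <= e,
   then eta makes N eta m / s <= e. *)
pose s := e / N.+1%:R; have s0 : 0 < s by rewrite divr_gt0.
pose eta := e * s / (N.+1%:R * (m + 1)).
have m1 : 0 < m + 1 by lra.
have eta0 : 0 < eta by rewrite divr_gt0 ?mulr_gt0.
apply: le_trans (vanishing_bound eta0 s0 (ler0n R N)) _; rewrite -/m.
have h1 : N%:R * s <= e.
  by rewrite /s mulrCA ger_pMr// ler_pdivrMr// mul1r ler_nat.
have h2 : N%:R * (eta * m / s) <= e.
  rewrite (_ : N%:R * _ = e * (N%:R / N.+1%:R * (m / (m + 1)))); last first.
    by rewrite /eta; field; rewrite ?gt_eqF//= ?addrC ?natr1 ?pnatr_eq0//.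
  rewrite ger_pMr// mulr_ile1 ?divr_ge0//; [exact: ltW|..].
    by rewrite ler_pdivrMr// mul1r ler_nat.
  by rewrite ler_pdivrMr// mul1r lerDl.
rewrite (_ : N%:R * _ = 2 * pi * (N%:R * s) + 2 * pi * (N%:R * (eta * m / s))); last by ring.
move: (Int _ _ _) HN => I HN.
have h3 : 2 * pi * (N%:R * s) <= 2 * pi * e by rewrite ler_pM2l// mulr_gt0.
have h4 : 2 * pi * (N%:R * (eta * m / s)) <= 2 * pi * e by rewrite ler_pM2l// mulr_gt0.
lra.
Qed.

End vanishing.

Lemma conjugate_fourier f ft k : L1 f -> L1 ft -> conjugate_of f ft -> (0 < k)%N ->
  fourier_cos ft k = - fourier_sin f k /\ fourier_sin ft k = fourier_cos f k.
Proof.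
move=> f1 ft1 fft k0; rewrite /fourier_cos /fourier_sin -!/(Int _ _ _).
have Ic g : L1 g -> intble (- pi) pi (fun t => g t * cos (k%:R * t)).
  by move=> g1; apply: intbleMc; [exact: L1_intble|exact: continuous_cosM].
have Is g : L1 g -> intble (- pi) pi (fun t => g t * sin (k%:R * t)).
  by move=> g1; apply: intbleMc; [exact: L1_intble|exact: continuous_sinM].
have H1 : Int (- pi) pi (fun t => f t * cos (k%:R * t)) -
    Int (- pi) pi (fun t => ft t * sin (k%:R * t)) = 0.
  rewrite -IntB; [|exact: Ic|exact: Is].
  rewrite -(@analytic_vanishing f ft k 1)//; last exact: normc_one.
  by apply: eq_Int => t _; rewrite mul1r expiX RecM.
have H2 : Int (- pi) pi (fun t => f t * sin (k%:R * t)) +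
    Int (- pi) pi (fun t => ft t * cos (k%:R * t)) = 0.
  rewrite -IntD; [|exact: Is|exact: Ic].
  rewrite -(@analytic_vanishing f ft k (- Complex 0 1))//; last first.
    by rewrite normcN1 /= expr0n/= expr1n add0r sqrtr1.
  apply: eq_Int => t _; rewrite expiX !(RecM, ImcM, RecN, ImcN) /=; ring.
split.
  by rewrite -mulrN; congr (_ * _); apply/eqP; rewrite -addr_eq0 addrC H2.
by congr (_ * _); apply/eqP; rewrite eq_sym -subr_eq0 H1.
Qed.

End conjugate_function.

(** * Amplitudes and strong convergence *)

Section strong_means.
Context {R : realType}.
Implicit Types (f g h : R -> R) (t e x lam : R) (k n N : nat).
Local Notation mu := (@lebesgue_measure R).

Let pp : - pi <= pi :> R. Proof. by rewrite ge0_cp// pi_ge0. Qed.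

Lemma cvg_uniform_onP (A : set R) (s : nat -> R -> R) g :
  {uniform A, s @ \oo --> g} <->
  forall e, 0 < e -> exists N, forall n, (N <= n)%N -> forall x, A x -> `|s n x - g x| <= e.
Proof.
split=> [H e e0|H P /uniform_nbhs[E [entE EP]]].
  pose P : set (R -> R) := [set h | forall x, A x -> `|h x - g x| <= e].
  have : nbhs (g : {uniform` A -> R}) P.
    apply/uniform_nbhs; exists [set xy | ball xy.1 e xy.2]; split.
      exact: (entourage_ball _ (PosNum e0)).
    by move=> h hE x Ax; rewrite distrC ltW//; exact: hE.
  by move=> /H[N _ HN]; exists N => n Nn; exact: HN.
move: entE; rewrite -entourage_ballE => -[e /= e0 eE].
have e2 : 0 < e / 2 by rewrite divr_gt0.
have [N HN] := H _ e2; exists N => // n Nn; apply: EP => x Ax; apply: eE => /=.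
rewrite /ball/= distrC; apply: le_lt_trans (HN n Nn x Ax) _.
by rewrite ltr_pdivrMr// ltr_pMr// ltr1n.
Qed.

Lemma cvg_uniformP (s : nat -> R -> R) g : {uniform, s @ \oo --> g} <->
  forall e, 0 < e -> exists N, forall n, (N <= n)%N -> forall x, `|s n x - g x| <= e.
Proof.
split=> [/cvg_uniform_onP H e /H[N HN]|H].
  by exists N => n Nn x; exact: HN.
by apply/cvg_uniform_onP => e /H[N HN]; exists N => n Nn x _; exact: HN.
Qed.

Definition amplitude f k := Num.sqrt (fourier_cos f k ^+ 2 + fourier_sin f k ^+ 2).

Lemma amplitude_ge0 f k : 0 <= amplitude f k.
Proof. exact: sqrtr_ge0. Qed.

Lemma amplitude_sqr f k :
  amplitude f k ^+ 2 = fourier_cos f k ^+ 2 + fourier_sin f k ^+ 2.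
Proof. by rewrite sqr_sqrtr// addr_ge0// sqr_ge0. Qed.

Lemma harm_conj_harm f k x : harm f k x ^+ 2 + conj_harm f k x ^+ 2 = amplitude f k ^+ 2.
Proof.
rewrite amplitude_sqr /harm /conj_harm.
transitivity ((fourier_cos f k ^+ 2 + fourier_sin f k ^+ 2) *
  (cos (k%:R * x) ^+ 2 + sin (k%:R * x) ^+ 2)); first by ring.
by rewrite cos2Dsin2 mulr1.
Qed.

Lemma norm_harm_le f k x : `|harm f k x| <= amplitude f k.
Proof.
rewrite -(ler_pXn2r (n := 2)) ?nnegrE ?amplitude_ge0// real_normK ?num_real//.
by rewrite -(harm_conj_harm f k x) lerDl sqr_ge0.
Qed.

Lemma norm_conj_harm_le f k x : `|conj_harm f k x| <= amplitude f k.
Proof.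
rewrite -(ler_pXn2r (n := 2)) ?nnegrE ?amplitude_ge0// real_normK ?num_real//.
by rewrite -(harm_conj_harm f k x) lerDr sqr_ge0.
Qed.

Lemma continuous_harm f k : continuous (harm f k).
Proof.
move=> t; apply: cvgD; apply: cvgM; try exact: cvg_cst.
  exact: continuous_cosM.
exact: continuous_sinM.
Qed.

Lemma continuous_harm_sqr f k : continuous (fun t => harm f k t ^+ 2).
Proof. 
move=> t; under [X in continuous_at _ X]eq_fun do rewrite expr2.
by apply: cvgM; exact: continuous_harm. Qed.

Lemma Int_harm_sqr f k : (0 < k)%N ->
  Int (- pi) pi (fun t => harm f k t ^+ 2) = pi * amplitude f k ^+ 2.
Proof.
move=> k0; rewrite amplitude_sqr /harm; set a := fourier_cos f k; set b := fourier_sin f k.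
have E t : (a * cos (k%:R * t) + b * sin (k%:R * t)) ^+ 2 =
  (a ^+ 2 + b ^+ 2) / 2 + ((a ^+ 2 - b ^+ 2) / 2 * cos (k.*2%:R * t) +
    a * b * sin (k.*2%:R * t)).
  have -> : k.*2%:R * t = k%:R * t + k%:R * t by rewrite -addnn natrD mulrDl.
  rewrite cosD sinD; set c := cos _; set d := sin _.
  apply/eqP; rewrite -subr_eq0; apply/eqP.
  transitivity ((a ^+ 2 + b ^+ 2) / 2 * (c ^+ 2 + d ^+ 2 - 1)); first by field.
  by rewrite cos2Dsin2 subrr mulr0.
under [X in Int _ _ X]eq_fun do rewrite E.
have Ic : intble (- pi) pi (fun t => (a ^+ 2 - b ^+ 2) / 2 * cos (k.*2%:R * t)).
  exact/intbleZ/intble_continuous/continuous_cosM.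
have Is : intble (- pi) pi (fun t => a * b * sin (k.*2%:R * t)).
  exact/intbleZ/intble_continuous/continuous_sinM.
rewrite IntD; [|exact: intble_cst|exact: intbleD].
rewrite Int_cst// IntD//.
rewrite IntZ; last exact/intble_continuous/continuous_cosM.
rewrite IntZ; last exact/intble_continuous/continuous_sinM.
by rewrite Int_cosM_sym ?double_gt0// Int_sinM_sym; field.
Qed.

Definition amplitude_mean lam f n :=
  (\sum_(1 <= k < n.+1) k%:R `^ lam * amplitude f k `^ lam) / n%:R.

Lemma fourier_sum_diff f k x : (0 < k)%N ->
  fourier_sum f k x - fourier_sum f k.-1 x = harm f k x.
Proof.
case: k => // k _; rewrite /fourier_sum/= (@big_nat_recr _ _ _ k.+1 1)//= /harm.
ring.
Qed.

Lemma strong_meanE lam f n x : strong_mean lam (fourier_sum f ^~ x) n =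
  (\sum_(1 <= k < n.+1) k%:R `^ lam * `|harm f k x| `^ lam) / n%:R.
Proof.
rewrite /strong_mean; congr (_ / _); apply: eq_big_nat => k /andP[k0 _].
by rewrite fourier_sum_diff.
Qed.

Lemma amplitude_mean_ge0 lam f n : 0 <= amplitude_mean lam f n.
Proof.
by rewrite /amplitude_mean divr_ge0// sumr_ge0// => k _; rewrite mulr_ge0// powR_ge0.
Qed.

Lemma strong_mean_le lam f n x : 0 <= lam ->
  `|strong_mean lam (fourier_sum f ^~ x) n| <= amplitude_mean lam f n.
Proof.
move=> lam0; rewrite strong_meanE ger0_norm; last first.
  by rewrite divr_ge0// sumr_ge0// => k _; rewrite mulr_ge0// powR_ge0.
apply: ler_wpM2r; first by rewrite invr_ge0.
apply: ler_sum => k _; apply: ler_wpM2l; first exact: powR_ge0.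
by apply: ge0_ler_powR; rewrite ?nnegrE ?amplitude_ge0// norm_harm_le.
Qed.

(* Tangent bound: it trades the power lam of a cosine for its square, whose
   mean over a period is explicit. *)
Lemma powR_ge_sqr (c lam : R) : 0 <= lam -> 0 <= c <= 1 ->
  2^-1 `^ lam * (4 / 3 * (c ^+ 2 - 4^-1)) <= c `^ lam.
Proof.
move=> lam0 /andP[c0 c1]; have V0 := powR_ge0 (2^-1 : R) lam.
have c2 : c ^+ 2 <= 1 by rewrite expr_le1.
have [c12|c12] := leP 2^-1 c.
  apply: (@le_trans _ _ (2^-1 `^ lam)).
    by rewrite ler_piMr//; lra.
  by apply: ge0_ler_powR; rewrite ?nnegrE// invr_ge0.
apply: (@le_trans _ _ 0); last exact: powR_ge0.
rewrite mulr_ge0_le0//.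
have : c ^+ 2 <= 2^-1 ^+ 2 by rewrite lerXn2r ?nnegrE ?invr_ge0// ltW.
by rewrite exprVn -natrX; lra.
Qed.

Lemma measurable_strong_mean lam f n (A : set R) : measurable A ->
  measurable_fun A (fun x => strong_mean lam (fourier_sum f ^~ x) n).
Proof.
move=> mA; under eq_fun do rewrite strong_meanE.
apply: measurable_funM; last exact: measurable_cst.
apply: measurable_sum => k; apply: measurable_funM; first exact: measurable_cst.
apply: (measurableT_comp (measurable_powR _)); apply: measurableT_comp => //.
by apply: measurable_funTS; apply: continuous_measurable_fun; exact: continuous_harm.
Qed.

Lemma Int_indic_le a b (B : set R) (r : R) : measurable B -> (mu B < r%:E)%E ->
  intble a b \1_B /\ Int a b \1_B <= r.
Proof.
move=> mB Br.
have mBle : (mu (B `&` `[a, b]) <= mu B)%E.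
  by apply: le_measure; rewrite ?inE//; exact: measurableI.
have I : (\int[mu]_(x in `[a, b]) (\1_B x)%:E)%E = mu (B `&` `[a, b]).
  by rewrite integral_indic.
split.
  apply/integrableP; split; first exact/measurable_EFinP/measurable_indic.
  under eq_integral do rewrite /= ger0_norm ?indicE//.
  rewrite -/(indic B).
  under eq_integral do rewrite -indicE.
  by rewrite I (le_lt_trans mBle)// (lt_trans Br) ?ltry.
rewrite /Int /Rintegral I -lee_fin fineK.
  by rewrite (le_trans mBle)// ltW.
rewrite ge0_fin_numE//; exact: le_lt_trans mBle (lt_trans Br (ltry _)).
Qed.

Lemma Int_harm_sqr_ratio f k : (0 < k)%N -> amplitude f k != 0 ->
  Int (- pi) pi (fun t => harm f k t ^+ 2 / amplitude f k ^+ 2 - 4^-1) = pi / 2.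
Proof.
move=> k0 a0.
have ch : continuous (fun t => harm f k t ^+ 2).
  exact: continuous_harm_sqr.
under [X in Int _ _ X]eq_fun do rewrite mulrC.
rewrite IntB; [|exact/intbleZ/intble_continuous|exact: intble_cst].
rewrite IntZ; last exact: intble_continuous.
by rewrite Int_cst// Int_harm_sqr//; field.
Qed.

(** The first term of the minimum serves off the exceptional set of Egorov's theorem, the second one
    on it. *)
Lemma powR_harm_ge lam f k x : 1 <= lam ->
  amplitude f k `^ lam *
    (2^-1 `^ lam * (4 / 3 * (harm f k x ^+ 2 / amplitude f k ^+ 2 - 4^-1))) <=
  Num.min (`|harm f k x| `^ lam) (2^-1 `^ lam * amplitude f k `^ lam).
Proof.
move=> lam1; set V := (2^-1 : R) `^ lam; have lam0 : 0 < lam by exact: lt_le_trans lam1.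
have V0 : 0 <= V by exact: powR_ge0.
have [->|a0] := eqVneq (amplitude f k) 0.
  by rewrite powR0 ?gt_eqF// mul0r mulr0 le_min powR_ge0 lexx.
have A0 : 0 < amplitude f k by rewrite lt_def a0 amplitude_ge0.
pose c := `|harm f k x| / amplitude f k.
have c01 : 0 <= c <= 1.
  by rewrite divr_ge0 ?amplitude_ge0//= ler_pdivrMr// mul1r norm_harm_le.
have -> : harm f k x ^+ 2 / amplitude f k ^+ 2 = c ^+ 2.
  by rewrite /c expr_div_n real_normK ?num_real.
have -> : `|harm f k x| `^ lam = amplitude f k `^ lam * c `^ lam.
  have [c0 _] := andP c01.
  by rewrite -powRM ?amplitude_ge0// /c mulrC divfK.
rewrite le_min; apply/andP; split.
  by apply: ler_wpM2l; [exact: powR_ge0|apply: powR_ge_sqr => //; exact: ltW].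
rewrite mulrC; apply: ler_wpM2r; first exact: powR_ge0.
rewrite ler_piMr//; have [c0 c1] := andP c01.
have : c ^+ 2 <= 1 by rewrite expr_le1.
by move: (c ^+ 2) => y; lra.
Qed.

(** Used with p = pi and T the amplitude mean. If T > e, then I >= 4 V T / 3, whereas the upper
    bound is below V T / 2 + V T / 2. *)
Lemma amplitude_mean_arith (p V T e I J : R) : 2 <= p -> p < 4 -> 0 < V -> 0 < e ->
  0 <= T -> J <= 2^-1 ->
  I = T * (V * (2 * p / 3)) -> I <= V * e / 16 * (p - - p) + V * T * J -> T <= e.
Proof.
move=> p2 p4 V0 e0 T0 J2 -> H; rewrite leNgt; apply/negP => eT.
have VT : 0 < V * T by rewrite mulr_gt0// (lt_trans e0).
have VeT : V * e < V * T by rewrite ltr_pM2l.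
have Ve : 0 < V * e by rewrite mulr_gt0.
have : V * T * J <= V * T * 2^-1 by rewrite ler_pM2l.
have : V * T * 2 <= V * T * p by rewrite ler_pM2l.
have : V * e * p <= V * e * 4 by rewrite ler_pM2l// ltW.
move: H; rewrite !mulrA.
have -> : T * V * 2 * p / 3 = V * T * p * (2 / 3) by field.
have -> : V * e / 16 * (p - - p) = V * e * p / 8 by field.
by move: VeT Ve; move: (V * T * p) (V * e * p) (V * T * J) (V * T) (V * e); intros; lra.
Qed.

(** A quantitative Cantor-Lebesgue argument. The minorant [S] of the strong mean integrates over a
    period to a fixed multiple of the amplitude mean T. Off a set B of measure less than 1 / 2 the
    strong mean is uniformly small, and on B the minorant is at most V T, which is too little to
    account for that integral unless T is small. *)
Lemma amplitude_mean_cvg0 lam f : 1 <= lam ->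
  (\forall x \ae mu, strong_mean lam (fourier_sum f ^~ x) @ \oo --> (0 : R)) ->
  forall e, 0 < e -> exists N, forall n, (N <= n)%N -> amplitude_mean lam f n <= e.
Proof.
move=> lam1 sm e e0; have lam0 : 0 <= lam by exact: le_trans lam1.
pose V := (2^-1 : R) `^ lam; have V0 : 0 < V by rewrite powR_gt0 ?invr_gt0.
have half : (0 : R) < 2^-1 by rewrite invr_gt0.
have fin : Order.lt (mu `[- pi, pi]) +oo%E.
  by rewrite /= lebesgue_measure_itv/= lte_fin; case: ifP => _; rewrite -?EFinB ltry.
have smA : {ae mu, forall x, `[- pi, pi]%classic x ->
    strong_mean lam (fourier_sum f ^~ x) @ \oo --> (0 : R)}.
  by apply: filterS sm => x.
have [B [mB Bsmall /cvg_uniform_onP unif]] := @ae_pointwise_almost_uniform _ R _ mu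
  (fun n x => strong_mean lam (fourier_sum f ^~ x) n) (cst 0) `[- pi, pi]%classic 2^-1
  (fun n => measurable_strong_mean lam f n (measurable_segment _ _)) (measurable_cst _)
  (measurable_segment _ _) fin
  smA half.
have e1 : 0 < V * e / 16 by rewrite !mulr_gt0// ?invr_gt0.
have [N HN] := unif _ e1; exists N => n Nn; have {HN unif} Sn := HN n Nn.
have [IB IB2] := Int_indic_le (- pi) pi mB Bsmall.
pose S x := (\sum_(1 <= k < n.+1) k%:R `^ lam * amplitude f k `^ lam *
  (V * (4 / 3 * (harm f k x ^+ 2 / amplitude f k ^+ 2 - 4^-1)))) / n%:R.
have cs k : continuous (fun x => V * (4 / 3 * (harm f k x ^+ 2 / amplitude f k ^+ 2 - 4^-1))).
  move=> x; do 2 (apply: cvgM; first exact: cvg_cst).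
  apply: cvgB; last exact: cvg_cst.
  by apply: cvgM; [apply: continuous_harm_sqr|exact: cvg_cst].
have IS : Int (- pi) pi S = amplitude_mean lam f n * (V * (2 * pi / 3)).
  rewrite /S; under [X in Int _ _ X]eq_fun do rewrite mulrC.
  rewrite IntZ; last by apply: intble_sum => k _; apply/intbleZ/intble_continuous.
  rewrite Int_sum//; last by move=> k _; apply/intbleZ/intble_continuous.
  rewrite /amplitude_mean [RHS]mulrAC [RHS]mulrC; congr (_ * _).
  rewrite mulr_suml; apply: eq_big_nat => k /andP[k0 _].
  rewrite IntZ; last exact: intble_continuous.
  have [->|a0] := eqVneq (amplitude f k) 0.
    by rewrite powR0 ?gt_eqF ?(lt_le_trans ltr01)// mulr0 !mul0r.
  have I : intble (- pi) pi (fun x => harm f k x ^+ 2 / amplitude f k ^+ 2 - 4^-1).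
    apply: intble_continuous => x; apply: cvgB; last exact: cvg_cst.
    by apply: cvgM; [exact: continuous_harm_sqr|exact: cvg_cst].
  rewrite IntZ; last exact: intbleZ.
  by rewrite IntZ// Int_harm_sqr_ratio//; congr (_ * (_ * _)); field.
have pS x : - pi <= x <= pi -> S x <= V * e / 16 + V * amplitude_mean lam f n * \1_B x.
  move=> xp; rewrite indicE; have [xB|xB] := boolP (x \in B).
    rewrite mulr1; apply: ler_wpDl; first exact: ltW.
    rewrite /S /amplitude_mean mulrA; apply: ler_wpM2r; first by rewrite invr_ge0.
    rewrite mulr_sumr; apply: ler_sum => k _; rewrite -mulrA [leRHS]mulrCA.
    apply: ler_wpM2l; first exact: powR_ge0.
    by have := powR_harm_ge f k x lam1; rewrite le_min => /andP[].
  rewrite mulr0 addr0; have := Sn x; rewrite subr0 => H.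
  apply: le_trans (le_trans (ler_norm _) (H _)).
    rewrite strong_meanE; apply: ler_wpM2r; first by rewrite invr_ge0.
    apply: ler_sum => k _; rewrite -mulrA; apply: ler_wpM2l; first exact: powR_ge0.
    by have := powR_harm_ge f k x lam1; rewrite le_min => /andP[].
  by split; [rewrite /= in_itv|move=> Bx; move: xB; rewrite mem_set].
apply: (@amplitude_mean_arith pi V (amplitude_mean lam f n) e
  (Int (- pi) pi S) (Int (- pi) pi \1_B)) => //.
- exact: pi_ge2.
- by have := @pihalf_lt2 R; lra.
- exact: amplitude_mean_ge0.
rewrite -(@Int_cst _ (- pi) pi)//.
rewrite -IntZ// -IntD; [|exact: intble_cst|exact: intbleZ].
apply: le_Int => //.
- rewrite /S; under [X in intble _ _ X]eq_fun do rewrite mulrC.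
  by apply: intbleZ; apply: intble_sum => k _; apply/intbleZ/intble_continuous.
- by apply: intbleD; [exact: intble_cst|exact: intbleZ].
Qed.

(** A termwise substitute for the power mean inequality: with t the k-th term, either t <= e, or t /
    e >= 1 and then t / e <= (t / e)^lam. *)
Lemma amplitude_mean1_le lam f n e : 1 <= lam -> 0 < e ->
  (\sum_(1 <= k < n.+1) k%:R * amplitude f k) / n%:R <=
  e + e * e^-1 `^ lam * amplitude_mean lam f n.
Proof.
move=> lam1 e0; have lam0 : 0 < lam by exact: lt_le_trans lam1.
have K t : 0 <= t -> t <= e + e * e^-1 `^ lam * t `^ lam.
  move=> t0; have C0 : 0 <= e * e^-1 `^ lam * t `^ lam.
    by rewrite !mulr_ge0 ?powR_ge0// ltW.
  have [te|et] := leP t e; first by rewrite ler_wpDr.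
  rewrite ler_wpDl ?(ltW e0)// -mulrA -powRM ?invr_ge0 ?(ltW e0)//.
  rewrite -ler_pdivrMl// -{1}[e^-1 * t]powRr1 ?mulr_ge0 ?invr_ge0 ?(ltW e0)//.
  by apply: ler_powR => //; rewrite mulrC ler_pdivlMr// mul1r ltW.
case: n => [|n]; first by rewrite /amplitude_mean invr0 !mulr0 addr0 ltW.
rewrite ler_pdivrMr ?ltr0n// mulrDl /amplitude_mean mulrA divfK ?pnatr_eq0//.
have -> : e * n.+1%:R = \sum_(1 <= k < n.+2) e.
  by rewrite sumr_const_nat subn1 mulr_natr.
rewrite mulr_sumr -big_split/=; apply: ler_sum => k _.
by rewrite -powRM ?amplitude_ge0//; apply: K; rewrite mulr_ge0 ?amplitude_ge0.
Qed.

Lemma amplitude_mean1_cvg0 lam f : 1 <= lam ->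
  (forall e, 0 < e -> exists N, forall n, (N <= n)%N -> amplitude_mean lam f n <= e) ->
  forall e, 0 < e -> exists N, forall n, (N <= n)%N ->
    (\sum_(1 <= k < n.+1) k%:R * amplitude f k) / n%:R <= e.
Proof.
move=> lam1 H e e0; have e2 : 0 < e / 2 by rewrite divr_gt0.
pose C := e / 2 * (e / 2)^-1 `^ lam; have C0 : 0 < C by rewrite mulr_gt0// powR_gt0 ?invr_gt0.
have [|N HN] := H (e / 2 / C); first by rewrite divr_gt0.
exists N => n Nn; apply: le_trans (amplitude_mean1_le f n lam1 e2) _.
have : C * amplitude_mean lam f n <= e / 2 by rewrite mulrC -ler_pdivlMr//; exact: HN.
by rewrite -/C; move: (C * _) => y; lra.
Qed.

(** For k <= 2 n the weights of orders 2 n and n differ by at most k / n, the weight of order n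
    being counted as 0 for k > n; the factor 2 turns 1 / (2 n) into 1 / n. *)
Lemma conj_fejer_sum_double f n x :
  `|conj_fejer_sum f n.*2 x - conj_fejer_sum f n x| <=
  2 * ((\sum_(1 <= k < n.*2.+1) k%:R * amplitude f k) / n.*2%:R).
Proof.
case: n => [|n]; first by rewrite double0 subrr normr0 invr0 !mulr0.
rewrite /conj_fejer_sum.
have -> : \sum_(1 <= k < n.+2) fejer_weight n.+1 k * conj_harm f k x =
    \sum_(1 <= k < n.+1.*2.+1) (if (k < n.+2)%N then fejer_weight n.+1 k else 0) *
      conj_harm f k x :> R.
  rewrite [RHS](@big_cat_nat _ _ _ n.+2 1 n.+1.*2.+1)//=; last by rewrite -addnn; lia.
  rewrite [X in _ = _ + X]big_nat_cond [X in _ = _ + X]big1 ?addr0.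
    by apply: eq_big_nat => k /andP[_ kn]; rewrite kn.
  by move=> k /andP[/andP[kn _] _]; rewrite ltnNge kn/= mul0r.
rewrite -sumrB; apply: le_trans (ler_norm_sum _ _ _) _.
rewrite mulr_suml mulr_sumr; apply: ler_sum_nat => k /andP[k1 k2].
rewrite -mulrBl normrM.
have -> : 2 * (k%:R * amplitude f k / n.+1.*2%:R) = (k%:R / n.+1%:R) * amplitude f k.
  by rewrite -muln2 natrM; field.
apply: ler_pM => //; last exact: norm_conj_harm_le.
have n1 : 0 < n.+1%:R :> R by [].
case: ifPn => [kn|]; last first.
  rewrite -leqNgt => nk; rewrite subr0; apply: le_trans (norm_fejer_weight_le1 k2) _.
  by rewrite ler_pdivlMr// mul1r ler_nat ltnW.
rewrite /fejer_weight.
have a1 : k%:R / n.+1.*2.+1%:R <= k%:R / n.+1%:R :> R.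
  rewrite ler_wpM2l// lef_pV2 ?posrE// ler_nat -addnn; lia.
have a2 : k%:R / n.+2%:R <= k%:R / n.+1%:R :> R.
  by rewrite ler_wpM2l// lef_pV2 ?posrE// ler_nat.
have a3 : 0 <= k%:R / n.+1.*2.+1%:R :> R by rewrite divr_ge0.
have a4 : 0 <= k%:R / n.+2%:R :> R by rewrite divr_ge0.
by rewrite ler_norml; apply/andP; split; move: a1 a2 a3 a4;
  move: (_ / n.+1.*2.+1%:R) (_ / n.+2%:R) (_ / n.+1%:R); intros; lra.
Qed.

Lemma fourier_fejer_dist f n x :
  `|fourier_sum f n x - fejer_sum f n x| <=
  (\sum_(1 <= k < n.+1) k%:R * amplitude f k) / n%:R.
Proof.
rewrite /fourier_sum /fejer_sum -/(harm f) opprD addrACA subrr add0r -sumrB.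
apply: le_trans (ler_norm_sum _ _ _) _; rewrite mulr_suml.
case: n => [|n]; first by rewrite !big_nil.
apply: ler_sum => k _; rewrite -/(harm f k x) -{1}[harm f k x]mul1r -mulrBl normrM.
rewrite [leRHS]mulrAC; apply: ler_pM => //; last exact: norm_harm_le.
rewrite /fejer_weight subKr ger0_norm ?divr_ge0//.
by rewrite ler_wpM2l// lef_pV2 ?posrE// ler_nat.
Qed.

End strong_means.

(** * Continuous representatives *)

Section continuous_representative.
Context {R : realType}.
Implicit Types (f g h : R -> R) (e x lam : R) (k n N : nat).
Local Notation mu := (@lebesgue_measure R).

Lemma ae_eq_fourier f g k : L1 f -> L1 g -> f = g %[ae mu] ->
  fourier_cos f k = fourier_cos g k /\ fourier_sin f k = fourier_sin g k.
Proof.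
move=> f1 g1 fg; split; congr (_ * _); apply: ae_eq_Int.
- by apply: intbleMc; [exact: L1_intble|exact: continuous_cosM].
- by apply: intbleMc; [exact: L1_intble|exact: continuous_cosM].
- by apply: filterS fg => x /= ->.
- by apply: intbleMc; [exact: L1_intble|exact: continuous_sinM].
- by apply: intbleMc; [exact: L1_intble|exact: continuous_sinM].
- by apply: filterS fg => x /= ->.
Qed.

Lemma ae_eq_fourier_sum f g : L1 f -> L1 g -> f = g %[ae mu] ->
  fourier_sum f = fourier_sum g.
Proof.
move=> f1 g1 fg; apply/funext => n; apply/funext => x; rewrite /fourier_sum.
have E k := ae_eq_fourier k f1 g1 fg.
by rewrite (E 0%N).1; congr (_ + _); apply: eq_bigr => k _; rewrite (E k).1 (E k).2.
Qed.

(* [ravg f x l] and [lavg f x l'] are the one-sided limits of averages of f, so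
   the hypothesis says that f has no jump. *)
Lemma continuous_version f g : L1 f -> periodic g (pi *+ 2) -> regulated g ->
  f = g %[ae mu] -> (forall x l l', ravg f x l -> lavg f x l' -> l = l') ->
  exists h, [/\ periodic h (pi *+ 2), continuous h & f = h %[ae mu]].
Proof.
move=> f1 gT gW fg nojump; pose h (x : R) : R := lim (g y @[y --> x^'+]).
have hr x : g y @[y --> x^'+] --> h x by have [] := gW x.
have rh x : ravg f x (h x) by exact: ravg_cvg (hr x).
have hl x : g y @[y --> x^'-] --> h x.
  have [_ /cvg_ex[l gl]] := gW x.
  by rewrite (nojump x (h x) l)//; exact: lavg_cvg gl.
have lh x : lavg f x (h x) by exact: lavg_cvg (hl x).
exists h; split.
(* [nojump] serves as uniqueness of the limit: by periodicity of f, h (x + 2 pi) is a limit of right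
   averages at x, and h x is one of left averages. *)
- move=> x; apply: (nojump x) => // e /(rh (x + pi *+ 2))[d d0 H]; exists d => // t t0 td.
  by under [X in Int _ _ X]eq_fun do rewrite -(f1.1 (x + _)) addrAC; exact: H.
- move=> x; apply/cvgrPdist_le => e e0.
  have e2 : 0 < e / 2 by rewrite divr_gt0.
  have [d1 /= d10 gd1] : \forall y \near x^'+, `|h x - g y| <= e / 2.
    by move/cvgrPdist_le : (hr x); exact.
  have [d2 /= d20 gd2] : \forall y \near x^'-, `|h x - g y| <= e / 2.
    by move/cvgrPdist_le : (hl x); exact.
  have gd y : `|x - y| < Num.min d1 d2 -> y != x -> `|h x - g y| <= e / 2.
    rewrite lt_min => /andP[y1 y2]; case: (ltgtP y x) => // xy _.
      exact: (gd2 y y2 xy).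
    exact: (gd1 y y1 xy).
  exists (Num.min d1 d2) => /=; first by rewrite lt_min d10.
  move: (Num.min d1 d2) gd => d gd z /= zd; have d0 := le_lt_trans (normr_ge0 _) zd.
  have [->|zx] := eqVneq z x; first by rewrite subrr normr0 ltW.
  have near_z : \forall y \near z^'+, `|h x - g y| <= e / 2.
    move: zd; rewrite ltr_distlC => /andP[zd1 zd2].
    (* h z is a limit of values of g to the right of z. Staying below y0 keeps these points within d
       of x and distinct from x, where g is not controlled. *)
    have [y0 zy0 y0P] : exists2 y0, z < y0 & y0 <= x + d /\ (z < x -> y0 <= x).
      have [xz|zx'] := ltP x z; first by exists (x + d) => //; split=> //; rewrite ltNge ltW.
      by exists x; [rewrite lt_neqAle zx|split=> //; rewrite lerDl ltW].
    near=> y; have zy : z < y by near: y; exact: nbhs_right_gt.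
    have yy : y < y0 by near: y; exact: nbhs_right_lt.
    apply: gd => /=.
      by rewrite ltr_distlC (lt_trans _ zy)//= (lt_le_trans yy)//; case: y0P.
    have [xz|zx'] := ltP x z; first by rewrite gt_eqF// (lt_trans xz).
    by rewrite lt_eqF// (lt_le_trans yy)//; apply: y0P.2; rewrite lt_neqAle zx.
  have /cvgrPdist_le/(_ _ e2) near_h := hr z.
  have [y [hy hz]] : exists y, `|h x - g y| <= e / 2 /\ `|h z - g y| <= e / 2.
    by apply: (@filter_ex _ (z : R)^'+); exact: filterI.
  rewrite -(subrK (g y) (h x)) -addrA (splitr e); apply: le_trans (ler_normD _ _) _.
  by apply: lerD => //; rewrite distrC.
- apply: filterS (ae_avg f1) => x [fr fl] _; exact: nojump fr (lh x).
Unshelve. all: by end_near. Qed.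

Lemma continuous_regulated g : continuous g -> regulated g.
Proof.
move=> cg x; split; apply/cvg_ex; exists (g x).
  exact: cvg_at_right_filter (cg x).
exact: cvg_at_left_filter (cg x).
Qed.

Lemma strong_cvg_uniform_of lam h : 1 <= lam -> periodic h (pi *+ 2) -> continuous h ->
  (forall e, 0 < e -> exists N, forall n, (N <= n)%N -> amplitude_mean lam h n <= e) ->
  strong_cvg_uniform lam (fourier_sum h) h.
Proof.
move=> lam1 hT ch H; have lam0 : 0 <= lam by exact: le_trans lam1.
split; apply/cvg_uniformP => e e0.
  have e2 : 0 < e / 2 by rewrite divr_gt0.
  have [N1 HN1] := amplitude_mean1_cvg0 lam1 H e2.
  have [N2 HN2] := fejer_sum_unif hT ch e2.
  exists (maxn N1 N2) => n; rewrite geq_max => /andP[n1 n2] x.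
  rewrite -(subrK (fejer_sum h n x) (fourier_sum h n x)) -addrA.
  apply: le_trans (ler_normD _ _) _; rewrite [leRHS]splitr; apply: lerD.
    by apply: le_trans (fourier_fejer_dist _ _ _) _; exact: HN1.
  exact: HN2.
have [N HN] := H _ e0; exists N => n Nn x.
by rewrite subr0; apply: le_trans (strong_mean_le _ _ _ lam0) _; exact: HN.
Qed.

Lemma amplitude_mean_eq lam f g n :
  (forall k, (0 < k)%N -> amplitude f k = amplitude g k) ->
  amplitude_mean lam f n = amplitude_mean lam g n.
Proof.
rewrite /amplitude_mean; move: (amplitude f) (amplitude g) => u v uv.
by congr (_ / _); apply: eq_big_nat => k /andP[k0 _]; rewrite uv.
Qed.

Lemma classS_uniform_of lam f : 1 <= lam -> classW f ->
  (forall e, 0 < e -> exists N, forall n, (N <= n)%N -> amplitude_mean lam f n <= e) ->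
  classS_uniform lam f.
Proof.
move=> lam1 [f1 [g [gT gW fg]]] H; split=> //.
have [|h [hT ch fh]] := continuous_version f1 gT gW fg.
  move=> x l l' fr fl; apply: (conj_fejer_jump f1 fr fl); apply/cvg_seqP => e e0.
  have e2 : 0 < e / 2 by rewrite divr_gt0.
  have [N HN] := amplitude_mean1_cvg0 lam1 H e2; exists N => n Nn; rewrite subr0.
  apply: le_trans (conj_fejer_sum_double _ _ _) _; rewrite mulrC -ler_pdivlMr//.
  by apply: HN; rewrite -addnn (leq_trans Nn)// leq_addr.
exists h; split; [exact: hT| |exact: fh]; split; first exact: ch.
apply: (strong_cvg_uniform_of lam1 hT ch) => e /H[N HN].
exists N => n Nn; rewrite -(@amplitude_mean_eq lam f); first exact: HN.
move=> k _; have [] := ae_eq_fourier k f1 (L1_continuous hT ch) fh.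
by rewrite /amplitude => -> ->.
Qed.

Lemma classW_classS_ae lam : 1 <= lam ->
  @classW R `&` classS_ae lam = classS_uniform lam.
Proof.
move=> lam1; apply/seteqP; split=> f.
  move=> [fW [f1 fS]]; apply: classS_uniform_of => //.
  by apply: amplitude_mean_cvg0 => //; apply: filterS fS => x [].
move=> [f1 [g [gT [cg [/cvg_uniformP sg /cvg_uniformP mg]] fg]]]; split.
  by split=> //; exists g; split=> //; exact: continuous_regulated.
split=> //; rewrite (ae_eq_fourier_sum f1 (L1_continuous gT cg) fg).
apply: filterS fg => x /= ->; split; apply/cvg_seqP => e e0.
  by have [N HN] := sg _ e0; exists N => n Nn; exact: HN.
by have [N HN] := mg _ e0; exists N => n Nn; exact: HN.
Qed.

Lemma classS_conjugate lam f ft : 1 <= lam -> conjugate_of f ft ->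
  classS_ae lam f -> classW ft -> classS_uniform lam ft.
Proof.
move=> lam1 fft [f1 fS] ftW; apply: classS_uniform_of => // e e0.
have [|N HN] := amplitude_mean_cvg0 lam1 _ e0 (f := f).
  by apply: filterS fS => x [].
exists N => n Nn; rewrite (@amplitude_mean_eq lam ft f); first exact: HN.
move=> k k0; rewrite /amplitude; have [-> ->] := conjugate_fourier f1 ftW.1 fft k0.
by rewrite sqrrN addrC.
Qed.

Lemma conj_fejer_sum_conjugate f ft n x : L1 f -> L1 ft -> conjugate_of f ft ->
  conj_fejer_sum f n x = fejer_sum ft n x - fourier_cos ft 0 / 2 /\
  conj_fejer_sum ft n x = - (fejer_sum f n x - fourier_cos f 0 / 2).
Proof.
move=> f1 ft1 fft; rewrite /conj_fejer_sum /fejer_sum !(addrC (_ / 2)) !addrK -sumrN.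
split; apply: eq_big_nat => k /andP[k0 _]; rewrite /harm /conj_harm;
  have [-> ->] := conjugate_fourier f1 ft1 fft k0; ring.
Qed.

(** This holds at every x, not just almost everywhere: the Fejer means of a regulated function
    converge to the midpoint of its one-sided limits. The exclusion of jumps needs every point. *)
Lemma fejer_sum_double_cvg0 f x : classW f ->
  fejer_sum f n.*2 x - fejer_sum f n x @[n --> \oo] --> (0 : R).
Proof.
move=> [f1 [g [_ gW fg]]]; have [/cvg_ex[l gl] /cvg_ex[l' gl']] := gW x.
have /cvg_seqP H := fejer_sum_cvg f1 (ravg_cvg f1 fg gl) (lavg_cvg f1 fg gl').
apply/cvg_seqP => e e0; have e2 : 0 < e / 2 by rewrite divr_gt0.
have [N HN] := H _ e2; exists N => n Nn; rewrite subr0.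
set c := (l + l') / 2 in HN.
have -> : fejer_sum f n.*2 x - fejer_sum f n x =
  (fejer_sum f n.*2 x - c) - (fejer_sum f n x - c) by ring.
apply: le_trans (ler_normB _ _) _; rewrite [leRHS]splitr; apply: lerD; apply: HN => //.
by rewrite -addnn (leq_trans Nn)// leq_addr.
Qed.

Lemma classC_conjugate f ft : conjugate_of f ft -> classW f -> classW ft ->
  classC f /\ classC ft.
Proof.
move=> fft fW ftW; have f1 := fW.1; have ft1 := ftW.1.
have E n x := conj_fejer_sum_conjugate n x f1 ft1 fft.
split; split=> //.
  have [_ [g [gT gW fg]]] := fW.
  have [|h [hT ch fh]] := continuous_version f1 gT gW fg; last by exists h.
  move=> x l l' fr fl; apply: (conj_fejer_jump f1 fr fl).
  under eq_fun do rewrite !(E _ _).1 opprD addrACA opprK addNr addr0.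
  exact: fejer_sum_double_cvg0.
have [_ [g [gT gW fg]]] := ftW.
have [|h [hT ch fh]] := continuous_version ft1 gT gW fg; last by exists h.
move=> x l l' fr fl; apply: (conj_fejer_jump ft1 fr fl).
have {}E n : conj_fejer_sum ft n.*2 x - conj_fejer_sum ft n x =
    - (fejer_sum f n.*2 x - fejer_sum f n x) by rewrite !(E _ _).2; ring.
under eq_fun do rewrite E.
by rewrite -oppr0; apply: cvgN; exact: fejer_sum_double_cvg0.
Qed.

End continuous_representative.

(** * Harmonic variation *)

Section harmonic_variation.
Context {R : realType}.
Implicit Types (f g h : R -> R) (a b c d e l r x y z M : R) (m n : nat)
  (p q : R * R) (s t : seq (R * R)).
Local Notation mu := (@lebesgue_measure R).

(* The first interval of s has rank m.+1. *)
Fixpoint hvar g m s : R :=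
  if s is p :: s' then `|g p.2 - g p.1| / m.+1%:R + hvar g m.+1 s' else 0.

Definition apart p q := (p.2 <= q.1) || (q.2 <= p.1).

(** Lists in arbitrary order replace the families indexed by ordinals, so that collections can be
    concatenated and their ranks shifted. *)
Definition collection l r s :=
  all (fun p => [&& l <= p.1, p.1 < p.2 & p.2 <= r]) s && pairwise apart s.

Lemma hvar_cat g m s t : hvar g m (s ++ t) = hvar g m s + hvar g (m + size s) t.
Proof.
elim: s m => [|p s IH] m /=; first by rewrite addn0 add0r.
by rewrite IH addrA addSnnS.
Qed.

Lemma hvarE g m s : hvar g m s = \sum_(i < size s)
  `|g (nth (0, 0) s i).2 - g (nth (0, 0) s i).1| / (m + i).+1%:R.
Proof.
elim: s m => [|p s IH] m /=; first by rewrite big_ord0.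
rewrite big_ord_recl/= addn0 IH; congr (_ + _); apply: eq_bigr => i _.
by rewrite addSnnS.
Qed.

Lemma hvar_map g m (A B : nat -> R) k :
  hvar g m [seq (A i, B i) | i <- iota 0 k] =
  \sum_(0 <= i < k) `|g (B i) - g (A i)| / (m + i).+1%:R.
Proof.
elim: k => [|k IH]; first by rewrite big_nil.
by rewrite -(addn1 k) iotaD map_cat hvar_cat IH size_map size_iota addn1 big_nat_recr//= addr0.
Qed.

Lemma hbv_collection g : harmonic_bounded_variation g ->
  exists M, forall s, collection 0 (pi *+ 2) s -> hvar g 0 s <= M.
Proof.
move=> [M gM]; exists M => s /andP[/(all_nthP (0, 0)) sI /(pairwiseP (0, 0)) sA].
apply: gM; exists (size s), (fun i => (nth (0, 0) s i).1), (fun i => (nth (0, 0) s i).2).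
split; last exact: hvarE.
- by move=> i; have /and3P[] := sI i (ltn_ord i).
- move=> i y /=; rewrite !in_itv/= => /andP[y1 y2].
  by have /and3P[a _ b] := sI i (ltn_ord i); rewrite (le_lt_trans a)//= (lt_le_trans y2).
- move=> i j _ _ [y []]; rewrite /= !in_itv/= => /andP[i1 i2] /andP[j1 j2].
  have K (i' j' : 'I_(size s)) : (i' < j')%N -> (nth (0, 0) s i').1 < y ->
      y < (nth (0, 0) s i').2 -> (nth (0, 0) s j').1 < y -> y < (nth (0, 0) s j').2 -> False.
    move=> ij a1 a2 b1 b2.
    have /orP[] := sA i' j' (ltn_ord i') (ltn_ord j') ij; rewrite leNgt => /negP; apply.
      exact: lt_trans b1 a2.
    exact: lt_trans a1 b2.
  apply/val_inj; case: (ltngtP i j) => // ij.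
    by case: (K _ _ ij i1 i2 j1 j2).
  by case: (K _ _ ij j1 j2 i1 i2).
Qed.

(** The common form of three replacements of intervals by subintervals at the cost of a factor c:
    cutting at a multiple of the period, moving endpoints off a null set, and avoiding a point. *)
Lemma collection_refine g g' c l r s m (Q : R -> R -> Prop) : 0 <= c ->
  (forall a b, a < b -> exists a' b', [/\ a <= a', a' < b', b' <= b, Q a' b' &
     `|g b - g a| <= c * `|g' b' - g' a'|]) ->
  collection l r s -> exists t, [/\ collection l r t,
    forall q, q \in t -> Q q.1 q.2 & hvar g m s <= c * hvar g' m t].
Proof.
move=> c0 H /andP[sI sA].
(* Each new interval remembers an interval of s that contains it, from which nonoverlapping is
   inherited in the induction. *)
suff [t [H1 [H2 [H3 H4]]]] : exists t, (forall q, q \in t -> q.1 < q.2 /\ exists2 p, p \in s &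
    (p.1 <= q.1) && (q.2 <= p.2)) /\ pairwise apart t /\
    (forall q, q \in t -> Q q.1 q.2) /\ hvar g m s <= c * hvar g' m t.
  exists t; split=> //; apply/andP; split=> //; apply/allP => q /H1[qq [p ps /andP[a b]]].
  have /and3P[lp _ pr] := allP sI _ ps.
  by rewrite (le_trans lp a) qq (le_trans b pr).
elim: s m sI sA => [|p s IH] m /=.
  by move=> _ _; exists [::]; do 3 split=> //=; rewrite mulr0.
move=> /andP[/and3P[lp pp pr] sI] /andP[pA sA].
have [t [H1 [H2 [H3 H4]]]] := IH m.+1 sI sA.
have [a' [b' [aa ab bb Qab vab]]] := H _ _ pp.
exists ((a', b') :: t); split; [|split; [|split]] => /=.
- move=> q; rewrite inE => /orP[/eqP ->/=|/H1[qq [p' p's h]]].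
    by split=> //; exists p; rewrite ?mem_head// aa bb.
  by split=> //; exists p' => //; rewrite inE p's orbT.
- rewrite H2 andbT; apply/allP => q /H1[qq [p' p's /andP[u v]]].
  have /orP[w|w] := allP pA _ p's; apply/orP => /=.
    by left; rewrite (le_trans bb)// (le_trans w).
  by right; rewrite (le_trans v)// (le_trans w).
- by move=> q; rewrite inE => /orP[/eqP ->//|]; exact: H3.
- rewrite mulrDr; apply: lerD => //.
  by rewrite mulrA; apply: ler_wpM2r; rewrite ?invr_ge0.
Qed.

Lemma collection_map l r l' r' s (F : R * R -> R * R) :
  (forall p, p \in s -> [&& l' <= (F p).1, (F p).1 < (F p).2 & (F p).2 <= r']) ->
  (forall p q, p \in s -> q \in s -> apart p q -> apart (F p) (F q)) ->
  collection l r s -> collection l' r' (map F s).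
Proof.
move=> FI FA /andP[_ sA]; apply/andP; split.
  by apply/allP => _ /mapP[p ps ->]; exact: FI.
elim: s FI FA sA => //= p s IH FI FA /andP[pA sA]; apply/andP; split.
  apply/allP => _ /mapP[q qs ->]; apply: FA; rewrite ?mem_head ?inE ?qs ?orbT//.
  exact: (allP pA).
apply: IH => //; first by move=> q qs; apply: FI; rewrite inE qs orbT.
by move=> q q' qs q's; apply: FA; rewrite inE ?qs ?q's orbT.
Qed.

Lemma hvar_map_eq g m s (F : R * R -> R * R) :
  (forall p, p \in s -> g (F p).2 - g (F p).1 = g p.2 - g p.1) ->
  hvar g m (map F s) = hvar g m s.
Proof.
elim: s m => //= p s IH m H; rewrite H ?mem_head// IH// => q qs.
by apply: H; rewrite inE qs orbT.
Qed.

(** The window has length 2 P. Once it is translated by - z, its part to the left of z is moved 2 P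
    to the right, where it lands beyond the other part. *)
Lemma collection_rotate P c z s : - P <= - c + z -> - c + z <= P ->
  collection (c - P) (c + P) s -> (forall q, q \in s -> q.2 <= z \/ z <= q.1) ->
  collection 0 (P + P) [seq if p.2 <= z then (p.1 - z + (P + P), p.2 - z + (P + P))
                            else (p.1 - z, p.2 - z) | p <- s].
Proof.
move=> k1 k2 cs sz; have sI p : p \in s ->
    [/\ c - P <= p.1, p.1 < p.2, p.2 <= c + P & p.2 <= z \/ z <= p.1].
  by move=> ps; have /andP[/allP/(_ p ps)/and3P[? ? ?] _] := cs; split=> //; exact: sz.
apply: collection_map cs.
  move=> p /sI[]; case: p => p1 p2 /=; clear -k1 k2.
  by case: ifPn => [pz|/negP pz] /= ? ? ? [] // ?; apply/and3P; split; lra.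
move=> p q /sI + /sI; case: p q => [p1 p2] [q1 q2] /=; clear -k1 k2.
rewrite /apart/=; do 2 case: ifPn => /= /negP ?; rewrite ?lerD2r// => -[? ? ? ?] [? ? ? ?] _.
  by apply/orP; right; lra.
by apply/orP; left; lra.
Qed.

Definition hvar_bounded g := forall c, exists M, forall s,
  collection (c - pi) (c + pi) s -> hvar g 0 s <= M.

(** The definition of harmonic variation bears on (0, 2 pi) only, so a multiple z of the period
    inside the window is an obstacle. An interval across z is replaced by whichever of its two
    pieces has the larger increment, hence the factor 2. *)
Lemma hbv_hvar_bounded g : periodic g (pi *+ 2) -> harmonic_bounded_variation g ->
  hvar_bounded g.
Proof.
move=> gT /hbv_collection[M gM] c; exists (2 * M) => s cs.
have p0 := @pi_gt0 R.
have [k] := period_reduce (- c); set T := pi *+ 2 => /andP[k1 k2].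
pose z := T *~ k; have gz y : g (y + z) = g y by exact: periodicz.
have [||t [ct tz st]] := @collection_refine g g 2 _ _ s 0
    (fun a b => b <= z \/ z <= a) _ _ cs => //.
  move=> a b ab; have [bz|zb] := leP b z.
    exists a, b; split=> //; first by left.
    by rewrite ler_peMl// ler1n.
  have [za|az] := leP z a.
    exists a, b; split=> //; first by right.
    by rewrite ler_peMl// ler1n.
  have tri : `|g b - g a| <= `|g b - g z| + `|g z - g a|.
    by rewrite -(subrKA (g z)); exact: ler_normD.
  have [h|h] := leP `|g b - g z| `|g z - g a|.
    exists a, z; split=> //; [exact: ltW|by left|].
    by apply: le_trans tri _; rewrite mulrDl !mul1r; exact: lerD.
  exists z, b; split=> //; [exact: ltW|by right|].
  by apply: le_trans tri _; rewrite mulrDl !mul1r lerD// ltW.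
apply: le_trans st _; rewrite ler_pM2l//.
pose F p := if p.2 <= z then (p.1 - z + T, p.2 - z + T) else (p.1 - z, p.2 - z).
have gy y : g (y - z) = g y by rewrite -(gz (y - z)) subrK.
rewrite -(@hvar_map_eq g 0 t F).
  by apply: gM; rewrite /T mulr2n; apply: collection_rotate ct tz.
move=> p pt; rewrite /F; case: ifP => _ /=; last by rewrite !gy.
by rewrite !(gT, gy).
Qed.

(** * Harmonic variation near a point *)

Definition avoids x d s := forall p, p \in s -> p.2 <= x - d \/ x + d <= p.1.

Lemma collectionW l r l' r' s : l' <= l -> r <= r' -> collection l r s -> collection l' r' s.
Proof.
move=> ll rr /andP[sI sA]; rewrite /collection sA andbT.
apply: sub_all sI => p /and3P[p1 p2 p3].
by rewrite (le_trans ll)//= p2 (le_trans p3).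
Qed.

Lemma avoidsW x d d' s : d' <= d -> avoids x d s -> avoids x d' s.
Proof.
move=> dd H p /H[h|h]; [left|right]; first by rewrite (le_trans h)// lerB.
by rewrite (le_trans _ h)// lerD2l.
Qed.

Lemma collection_cat x d l r s t : avoids x d s -> l <= x - d -> x + d <= r ->
  collection l r s -> collection (x - d) (x + d) t -> collection l r (s ++ t).
Proof.
move=> sx lx xr /andP[sI sA] ct; have /andP[tI tA] := collectionW lx xr ct.
rewrite /collection all_cat sI tI pairwise_cat sA tA !andbT/=.
apply/allrelP => p q /sx ps qt; have /andP[/allP/(_ q qt)/and3P[q1 _ q2] _] := ct.
apply/orP; case: ps => h; first by left; exact: le_trans h q1.
by right; exact: le_trans q2 h.
Qed.

(* Collections that accumulate at x are concatenated from the outermost inwards;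
   starting each of them at an arbitrary rank keeps its contribution above e. *)
Lemma concat_unbounded g x e : hvar_bounded g -> 0 < e ->
  (forall m d, 0 < d -> exists s d', [/\ 0 < d', collection (x - d) (x + d) s,
     avoids x d' s & e <= hvar g m s]) -> False.
Proof.
move=> /(_ x)[M gM] e0 H; have p0 := @pi_gt0 R.
have K n : exists s d, [/\ 0 < d, d <= pi, collection (x - pi) (x + pi) s,
    avoids x d s & n%:R * e <= hvar g 0 s].
  elim: n => [|n [s [d [d0 dp cs ax es]]]].
    by exists [::], pi; split=> //; rewrite mul0r.
  have [t [d' [d'0 ct tx et]]] := H (size s) d d0.
  exists (s ++ t), (Num.min d d'); split.
  - by rewrite lt_min d0.
  - by rewrite ge_min dp.
  - by apply: collection_cat ct => //; rewrite ?lerD2l ?lerN2.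
  - move=> p; rewrite mem_cat => /orP[ps|pt].
      by apply: (avoidsW _ ax ps); rewrite ge_min lexx.
    by apply: (avoidsW _ tx pt); rewrite ge_min lexx orbT.
  - by rewrite hvar_cat add0n -natr1 mulrDl mul1r lerD.
have [s [d [_ _ cs _ es]]] := K (Num.bound (M / e)).
have := le_trans es (gM _ cs); rewrite leNgt -ltr_pdivrMr// => /negP; apply.
rewrite ltNge; apply/negP => MK; have [M0|M0] := leP 0 (M / e).
  by have := archi_boundP M0; rewrite ltNge MK.
by have := le_lt_trans MK M0; rewrite ltNge ler0n.
Qed.

Lemma hvar_ge g m e s : (forall p, p \in s -> e <= `|g p.2 - g p.1|) -> 0 <= e ->
  (size s)%:R * e / (m + size s)%:R <= hvar g m s.
Proof.
move=> H e0; rewrite hvarE.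
have -> : (size s)%:R * e / (m + size s)%:R = \sum_(i < size s) e / (m + size s)%:R.
  by rewrite sumr_const card_ord -mulrA mulr_natl.
apply: ler_sum => i _; apply: ler_pM; rewrite ?invr_ge0//.
  by apply: H; exact: mem_nth.
have s0 : (0 < m + size s)%N by rewrite addn_gt0 (leq_trans _ (ltn_ord i)) ?orbT.
by rewrite lef_pV2 ?posrE ?ltr0n// ler_nat -addnS leq_add2l.
Qed.

(** Near x one can pick m + 1 nonoverlapping intervals with increments of at least e. Placed after m
    others they have ranks at most 2 m + 1, so they contribute at least e / 2 whatever m is. *)
Lemma oscillation_unbounded g x e : hvar_bounded g -> 0 < e ->
  (forall d, 0 < d -> exists y z, [/\ y < z, x < y \/ z < x, x - d <= y, z <= x + d &
     e <= `|g z - g y|]) -> False.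
Proof.
move=> gB e0 H; have e2 : 0 < e / 2 by rewrite divr_gt0.
apply: (@concat_unbounded g x (e / 2)) => // m d d0.
have K n : exists s d', [/\ 0 < d', d' <= d, collection (x - d) (x + d) s, avoids x d' s &
    size s = n /\ forall p, p \in s -> e <= `|g p.2 - g p.1|].
  elim: n => [|n [s [d' [d'0 d'd cs ax [sn es]]]]]; first by exists [::], d.
  have [y [z [yz xyz y1 z1 eyz]]] := H _ d'0.
  exists (s ++ [:: (y, z)]), (Num.min d' (if x < y then y - x else x - z)); split.
  - rewrite lt_min d'0/=; case: ifPn => [xy|]; first by rewrite subr_gt0.
    by case: xyz => [->//|zx _]; rewrite subr_gt0.
  - by rewrite ge_min d'd.
  - by apply: (@collection_cat x d') => //; rewrite ?lerD2l ?lerN2// /collection/= y1 yz z1.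
  - move=> p; rewrite mem_cat => /orP[ps|].
      by apply: (avoidsW _ ax ps); rewrite ge_min lexx.
    rewrite inE => /eqP -> /=; case: ifPn => [xy|xy]; [right|left].
      by rewrite -lerBrDl ge_min lexx orbT.
    by rewrite lerBrDr -lerBrDl ge_min lexx orbT.
  - split; first by rewrite size_cat sn addn1.
    by move=> p; rewrite mem_cat inE => /orP[|/eqP -> //]; exact: es.
have [s [d' [d'0 d'd cs ax [sm es]]]] := K m.+1.
exists s, d'; split=> //; apply: le_trans (hvar_ge m es (ltW e0)); rewrite sm.
rewrite -mulrA mulrCA ler_pM2l// ler_pdivlMr ?ltr0n ?addnS//.
by rewrite mulrC ler_pdivrMr// -natrM ler_nat; lia.
Qed.

Lemma cvg_at_right_cauchy g x :
  (forall e, 0 < e -> exists2 d, 0 < d & forall y z, x < y -> x < z -> y <= x + d ->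
     z <= x + d -> `|g z - g y| <= e) -> cvg (g y @[y --> x^'+]).
Proof.
move=> H; apply/cauchy_cvgP; apply: cauchy_exP => e e0.
have e2 : 0 < e / 2 by rewrite divr_gt0.
have [d d0 gd] := H _ e2; exists (g (x + d)).
change (\forall y \near x^'+, ball (g (x + d)) e (g y)); near=> y.
rewrite /ball/=; apply: le_lt_trans (gd y (x + d) _ _ _ _) _ => //.
- by rewrite ltrDl.
- by near: y; apply: nbhs_right_le; rewrite ltrDl.
- by rewrite ltr_pdivrMr// ltr_pMr// ltr1n.
Unshelve. all: by end_near. Qed.

Lemma cvg_at_left_cauchy g x :
  (forall e, 0 < e -> exists2 d, 0 < d & forall y z, y < x -> z < x -> x - d <= y ->
     x - d <= z -> `|g z - g y| <= e) -> cvg (g y @[y --> x^'-]).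
Proof.
move=> H; apply/cauchy_cvgP; apply: cauchy_exP => e e0.
have e2 : 0 < e / 2 by rewrite divr_gt0.
have [d d0 gd] := H _ e2; exists (g (x - d)).
change (\forall y \near x^'-, ball (g (x - d)) e (g y)); near=> y.
rewrite /ball/=; apply: le_lt_trans (gd y (x - d) _ _ _ _) _ => //.
- by rewrite ltrBlDr ltrDl.
- by near: y; apply: nbhs_left_ge; rewrite ltrBlDr ltrDl.
- by rewrite ltr_pdivrMr// ltr_pMr// ltr1n.
Unshelve. all: by end_near. Qed.

Lemma hvar_bounded_regulated g : hvar_bounded g -> regulated g.
Proof.
move=> gB x; split.
  apply: cvg_at_right_cauchy => e e0; apply: contrapT => nd.
  apply: (oscillation_unbounded (x := x) gB e0) => d d0; apply: contrapT => nyz.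
  apply: nd; exists d => // y z xy xz yd zd; rewrite leNgt; apply/negP => eyz.
  have e' := ltW eyz; have xd : x - d <= x by rewrite gerBl ltW.
  case: (ltgtP y z) => yz.
  - by apply: nyz; exists y, z; split=> //; [left|exact: le_trans xd (ltW xy)].
  - by apply: nyz; exists z, y; split=> //; [left|exact: le_trans xd (ltW xz)|rewrite distrC].
  - by move: eyz; rewrite yz subrr normr0 ltNge ltW.
apply: cvg_at_left_cauchy => e e0; apply: contrapT => nd.
apply: (oscillation_unbounded (x := x) gB e0) => d d0; apply: contrapT => nyz.
apply: nd; exists d => // y z xy xz yd zd; rewrite leNgt; apply/negP => eyz.
have e' := ltW eyz; have xd : x <= x + d by rewrite lerDl ltW.
case: (ltgtP y z) => yz.
- by apply: nyz; exists y, z; split=> //; [right|exact: le_trans (ltW xz) xd].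
- by apply: nyz; exists z, y; split=> //; [right|exact: le_trans (ltW xy) xd|rewrite distrC].
- by move: eyz; rewrite yz subrr normr0 ltNge ltW.
Qed.

Lemma ae_dense (P : set R) a b : a < b -> (\forall x \ae mu, P x) ->
  exists x, [/\ a < x, x < b & P x].
Proof.
move=> ab [N [mN N0 PN]]; apply: contrapT => nx.
have abN : `]a, b[ `<=` N.
  move=> y /=; rewrite in_itv/= => /andP[ay yb]; apply: PN => /= Py.
  by apply: nx; exists y.
have := le_measure mu (mem_set (measurable_itv `]a, b[)) (mem_set mN) abN.
rewrite /= lebesgue_measure_itv/= lte_fin ab -EFinB => H.
have : ((b - a)%:E <= 0)%E by rewrite -N0.
by rewrite lee_fin subr_le0 leNgt ab.
Qed.

(** Endpoints are moved inwards to points where g and h agree. By continuity each move costs at most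
    a quarter of the increment of h, so at least half of it remains. *)
Lemma hvar_bounded_ae g h : g = h %[ae mu] -> continuous h -> hvar_bounded g ->
  hvar_bounded h.
Proof.
move=> gh ch gB c; have [M gM] := gB c; exists (2 * M) => s cs.
have [||t [ct _ st]] := @collection_refine h g 2 _ _ s 0 (fun _ _ => True) _ _ cs => //.
  move=> a b ab; have [v0|v0] := eqVneq (h b - h a) 0.
    by exists a, b; split=> //; rewrite v0 normr0 mulr_ge0.
  have v4 : 0 < `|h b - h a| / 4 by rewrite divr_gt0 ?normr_gt0.
  have [d1 /= d10 hd1] : \forall y \near a, `|h a - h y| <= `|h b - h a| / 4.
    by move/cvgrPdist_le : (ch a); exact.
  have [d2 /= d20 hd2] : \forall y \near b, `|h b - h y| <= `|h b - h a| / 4.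
    by move/cvgrPdist_le : (ch b); exact.
  have [|a' [aa' a'a ga]] := ae_dense _ gh (a := a) (b := Num.min (a + d1) ((a + b) / 2)).
    by rewrite lt_min ltrDl d10 /=; lra.
  have [|b' [b'b bb' gb]] := ae_dense _ gh (a := Num.max (b - d2) ((a + b) / 2)) (b := b).
    by rewrite gt_max ltrBlDr ltrDl d20 /=; lra.
  move: a'a b'b; rewrite lt_min gt_max => /andP[a1 a2] /andP[b1 b2].
  exists a', b'; split=> //; try exact: ltW; first exact: lt_trans a2 b2.
  rewrite (ga I) (gb I).
  have /hd1 u1 : `|a - a'| < d1 by rewrite distrC ger0_norm ?subr_ge0 1?ltW// ltrBlDl.
  have /hd2 u2 : `|b - b'| < d2 by rewrite ger0_norm ?subr_ge0 1?ltW// ltrBlDl -ltrBlDr.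
  have := ler_normD (h b - h b') (h b' - h a'); have := ler_normD (h b - h a') (h a' - h a).
  rewrite !subrKA (distrC (h a') (h a)).
  move: u1 u2; move: `|h a - h a'| `|h b - h b'| `|h b - h a'| `|h b' - h a'| `|h b - h a|.
  by intros; lra.
by apply: le_trans st _; rewrite ler_pM2l//; exact: gM.
Qed.

(** When x lies in [a, b], one of the pieces cut at x carries at least half of the increment;
    pulling its end off x costs at most a quarter by continuity, and a quarter remains. *)
Lemma interval_avoid h x a b : continuous h -> a < b ->
  exists a' b', [/\ a <= a', a' < b', b' <= b, b' < x \/ x < a' &
    `|h b - h a| <= 4 * `|h b' - h a'|].
Proof.
move=> ch ab.
have triv : `|h b - h a| <= 4 * `|h b - h a| by rewrite ler_peMl// ler1n.
have [xa|ax] := ltP x a; first by exists a, b; split=> //; right.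
have [bx|xb] := ltP b x; first by exists a, b; split=> //; left.
have [v0|v0] := eqVneq (h b - h a) 0.
  rewrite v0 normr0; have [xb'|bx] := ltP x b.
    by exists ((x + b) / 2), b; split=> //; try lra; rewrite ?mulr_ge0//; right; lra.
  by exists a, ((a + x) / 2); split=> //; try lra; rewrite ?mulr_ge0//; left; lra.
have v4 : 0 < `|h b - h a| / 4 by rewrite divr_gt0 ?normr_gt0.
have [d /= d0 hd] : \forall y \near x, `|h x - h y| <= `|h b - h a| / 4.
  by move/cvgrPdist_le : (ch x); exact.
have tri : `|h b - h a| <= `|h b - h x| + `|h x - h a|.
  by rewrite -(subrKA (h x)); exact: ler_normD.
have [half|half] := leP (`|h b - h a| / 2) `|h b - h x|.
  have xb' : x < b.
    rewrite lt_neqAle xb andbT; apply/eqP => E; move: half; rewrite E subrr normr0.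
    by move: v4; move: `|_|; intros; lra.
  pose a' := Num.min (x + d / 2) ((x + b) / 2).
  have xa' : x < a' by rewrite lt_min; apply/andP; split; lra.
  have a'd : a' <= x + d / 2 by rewrite ge_min lexx.
  have a'b : a' < b by rewrite gt_min; apply/orP; right; lra.
  exists a', b; split=> //; [exact: le_trans ax (ltW xa')|by right|].
  have /hd u1 : `|x - a'| < d by rewrite distrC ger0_norm ?subr_ge0 1?ltW//; lra.
  have := ler_normD (h b - h a') (h a' - h x); rewrite subrKA (distrC (h a') (h x)).
  by move: half u1; move: `|h x - h a'| `|h b - h a'| `|h b - h x| `|h b - h a|; intros; lra.
have ax' : a < x.
  rewrite lt_neqAle ax andbT; apply/eqP => E; move: half; rewrite E.
  by move: v4; rewrite E; move: `|_|; intros; lra.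
pose b' := Num.max (x - d / 2) ((a + x) / 2).
have b'x : b' < x by rewrite gt_max; apply/andP; split; lra.
have b'd : x - d / 2 <= b' by rewrite le_max lexx.
have ab' : a < b' by rewrite lt_max; apply/orP; right; lra.
exists a, b'; split=> //; [exact: le_trans (ltW b'x) xb|by left|].
have /hd u1 : `|x - b'| < d by rewrite ger0_norm ?subr_ge0 1?ltW//; lra.
have := ler_normD (h x - h b') (h b' - h a); rewrite subrKA.
move: tri half u1.
move: `|h x - h b'| `|h b' - h a| `|h b - h x| `|h x - h a| `|h b - h a|.
by intros; lra.
Qed.

Lemma avoids_uniform x s : (forall p, p \in s -> p.2 < x \/ x < p.1) ->
  exists2 d, 0 < d & avoids x d s.
Proof.
elim: s => [|p s IH] H; first by exists 1.
have [|d d0 dx] := IH; first by move=> q qs; apply: H; rewrite inE qs orbT.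
have [d' d'0 px] : exists2 d', 0 < d' & p.2 <= x - d' \/ x + d' <= p.1.
  have [px|xp] := H _ (mem_head _ _).
    by exists (x - p.2); [rewrite subr_gt0|left; rewrite subKr].
  by exists (p.1 - x); [rewrite subr_gt0|right; rewrite addrC subrK].
exists (Num.min d d'); first by rewrite lt_min d0.
move=> q; rewrite inE => /orP[/eqP ->|qs]; last first.
  by apply: avoidsW dx _ qs; rewrite ge_min lexx.
have px' : avoids x d' [:: p] by move=> q'; rewrite inE => /eqP ->.
by apply: (avoidsW _ px'); rewrite ?mem_head// ge_min lexx orbT.
Qed.

(** Starting at rank m + 1 at most doubles the denominators from the index i = m on, since m + i + 1
    <= 2 (i + 1); the earlier intervals are at most m in number and contribute at most v each. *)
Lemma hvar_shift_ge h m v s : (forall p, p \in s -> `|h p.2 - h p.1| <= v) -> 0 <= v ->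
  2^-1 * (hvar h 0 s - m%:R * v) <= hvar h m s.
Proof.
move=> sv v0; rewrite !hvarE ler_pdivrMl// lerBlDr.
have count n : \sum_(i < n) (if (i < m)%N then v else 0) <= m%:R * v.
  apply: (@le_trans _ _ ((minn n m)%:R * v)); last first.
    by apply: ler_wpM2r => //; rewrite ler_nat geq_minr.
  elim: n => [|n IH]; first by rewrite big_ord0 min0n mul0r.
  rewrite big_ord_recr/=; case: ltnP => nm; last first.
    by rewrite addr0 (le_trans IH)//; apply: ler_wpM2r => //; rewrite ler_nat; lia.
  rewrite (minn_idPl nm) -natr1 mulrDl mul1r lerD2r.
  by move: IH; rewrite (minn_idPl (ltnW nm)).
apply: le_trans (lerD (lexx _) (count (size s))).
rewrite mulr_sumr -big_split/=; apply: ler_sum => i _.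
have iv : `|h (nth (0, 0) s i).2 - h (nth (0, 0) s i).1| <= v by apply: sv; exact: mem_nth.
move: `|_| iv (normr_ge0 (h (nth (0, 0) s i).2 - h (nth (0, 0) s i).1)) => y yv y0.
rewrite add0n; case: ltnP => im.
  rewrite ler_wpDl ?mulr_ge0// (le_trans _ yv)// ler_piMr// invf_le1 ?ler1n//.
rewrite addr0 mulrCA; apply: ler_wpM2l => //.
by rewrite ler_pdivlMr// ler_pdivrMl// -natrM ler_nat; lia.
Qed.

(** Otherwise collections of variation above e would exist arbitrarily close to x. Continuity makes
    their increments so small that a shift to rank m + 1 leaves e / 4, and avoiding x leaves e / 16:
    this contradicts [concat_unbounded]. *)
Lemma small_hvar h x e : hvar_bounded h -> continuous h -> 0 < e ->
  exists2 d, 0 < d & forall s, collection (x - d) (x + d) s -> hvar h 0 s <= e.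
Proof.
move=> hB ch e0; apply: contrapT => nd.
have e16 : 0 < e / 16 by rewrite divr_gt0.
apply: (concat_unbounded (x := x) hB e16) => m d d0.
(* Increments near x are at most 2 v, so m of them amount to at most e / 2. *)
pose v := e / 4 / m.+1%:R; have v0 : 0 < v by rewrite !divr_gt0.
have [d1 /= d10 hd1] : \forall y \near x, `|h x - h y| <= v.
  by move/cvgrPdist_le : (ch x); apply.
pose d2 := Num.min d (d1 / 2); have d20 : 0 < d2 by rewrite lt_min d0 divr_gt0.
have [s cs es] : exists2 s, collection (x - d2) (x + d2) s & e < hvar h 0 s.
  apply: contrapT => ns; apply: nd; exists d2 => // s cs; rewrite leNgt; apply/negP => es.
  by apply: ns; exists s.
have sv p : p \in s -> `|h p.2 - h p.1| <= v *+ 2.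
  move=> ps; have /andP[/allP/(_ p ps)/and3P[p1 p2 p3] _] := cs.
  have d2d : d2 < d1 by rewrite gt_min; apply/orP; right; lra.
  have hv y : x - d2 <= y -> y <= x + d2 -> `|h x - h y| <= v.
    move=> y1 y2; apply: hd1; apply: le_lt_trans d2d; rewrite distrC ler_norml.
    by rewrite lerBrDl y1 lerBlDl y2.
  rewrite -(subrKA (h x)) mulr2n; apply: le_trans (ler_normD _ _) _; apply: lerD.
    by rewrite distrC; apply: hv => //; rewrite (le_trans p1)// ltW.
  by apply: hv => //; rewrite (le_trans _ p3)// ltW.
have [t [ct tx st]] := @collection_refine h h 4 _ _ s m (fun a b => b < x \/ x < a)
  (ler0n _ _) (fun a b => @interval_avoid h x a b ch) cs.
have [d' d'0 dx] := avoids_uniform tx.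
exists t, d'; split=> //.
  by apply: collectionW ct; rewrite ?lerD2l ?lerN2 ge_min lexx.
have := hvar_shift_ge m sv (mulrn_wge0 _ (ltW v0)).
have mv : m%:R * (v *+ 2) <= e / 2.
  have : v * m.+1%:R = e / 4 by rewrite /v divfK.
  have : 0 <= v by exact: ltW.
  rewrite -natr1 mulrDr mulr1 mulr2n mulrDr (mulrC v); clearbody v.
  by move: (m%:R * v); intros; lra.
by move: st es mv; move: (hvar h m t) (hvar h m s) (hvar h 0 s) (m%:R * _); intros; lra.
Qed.

Lemma small_hvar_uniform h e : hvar_bounded h -> continuous h -> 0 < e ->
  exists2 d, 0 < d & forall x s, - pi <= x <= pi ->
    collection (x - d) (x + d) s -> hvar h 0 s <= e.
Proof.
move=> hB ch e0.
have [d d0 dP] := lebesgue_number (- pi) pi (fun x => small_hvar x hB ch e0).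
exists d => // x s xp cs; have [z [d' [H zd]]] := dP x xp.
apply: H; apply: collectionW cs.
  have /zd : `|x - d - x| <= d by rewrite addrAC subrr add0r normrN ger0_norm// ltW.
  by rewrite ltr_distlC => /andP[_ ]; lra.
have /zd : `|x + d - x| <= d by rewrite addrAC subrr add0r ger0_norm// ltW.
by rewrite ltr_distlC; lra.
Qed.

End harmonic_variation.

(** * Uniform convergence of Fourier series *)

Section uniform_convergence.
Context {R : realType}.
Implicit Types (h : R -> R) (e d t u v x y M eta : R) (i k m n K P : nat).
Local Notation mu := (@lebesgue_measure R).

Definition half_csc t : R := (2 * sin (t / 2))^-1.

Definition dirichlet_kernel n t : R := 2^-1 + cos_sum (fun=> 1) n.+1 t.

Lemma dirichlet_kernel_sin n t :
  dirichlet_kernel n t * (2 * sin (t / 2)) = sin ((n%:R + 2^-1) * t).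
Proof.
rewrite /dirichlet_kernel /cos_sum; elim: n => [|n IH].
  by rewrite big_nil addr0 add0r mulrA mulVf// mul1r mulrC.
rewrite big_nat_recr//= addrA mulrDl IH mul1r.
have -> : (n%:R + 2^-1) * t = n.+1%:R * t - t / 2 by rewrite -natr1; field.
have -> : (n.+1%:R + 2^-1) * t = n.+1%:R * t + t / 2 by field.
by rewrite sinB sinD; ring.
Qed.

Lemma norm_dirichlet_kernel_le n t : `|dirichlet_kernel n t| <= n.+1%:R.
Proof.
rewrite /dirichlet_kernel; apply: le_trans (ler_normD _ _) _.
have -> : n.+1%:R = 1 + n%:R :> R by rewrite addrC natr1.
apply: lerD; first by rewrite ger0_norm// invf_le1// ler1n.
by apply: norm_weighted_sum_le => k *; [rewrite normr1|exact: norm_cos_le1].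
Qed.

Lemma continuous_dirichlet_kernel n : continuous (dirichlet_kernel n).
Proof. by move=> t; apply: cvgD; [exact: cvg_cst|exact: continuous_cos_sum]. Qed.

Lemma half_csc_le t : 0 < t <= pi -> 0 < half_csc t /\ half_csc t <= 2 / t.
Proof.
move=> /andP[t0 tp]; have s0 : 0 < sin (t / 2).
  by apply: sin_gt0_pi; rewrite divr_gt0//=; lra.
have st : t / 4 <= sin (t / 2).
  rewrite -(ler_pXn2r (n := 2)) ?nnegrE ?divr_ge0 ?(ltW t0) ?(ltW s0)//.
  have := @sqr_le_1subcos R t; rewrite (ltW t0) tp => /(_ isT).
  have -> : cos t = cos (t / 2 + t / 2) by rewrite -splitr.
  have := cos2Dsin2 (t / 2); rewrite cosD expr_div_n -!expr2.
  by move: (cos _ ^+ 2) (sin _ ^+ 2) (t ^+ 2) => a b c; lra.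
split; first by rewrite invr_gt0 mulr_gt0.
rewrite /half_csc -[2 / t]invrK invf_div lef_pV2 ?posrE ?mulr_gt0 ?divr_gt0//; lra.
Qed.

Lemma half_csc_anti t u : 0 < t -> t <= u -> u <= pi -> half_csc u <= half_csc t.
Proof.
move=> t0 tu up; have p0 := @pi_gt0 R.
have t1 : 0 < t <= pi by rewrite t0 (le_trans tu).
have u1 : 0 < u <= pi by rewrite (lt_le_trans t0).
have st y : 0 < y <= pi -> 0 < 2 * sin (y / 2).
  by move=> /half_csc_le[+ _]; rewrite invr_gt0.
rewrite /half_csc lef_pV2 ?posrE ?st// ler_pM2l//.
move: tu; rewrite le_eqVlt => /predU1P[->//|tu]; apply/ltW.
by rewrite ltr_sin ?in_itv/=; [lra|apply/andP; split; lra|apply/andP; split; lra].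
Qed.

Lemma dirichlet_kernelE n t : 0 < t <= pi ->
  dirichlet_kernel n t = sin ((n%:R + 2^-1) * t) * half_csc t.
Proof.
move=> tp; have [+ _] := half_csc_le tp; rewrite invr_gt0 => s0.
by rewrite -dirichlet_kernel_sin mulfK// gt_eqF.
Qed.

(** eta is the half-period of the numerator of the Dirichlet kernel: consecutive blocks differ by a
    sign, which allows cancellation in pairs. *)
Lemma sin_block n k u : let eta := pi / (n%:R + 2^-1) in
  sin ((n%:R + 2^-1) * (k%:R * eta + u)) = (-1) ^+ k * sin ((n%:R + 2^-1) * u) :> R.
Proof.
move=> eta; have N0 : n%:R + 2^-1 != 0 :> R by rewrite gt_eqF// ltr_wpDl// invr_gt0.
have -> : (n%:R + 2^-1) * (k%:R * eta + u) = k%:R * pi + (n%:R + 2^-1) * u.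
  by rewrite mulrDr mulrCA /eta [_ * (pi / _)]mulrC divfK.
by rewrite sinD sin_natpi cos_natpi mul0r add0r.
Qed.

Lemma Int_pairs (G : R -> R) eta P : continuous G -> 0 <= eta ->
  Int eta (P.*2.+1%:R * eta) G =
  Int 0 eta (fun u => \sum_(0 <= i < P)
    (G (i.*2.+1%:R * eta + u) + G (i.*2.+2%:R * eta + u))).
Proof.
move=> cG e0; have Gi a b : intble a b G by exact: intble_continuous.
have Gs c a b : intble a b (fun u => G (c + u)).
  apply: intble_continuous => t; apply: continuous_comp; last exact: cG.
  by apply: cvgD; [exact: cvg_cst|exact: cvg_id].
rewrite Int_sum//; last by move=> i _; exact: intbleD.
elim: P => [|P IH].
  (* The integral over the segment [eta, eta] is its own double, hence 0. *)
  rewrite big_nil mul1r; have := @Int_cat _ eta eta eta G (lexx _) (lexx _) (Gi _ _).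
  by move/eqP; rewrite addrC -subr_eq subrr => /eqP.
have b1 : eta <= P.*2.+1%:R * eta by rewrite ler_peMl// ler1n.
have b2 : P.*2.+1%:R * eta <= P.*2.+2%:R * eta by rewrite ler_wpM2r// ler_nat.
have b3 : P.*2.+2%:R * eta <= P.*2.+3%:R * eta by rewrite ler_wpM2r// ler_nat.
rewrite doubleS (@Int_cat _ (P.*2.+1%:R * eta))//; last exact: le_trans b3.
rewrite IH big_nat_recr//=; congr (_ + _).
rewrite (@Int_cat _ (P.*2.+2%:R * eta))// IntD//.
rewrite (Int_shift (Gi (_ + 0) (_ + eta))) (Int_shift (Gi (_ + 0) (_ + eta))).
have E k : k%:R * eta + eta = k.+1%:R * eta by rewrite -natr1 mulrDl mul1r.
by rewrite !addr0 !E.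
Qed.

(** K separates the pairs of blocks within distance d, where the variation of h is small, from those
    beyond, where 1 / (i + 1) <= 3 eta / d. The factor 3 accounts for the i-th pair reaching up to
    (2 i + 3) eta. *)
Lemma block_split P d eta : exists2 K, (K <= P)%N &
  (forall i, (i < K)%N -> 3 * i.+1%:R * eta <= d) /\
  (forall i, (K <= i)%N -> (i < P)%N -> 0 <= eta -> d <= 3 * i.+1%:R * eta).
Proof.
elim: P => [|P [K KP [H1 H2]]]; first by exists 0%N.
have [KltP|] := ltnP K P.
  exists K; [exact: ltnW|split=> // i Ki iP e0].
  apply: le_trans (H2 K (leqnn _) KltP e0) _.
  by rewrite ler_wpM2r// ler_wpM2l// ler_nat.
move=> PK; have {PK KP} E : K = P by apply/eqP; rewrite eqn_leq KP.
subst K; have [h|h] := leP (3 * P.+1%:R * eta) d.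
  exists P.+1 => //; split=> [i|i iP]; last by rewrite ltnNge iP.
  by rewrite ltnS leq_eqVlt => /predU1P[-> //|]; exact: H1.
exists P => //; split=> // i Pi iP e0.
by have -> : i = P by [lia]; exact: ltW.
Qed.

(** Beyond K each term is at most 3 v eta / d, and P eta <= 2. *)
Lemma harmonic_tail (y : nat -> R) K P e v d eta : 0 < d -> 0 <= v -> 0 <= eta ->
  (K <= P)%N -> P%:R * eta <= 2 -> (forall i, y i <= v) ->
  (forall i, (K <= i)%N -> (i < P)%N -> d <= 3 * i.+1%:R * eta) ->
  \sum_(0 <= i < K) y i / i.+1%:R <= e ->
  \sum_(0 <= i < P) y i / i.+1%:R <= e + 6 * (v / d).
Proof.
move=> d0 v0 e0 KP Pe yv H S; rewrite (@big_cat_nat _ _ _ K 0 P)//=; apply: lerD => //.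
apply: (@le_trans _ _ (\sum_(K <= i < P) v * (3 * eta / d))).
  apply: ler_sum_nat => i /andP[Ki iP].
  apply: (@le_trans _ _ (v / i.+1%:R)); first by rewrite ler_wpM2r.
  apply: ler_wpM2l => //; rewrite ler_pdivlMr// mulrC ler_pdivrMr//.
  by have := H i Ki iP; rewrite mulrAC.
rewrite sumr_const_nat -[leLHS]mulr_natl.
apply: (@le_trans _ _ (P%:R * (v * (3 * eta / d)))).
  by rewrite ler_wpM2r ?ler_nat ?leq_subr// !mulr_ge0// invr_ge0 ltW.
have -> : P%:R * (v * (3 * eta / d)) = (P%:R * eta) * (3 * (v / d)) by ring.
have -> : 6 * (v / d) = 2 * (3 * (v / d)) by ring.
by rewrite ler_wpM2r// mulr_ge0// divr_ge0// ltW.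
Qed.

Definition second_diff h x t : R := h (x + t) + h (x - t) - 2 * h x.

Lemma collection_blocks (l r : R) (A B : nat -> R) K :
  (forall i, (i < K)%N -> [&& l <= A i, A i < B i & B i <= r]) ->
  (forall i j, (i < j)%N -> (j < K)%N -> B i <= A j \/ B j <= A i) ->
  collection l r [seq (A i, B i) | i <- iota 0 K].
Proof.
move=> AB AB'; apply/andP; split.
  by apply/allP => _ /mapP[i + ->]; rewrite mem_iota => /andP[_ iK]; exact: AB.
rewrite pairwise_map; apply/(pairwiseP 0%N) => i j; rewrite !inE size_iota => iK jK ij.
by rewrite !nth_iota// !add0n; apply/orP; exact: AB'.
Qed.

(* The two collections are the intervals between consecutive block points to the
   right and to the left of x. *)
Lemma pair_sum_le h (w : R -> R) x u eta d e v M P :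
  0 < eta -> 0 <= u <= eta -> P.*2.+2%:R * eta <= pi -> 0 < d -> 0 <= e -> 0 <= v ->
  (forall y, `|h y| <= M) ->
  (forall y z, `|y - z| <= eta -> `|h y - h z| <= v) ->
  (forall y z, `|y - z| <= d -> `|h y - h z| <= e) ->
  (forall s, collection (x - d) (x + d) s -> hvar h 0 s <= e) ->
  (forall t, 0 < t <= pi -> 0 < w t /\ w t <= 2 / t) ->
  (forall s t, 0 < s -> s <= t -> t <= pi -> w t <= w s) ->
  \sum_(0 <= i < P) `|second_diff h x (i.*2.+1%:R * eta + u) * w (i.*2.+1%:R * eta + u) -
     second_diff h x (i.*2.+2%:R * eta + u) * w (i.*2.+2%:R * eta + u)| <=
  2 / eta * (4 * e + 12 * (v / d) + 12 * (M * eta / d)).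
Proof.
move=> eta0 /andP[u0 ue] Pp d0 e0 v0 hM hv he V wP wA.
have etage0 := ltW eta0; have p4 : pi < 4 :> R by have := @pihalf_lt2 R; lra.
pose a i : R := i.*2.+1%:R * eta + u; pose b i : R := i.*2.+2%:R * eta + u.
have ab i : b i = a i + eta by rewrite /b -natr1 mulrDl mul1r addrAC.
have ba i : b i <= a i.+1 by rewrite lerD2r ler_wpM2r// ler_nat doubleS.
have abi i : a i < b i by rewrite ab ltrDl.
have bij i j : (i < j)%N -> b i <= a j.
  by move=> ij; rewrite lerD2r ler_wpM2r// ler_nat -!addnn; clear -ij; lia.
have a0 i : 0 < a i by rewrite ltr_wpDr// mulr_gt0.
have ap i : (i <= P)%N -> a i <= pi.
  move=> iP; apply: le_trans Pp; apply: (@le_trans _ _ (i.*2.+1%:R * eta + eta)).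
    by rewrite lerD2l.
  rewrite -{2}(mul1r eta) -mulrDl natr1 ler_wpM2r// ler_nat !ltnS leq_double//.
have bp i : (i < P)%N -> b i <= pi by move=> iP; apply: le_trans (ba i) (ap _ iP).
have b0 i : 0 < b i by rewrite ab addr_gt0.
have wa i : (i <= P)%N -> w (a i) <= 2 / eta / i.+1%:R.
  move=> iP; have [_ H] := wP (a i) (introT andP (conj (a0 i) (ap i iP))).
  apply: le_trans H _; rewrite -mulrA -invfM ler_pM2l// lef_pV2 ?posrE ?mulr_gt0//.
  rewrite mulrC (@le_trans _ _ (i.*2.+1%:R * eta))//; last by rewrite lerDl.
  by rewrite ler_wpM2r// ler_nat -addnn; clear; lia.
have w0 i : (i <= P)%N -> 0 <= w (a i).
  by move=> iP; have [/ltW] := wP (a i) (introT andP (conj (a0 i) (ap i iP))).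
have wab i : (i < P)%N -> w (b i) <= w (a i).
  by move=> iP; apply: wA; rewrite ?bp// ab lerDl.
have Pe : P%:R * eta <= 2.
  have : P.*2.+2%:R * eta = 2 * (P%:R * eta) + 2 * eta.
    by rewrite -muln2 -addn2 natrD natrM; ring.
  by move: Pp p4; move: (P.*2.+2%:R * _) (P%:R * _) (pi : R); intros; lra.
have [K KP [KL KR]] := block_split P d eta.
have KR' i : (K <= i)%N -> (i < P)%N -> d <= 3 * i.+1%:R * eta by move=> ? ?; exact: KR.
have bd i : (i < K)%N -> b i <= d.
  move=> iK; apply: le_trans (KL i iK); apply: (@le_trans _ _ (i.*2.+2%:R * eta + eta)).
    by rewrite lerD2l.
  rewrite -{2}(mul1r eta) -mulrDl natr1 ler_wpM2r// -natrM ler_nat -addnn; clear; lia.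
have tail (y : nat -> R) := @harmonic_tail y K P e v d eta d0 v0 etage0 KP Pe.
have S1 : \sum_(0 <= i < P) `|h (x + b i) - h (x + a i)| / i.+1%:R <= e + 6 * (v / d).
  apply: tail => //.
    move=> i; apply: hv; rewrite ab.
    have -> : x + (a i + eta) - (x + a i) = eta by ring.
    by rewrite ger0_norm.
  have := hvar_map h 0 (fun i => x + a i) (fun i => x + b i) K => /= <-.
  apply: V; apply: collection_blocks => [i iK|i j ij jK].
    have xd : x - d <= x by rewrite gerBl ltW.
    by rewrite (le_trans xd) ?lerDl ?(ltW (a0 i))//= !ltrD2l abi/= lerD2l bd.
  by left; rewrite lerD2l bij.
have S2 : \sum_(0 <= i < P) `|h (x - b i) - h (x - a i)| / i.+1%:R <= e + 6 * (v / d).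
  apply: tail => //.
    move=> i; apply: hv; rewrite ab.
    have -> : x - (a i + eta) - (x - a i) = - eta by ring.
    by rewrite normrN ger0_norm.
  under eq_bigr do rewrite distrC.
  have := hvar_map h 0 (fun i => x - b i) (fun i => x - a i) K => /= <-.
  apply: V; apply: collection_blocks => [i iK|i j ij jK].
    have xd : x <= x + d by rewrite lerDl ltW.
    by rewrite lerD2l lerN2 bd//= ltrD2l ltrN2 abi/= (le_trans _ xd)// gerBl ltW.
  by right; rewrite lerD2l lerN2 bij.
pose p i := second_diff h x (a i); pose q i := second_diff h x (b i).
have pq i : `|q i - p i| <= `|h (x + b i) - h (x + a i)| + `|h (x - b i) - h (x - a i)|.
  have -> : q i - p i = (h (x + b i) - h (x + a i)) + (h (x - b i) - h (x - a i)).
    by rewrite /p /q /second_diff; ring.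
  exact: ler_normD.
have q1 i : `|q i| <= `|h (x + b i) - h x| + `|h (x - b i) - h x|.
  have -> : q i = (h (x + b i) - h x) + (h (x - b i) - h x).
    by rewrite /q /second_diff; ring.
  exact: ler_normD.
have qe i : (i < K)%N -> `|q i| <= 2 * e.
  move=> /bd bid; apply: le_trans (q1 i) _; rewrite mulrDl !mul1r; apply: lerD; apply: he.
    by rewrite addrAC subrr add0r ger0_norm// ltW.
  by rewrite addrAC subrr add0r normrN ger0_norm// ltW.
have qM i : `|q i| <= 4 * M.
  apply: le_trans (q1 i) _; have := ler_normB (h (x + b i)) (h x).
  have := ler_normB (h (x - b i)) (h x); have := hM (x + b i); have := hM (x - b i).
  have := hM x; move: `|_ - _| `|_ - h x| `|h (x + _)| `|h (x - _)| `|_|; intros; lra.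
have M0 : 0 <= M by exact: le_trans (normr_ge0 _) (hM 0).
have tele k : (k <= P)%N -> \sum_(k <= i < P) (w (a i) - w (b i)) <= w (a k).
  move=> kP; apply: (@le_trans _ _ (\sum_(k <= i < P) (w (a i) - w (a i.+1)))).
    apply: ler_sum_nat => i /andP[_ iP]; rewrite lerB//; apply: wA; rewrite ?ap//.
  under eq_bigr do rewrite -opprB.
  by rewrite sumrN telescope_sumr// opprB gerBl w0.
have teleK k : (k <= P)%N -> \sum_(0 <= i < k) (w (a i) - w (b i)) <= w (a 0%N).
  move=> kP; apply: le_trans (tele 0%N isT); rewrite [leRHS](@big_cat_nat _ _ _ k)//=.
  rewrite lerDl big_nat_cond sumr_ge0// => i /andP[/andP[_ iP] _].
  by rewrite subr_ge0 wab.
(* An Abel-type splitting. The increments of h come with w <= 2 / (eta (i + 1)), which produces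
   harmonic sums; the increments of w are nonnegative, so they telescope. *)
have term i : (i < P)%N -> `|p i * w (a i) - q i * w (b i)| <=
    2 / eta * (`|h (x + b i) - h (x + a i)| / i.+1%:R + `|h (x - b i) - h (x - a i)| / i.+1%:R)
    + `|q i| * (w (a i) - w (b i)).
  move=> iP; have -> : p i * w (a i) - q i * w (b i) =
      - (q i - p i) * w (a i) + q i * (w (a i) - w (b i)) by ring.
  apply: le_trans (ler_normD _ _) _; rewrite !normrM normrN; apply: lerD; last first.
    by rewrite [X in _ * X <= _]ger0_norm// subr_ge0 wab.
  rewrite -mulrDl mulrCA; apply: ler_pM => //.
  by rewrite ger0_norm ?w0 ?wa// ltnW.
(* Before K, |q i| <= 2 e and the sum telescopes to at most w (a 0). From K on, |q i| <= 4 M and it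
   telescopes to at most w (a K), where 1 / (K + 1) <= 3 eta / d. *)
have Q : \sum_(0 <= i < P) `|q i| * (w (a i) - w (b i)) <=
    2 / eta * (2 * e + 12 * (M * eta / d)).
  rewrite (@big_cat_nat _ _ _ K 0 P)//= mulrDr; apply: lerD.
    apply: (@le_trans _ _ (2 * e * \sum_(0 <= i < K) (w (a i) - w (b i)))).
      rewrite mulr_sumr; apply: ler_sum_nat => i /andP[_ iK]; apply: ler_wpM2r; last exact: qe.
      by rewrite subr_ge0 wab// (leq_trans iK).
    rewrite mulrC ler_wpM2r ?mulr_ge0//.
    by apply: le_trans (teleK _ KP) _; apply: le_trans (wa 0%N _) _ => //; rewrite divr1.
  apply: (@le_trans _ _ (4 * M * \sum_(K <= i < P) (w (a i) - w (b i)))).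
    rewrite mulr_sumr; apply: ler_sum_nat => i /andP[_ iP]; apply: ler_wpM2r => //.
    by rewrite subr_ge0 wab.
  have [PK|KltP] := leqP P K.
    rewrite big_geq// mulr0; apply: mulr_ge0; first by rewrite divr_ge0.
    by rewrite mulr_ge0// divr_ge0 ?mulr_ge0// ltW.
  apply: (@le_trans _ _ (4 * M * (2 / eta / K.+1%:R))).
    by rewrite ler_wpM2l ?mulr_ge0// (le_trans (tele _ KP))// wa.
  have -> : 4 * M * (2 / eta / K.+1%:R) = 2 / eta * (4 * M / K.+1%:R) by ring.
  rewrite ler_wpM2l ?divr_ge0// ler_pdivrMr//.
  have E : 1 <= 3 * K.+1%:R * eta / d by rewrite ler_pdivlMr// mul1r KR'.
  have -> : 12 * (M * eta / d) * K.+1%:R = 4 * M * (3 * K.+1%:R * eta / d) by ring.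
  by rewrite ler_peMr// mulr_ge0.
apply: (@le_trans _ _ (\sum_(0 <= i < P) (2 / eta *
  (`|h (x + b i) - h (x + a i)| / i.+1%:R + `|h (x - b i) - h (x - a i)| / i.+1%:R)
    + `|q i| * (w (a i) - w (b i))))).
  by apply: ler_sum_nat => i /andP[_ iP]; exact: term.
rewrite big_split/= -mulr_sumr big_split/=.
apply: (@le_trans _ _ (2 / eta * ((e + 6 * (v / d)) + (e + 6 * (v / d))) +
   2 / eta * (2 * e + 12 * (M * eta / d)))).
  apply: lerD => //; apply: ler_wpM2l; first by rewrite divr_ge0.
  exact: lerD.
by rewrite le_eqVlt; apply/orP; left; apply/eqP; ring.
Qed.

Lemma fourier_sum_sub h n x : periodic h (pi *+ 2) -> continuous h ->
  fourier_sum h n x - h x =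
  pi^-1 * Int 0 pi (fun t => second_diff h x t * dirichlet_kernel n t).
Proof.
move=> hT ch; have h1 := L1_continuous hT ch; have p0 := @pi_gt0 R.
have -> : fourier_sum h n x = fourier_cos h 0 / 2 + \sum_(1 <= k < n.+1) 1 * harm h k x.
  by rewrite /fourier_sum; congr (_ + _); apply: eq_bigr => k _; rewrite mul1r.
rewrite even_sumE//.
have E : h x = pi^-1 * Int 0 pi (fun t => 2 * h x * dirichlet_kernel n t).
  rewrite IntZ; last exact/intble_continuous/continuous_dirichlet_kernel.
  have -> : Int 0 pi (dirichlet_kernel n) = pi / 2 by exact: Int_cos_kernel.
  have cancel (p y : R) : p != 0 -> y = p^-1 * (2 * y * (p / 2)) by move=> ?; field.
  by apply: cancel; rewrite gt_eqF.
rewrite [X in _ - X]E -mulrBr -IntB; last 2 first.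
- apply: intble_continuous => t; apply: cvgM; last exact: continuous_dirichlet_kernel.
  apply: cvgD; (apply: continuous_comp; last exact: ch).
    by apply: cvgD; [exact: cvg_cst|exact: cvg_id].
  by apply: cvgB; [exact: cvg_cst|exact: cvg_id].
- by apply/intbleZ/intble_continuous; exact: continuous_dirichlet_kernel.
by congr (_ * Int _ _ _); apply/funext => t; rewrite -mulrBl.
Qed.

Lemma continuous_second_diff h x : continuous h -> continuous (second_diff h x).
Proof.
move=> ch t; apply: cvgB; last exact: cvg_cst.
apply: cvgD; (apply: continuous_comp; last exact: ch).
  by apply: cvgD; [exact: cvg_cst|exact: cvg_id].
by apply: cvgB; [exact: cvg_cst|exact: cvg_id].
Qed.

Lemma norm_second_diff_le h x t v : (forall y, `|y - x| <= `|t| -> `|h y - h x| <= v) ->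
  `|second_diff h x t| <= 2 * v.
Proof.
move=> H; have -> : second_diff h x t = (h (x + t) - h x) + (h (x - t) - h x).
  by rewrite /second_diff; ring.
rewrite mulrDl mul1r; apply: le_trans (ler_normD _ _) _; apply: lerD; apply: H.
  by rewrite addrAC subrr add0r.
by rewrite addrAC subrr add0r normrN.
Qed.

Lemma Int_norm_le (a b c : R) (G : R -> R) : a <= b -> intble a b G ->
  (forall t, a <= t <= b -> `|G t| <= c) -> `|Int a b G| <= c * (b - a).
Proof.
by move=> ab Gi Gc; rewrite -Int_cst//; apply: le_norm_Int2 => //; exact: intble_cst.
Qed.

(** [0, pi] is cut into the block [0, eta], pairs of blocks, and a remainder of length at most 5 eta
    / 2. On the first the kernel is at most n + 1 and (n + 1) eta <= 8, whence 16 v; the remainder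
    lies in t >= 1, where the kernel is at most 2, whence 20 M eta; [pair_sum_le] gives the middle
    term. *)
Lemma fourier_sum_sub_le h x n d e v M : periodic h (pi *+ 2) -> continuous h ->
  let eta := pi / (n%:R + 2^-1) in (1 < n)%N -> 5 / 2 * eta <= 1 ->
  0 < d -> 0 <= e -> 0 <= v ->
  (forall y, `|h y| <= M) ->
  (forall y z, `|y - z| <= eta -> `|h y - h z| <= v) ->
  (forall y z, `|y - z| <= d -> `|h y - h z| <= e) ->
  (forall s, collection (x - d) (x + d) s -> hvar h 0 s <= e) ->
  `|fourier_sum h n x - h x| <=
    16 * v + 2 * (4 * e + 12 * (v / d) + 12 * (M * eta / d)) + 20 * (M * eta).
Proof.
move=> hT ch eta n1 eta1 d0 e0 v0 hM hv he V.
have p0 := @pi_gt0 R; have p2 := @pi_ge2 R; have p4 : pi < 4 :> R.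
  by have := @pihalf_lt2 R; lra.
have N0 : 0 < n%:R + 2^-1 :> R by rewrite ltr_wpDl// invr_gt0.
have eta0 : 0 < eta by rewrite divr_gt0.
have NE : (n%:R + 2^-1) * eta = pi by rewrite mulrC divfK// gt_eqF.
have M0 : 0 <= M by exact: le_trans (normr_ge0 _) (hM 0).
(* The largest P with 2 P + 2 <= n, so that at most five half blocks are left over before pi = (n +
   1 / 2) eta. *)
pose P := n./2.-1.
have nP : (P.*2.+2 <= n)%N by rewrite /P; clear -n1; lia.
have Pn : (n <= P.*2.+3)%N by rewrite /P; clear -n1; lia.
have Pp : P.*2.+2%:R * eta <= pi.
  rewrite -NE ler_pM2r// (@le_trans _ _ n%:R) ?ler_nat// lerDl invr_ge0//.
have Pp1 : P.*2.+1%:R * eta <= pi.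
  by apply: le_trans Pp; rewrite ler_pM2r// ler_nat.
have eP : eta <= P.*2.+1%:R * eta by rewrite ler_peMl ?ler1n// ltW.
have rest : pi - P.*2.+1%:R * eta <= 5 / 2 * eta.
  rewrite -NE -mulrBl ler_pM2r//.
  have : n%:R <= P.*2.+3%:R :> R by rewrite ler_nat.
  rewrite -(natr1 P.*2.+2) -(natr1 P.*2.+1); lra.
pose G t := second_diff h x t * dirichlet_kernel n t.
have cG : continuous G.
  by move=> t; apply: cvgM; [exact: continuous_second_diff|exact: continuous_dirichlet_kernel].
have Gi a b : intble a b G by exact: intble_continuous.
have bound2 t : `|second_diff h x t| <= 4 * M.
  have -> : 4 * M = 2 * (M + M) by ring.
  apply: norm_second_diff_le => y _; apply: le_trans (ler_normB _ _) _; exact: lerD.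
rewrite fourier_sum_sub// normrM gtr0_norm ?invr_gt0//.
rewrite -(@ler_pM2l _ pi)// mulrA mulfV ?gt_eqF// mul1r.
apply: (@le_trans _ _ (16 * v + 2 * (4 * e + 12 * (v / d) + 12 * (M * eta / d)) +
  20 * (M * eta))); last first.
  rewrite ler_peMl//; last by lra.
  have : 0 <= M * eta by rewrite mulr_ge0// ltW.
  have : 0 <= M * eta / d by rewrite divr_ge0 ?mulr_ge0// ltW.
  have : 0 <= v / d by rewrite divr_ge0// ltW.
  by move: e0 v0; move: (v / d) (M * eta / d) (M * eta); clear; intros; lra.
rewrite -/G (@Int_cat _ eta)//; [|exact: ltW|exact: le_trans Pp1].
rewrite (@Int_cat _ (P.*2.+1%:R * eta) eta)// addrA.
apply: le_trans (ler_normD _ _) _; apply: lerD.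
  apply: le_trans (ler_normD _ _) _; apply: lerD.
    apply: le_trans (@Int_norm_le 0 eta (2 * v * n.+1%:R) G _ _ _) _ => //; first exact: ltW.
      move=> t /andP[t0 te]; rewrite normrM; apply: ler_pM => //.
        apply: norm_second_diff_le => y; rewrite (ger0_norm t0) => yt.
        by apply: hv; exact: le_trans yt te.
      exact: norm_dirichlet_kernel_le.
    rewrite subr0 -!mulrA mulrCA.
    have : n.+1%:R * eta <= 8.
      apply: (@le_trans _ _ (2 * ((n%:R + 2^-1) * eta))); last by rewrite NE; lra.
      by rewrite mulrA ler_pM2r// -natr1 mulrDr; have : 0 <= n%:R :> R by []; lra.
    have := v0; rewrite mulrCA; move: (n.+1%:R * eta) => y v0' y8.
    have : v * y <= v * 8 by rewrite ler_wpM2l.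
    lra.
  rewrite Int_pairs//; last exact: ltW.
  have -> : 2 * (4 * e + 12 * (v / d) + 12 * (M * eta / d)) =
      2 / eta * (4 * e + 12 * (v / d) + 12 * (M * eta / d)) * (eta - 0).
    have cancel (p y : R) : p != 0 -> 2 * y = 2 / p * y * (p - 0) by move=> ?; field.
    by apply: cancel; rewrite gt_eqF.
  apply: Int_norm_le; first exact: ltW.
    apply: intble_continuous; apply: continuous_bigsum => i t.
    apply: cvgD; (apply: continuous_comp; last exact: cG);
      by apply: cvgD; [exact: cvg_cst|exact: cvg_id].
  move=> u ue; apply: le_trans (ler_norm_sum _ _ _) _.
  apply: le_trans (@pair_sum_le h half_csc x u eta d e v M P _ _ _ _ _ _ _ _ _ _ _ _) => //;
    last 2 first.
  - exact: half_csc_le.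
  - by move=> s t; exact: half_csc_anti.
  apply: ler_sum_nat => i /andP[_ iP].
  have [u0 ue'] := andP ue.
  have ai : 0 < i.*2.+1%:R * eta + u <= pi.
    rewrite ltr_wpDr ?mulr_gt0//=; apply: le_trans Pp.
    apply: (@le_trans _ _ (i.*2.+1%:R * eta + eta)); first by rewrite lerD2l.
    by rewrite -{2}(mul1r eta) -mulrDl natr1 ler_pM2r// ler_nat -!addnn; clear -iP; lia.
  have bi : 0 < i.*2.+2%:R * eta + u <= pi.
    rewrite ltr_wpDr ?mulr_gt0//=; apply: le_trans Pp.
    apply: (@le_trans _ _ (i.*2.+2%:R * eta + eta)); first by rewrite lerD2l.
    by rewrite -{2}(mul1r eta) -mulrDl natr1 ler_pM2r// ler_nat -!addnn; clear -iP; lia.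
  rewrite /G (dirichlet_kernelE n ai) (dirichlet_kernelE n bi) !sin_block.
  rewrite -(signr_odd _ i.*2.+1) -(signr_odd _ i.*2.+2) /= odd_double /= expr0 expr1.
  set S := sin _; set A := second_diff _ _ _; set B := second_diff _ _ _.
  set a := half_csc _; set b := half_csc _.
  have -> : A * (- (1) * S * a) + B * (1 * S * b) = - S * (A * a - B * b) by ring.
  by rewrite normrM normrN ler_piMl// norm_sin_le1.
apply: le_trans (@Int_norm_le (P.*2.+1%:R * eta) pi (4 * M * 2) G _ _ _) _ => //.
  move=> t /andP[t1 tp]; rewrite normrM; apply: ler_pM => //.
  have t1' : 1 <= t by apply: le_trans t1; lra.
  have t0 : 0 < t <= pi by rewrite (lt_le_trans ltr01).
  rewrite dirichlet_kernelE// normrM -[2]mul1r; apply: ler_pM => //; first exact: norm_sin_le1.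
  have [w0 w2] := half_csc_le t0; rewrite gtr0_norm// (le_trans w2)//.
  by rewrite ler_pdivrMr ?ler_peMr//; case/andP: t0.
apply: (@le_trans _ _ (4 * M * 2 * (5 / 2 * eta))); first by rewrite ler_wpM2l// !mulr_ge0.
by rewrite le_eqVlt; apply/orP; left; apply/eqP; field.
Qed.

Lemma periodic_fourier_sum h n : periodic (fourier_sum h n) (pi *+ 2).
Proof.
move=> x; congr (_ + _); apply: eq_bigr => k _.
by rewrite (cosM_periodic k x) (sinM_periodic k x).
Qed.

Lemma reduce_to_period (A B : R -> R) e : periodic A (pi *+ 2) -> periodic B (pi *+ 2) ->
  (forall x, - pi <= x <= pi -> `|A x - B x| <= e) -> forall x, `|A x - B x| <= e.
Proof.
move=> AT BT H x; have [k /H] := period_reduce x.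
by rewrite (periodicz AT) (periodicz BT).
Qed.

Lemma fourier_sum_unif h : periodic h (pi *+ 2) -> continuous h -> hvar_bounded h ->
  {uniform, fourier_sum h @ \oo --> h}.
Proof.
move=> hT ch hB; apply/cvg_uniformP => e e0; have p0 := @pi_gt0 R.
have e32 : 0 < e / 32 by rewrite divr_gt0.
have [d1 d10 V] := small_hvar_uniform hB ch e32.
have [d2 d20 hd2] := periodic_unif_continuous hT ch e32.
pose d := Num.min d1 d2; have d0 : 0 < d by rewrite lt_min d10.
have dd1 : d <= d1 by rewrite ge_min lexx.
have dd2 : d <= d2 by rewrite ge_min lexx orbT.
have [M M0 hM] := periodic_bounded hT ch.
(* v is small relative to d, which is already fixed; eta will then be small relative to d, M and the
   modulus of continuity for v. The five terms of [fourier_sum_sub_le] amount to at most 3 e / 4. *)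
pose v := Num.min (e / 128) (e * d / 192).
have v0 : 0 < v by rewrite lt_min !divr_gt0// mulr_gt0.
have v1 : v <= e / 128 by rewrite ge_min lexx.
have v2 : v / d <= e / 192.
  by rewrite ler_pdivrMr// mulrAC ge_min lexx orbT.
have [d3 d30 hd3] := periodic_unif_continuous hT ch v0.
pose c := Num.min (Num.min d3 (2 / 5)) (Num.min (e / 160 / (M + 1)) (e * d / 192 / (M + 1))).
have M1 : 0 < M + 1 by rewrite ltr_wpDl.
have c0 : 0 < c by rewrite !lt_min d30 !divr_gt0// mulr_gt0.
have [N HN] : exists N, pi / c <= N%:R.
  by exists (Num.bound (pi / c)); apply/ltW/archi_boundP; rewrite divr_ge0 ?ltW.
exists (maxn N 2) => n; rewrite geq_max => /andP[Nn n2].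
pose eta : R := pi / (n%:R + 2^-1).
have N0 : 0 < n%:R + 2^-1 :> R by rewrite ltr_wpDl// invr_gt0.
have eta0 : 0 < eta by rewrite divr_gt0.
have etac : eta <= c.
  rewrite ler_pdivrMr// mulrC -ler_pdivrMr//; apply: le_trans HN _.
  by rewrite (@le_trans _ _ n%:R) ?ler_nat// lerDl invr_ge0.
have etad3 : eta <= d3 by apply: le_trans etac _; rewrite !ge_min lexx.
have eta25 : eta <= 2 / 5 by apply: le_trans etac _; rewrite !ge_min lexx !orbT.
have etaM1 : M * eta <= e / 160.
  apply: (@le_trans _ _ (eta * (M + 1))); first by rewrite mulrC ler_wpM2l ?(ltW eta0)// lerDl.
  by rewrite -ler_pdivlMr//; apply: le_trans etac _; rewrite !ge_min lexx !orbT.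
have etaM2 : M * eta / d <= e / 192.
  rewrite ler_pdivrMr// mulrAC.
  apply: (@le_trans _ _ (eta * (M + 1))); first by rewrite mulrC ler_wpM2l ?(ltW eta0)// lerDl.
  by rewrite -ler_pdivlMr//; apply: le_trans etac _; rewrite !ge_min lexx !orbT.
apply: reduce_to_period => //; first exact: periodic_fourier_sum.
move=> x xp; apply: (@le_trans _ _ (16 * v + 2 * (4 * (e / 32) + 12 * (v / d) +
    12 * (M * eta / d)) + 20 * (M * eta))).
  apply: (fourier_sum_sub_le hT ch n2 _ d0 (ltW e32) (ltW v0) hM) => //.
  - by rewrite -/eta; move: eta25; clear; lra.
  - by move=> y z yz; apply: hd3; exact: le_trans yz etad3.
  - by move=> y z yz; apply: hd2; exact: le_trans yz dd2.
  - move=> s cs; apply: V xp _; apply: collectionW cs; first by rewrite lerD2l lerN2.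
    by rewrite lerD2l.
move: e0 v1 v2 etaM1 etaM2; move: (v / d) (M * eta / d) (M * eta); clearbody v.
by clear; intros; lra.
Qed.

(** * Bernstein's inequality and the conjugate series *)

Lemma Int_sin_sin k m : (0 < k)%N -> (0 < m)%N ->
  Int 0 pi (fun t => sin (k%:R * t) * sin (m%:R * t)) = (k == m)%:R * (pi / 2) :> R.
Proof.
move=> k0 m0; wlog km : k m k0 m0 / (m <= k)%N => [H|].
  have [/H|/ltnW/H] := leqP m k; first exact.
  by rewrite eq_sym => <-//; congr (Int _ _ _); apply/funext => t; rewrite mulrC.
have E t : sin (k%:R * t) * sin (m%:R * t) =
    2^-1 * (cos ((k - m)%:R * t) - cos ((k + m)%:R * t)).
  by rewrite natrB// natrD mulrBl mulrDl cosB cosD; field.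
under [X in Int _ _ X]eq_fun do rewrite E.
have Ic j : intble 0 pi (fun t => cos (j%:R * t)) by exact/intble_continuous/continuous_cosM.
rewrite IntZ; last exact: intbleB.
rewrite IntB// (Int_cosM (k := k + m)) ?addn_gt0 ?k0// subr0.
have [->|km'] := eqVneq k m.
  rewrite subnn; under [X in Int _ _ X]eq_fun do rewrite mul0r cos0.
  by rewrite Int_cst ?pi_ge0// subr0 !mul1r mulrC.
by rewrite Int_cosM ?mulr0 ?mul0r// subn_gt0 ltn_neqAle eq_sym km'.
Qed.

(** Multiplication by 2 sin ((n + 1) t) centres the Fejer weights at the frequency n + 1, so that k
    = n + 1 - j receives 1 - j / (n + 1) = k / (n + 1). *)
Lemma Int_sin_bernstein_kernel k n : (0 < k)%N -> (k <= n.+1)%N ->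
  Int 0 pi (fun t => sin (k%:R * t) * (2 * sin (n.+1%:R * t) * fejer_kernel n t)) =
  pi / 2 * (k%:R / n.+1%:R).
Proof.
move=> k0 kn.
have E t : sin (k%:R * t) * (2 * sin (n.+1%:R * t) * fejer_kernel n t) =
    sin (k%:R * t) * sin (n.+1%:R * t) + \sum_(1 <= j < n.+1) fejer_weight n j *
     (sin (k%:R * t) * sin ((n.+1 + j)%:R * t) + sin (k%:R * t) * sin ((n.+1 - j)%:R * t)).
  rewrite /fejer_kernel /cos_sum mulrDr mulrDr; congr (_ + _); first by field.
  rewrite mulr_sumr mulr_sumr; apply: eq_big_nat => j /andP[_ jn].
  have -> : (n.+1 + j)%:R * t = n.+1%:R * t + j%:R * t by rewrite natrD mulrDl.
  have -> : (n.+1 - j)%:R * t = n.+1%:R * t - j%:R * t by rewrite natrB ?mulrBl// ltnW.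
  by rewrite sinB sinD; ring.
under [X in Int _ _ X]eq_fun do rewrite E.
have Is m : intble 0 pi (fun t => sin (k%:R * t) * sin (m%:R * t)).
  by apply: intble_continuous => t; apply: cvgM; exact: continuous_sinM.
rewrite IntD//; last by apply: intble_sum => j _; apply: intbleZ; exact: intbleD.
rewrite Int_sum ?pi_ge0//; last by move=> j _; apply: intbleZ; exact: intbleD.
rewrite Int_sin_sin//.
have S j : (1 <= j < n.+1)%N -> Int 0 pi (fun t => fejer_weight n j *
     (sin (k%:R * t) * sin ((n.+1 + j)%:R * t) + sin (k%:R * t) * sin ((n.+1 - j)%:R * t)))
    = if j == (n.+1 - k)%N then k%:R / n.+1%:R * (pi / 2) else 0.
  move=> /andP[j0 jn]; rewrite IntZ; last exact: intbleD.
  rewrite IntD// !Int_sin_sin ?addn_gt0 ?subn_gt0//.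
  have -> : (k == n.+1 + j)%N = false by apply/eqP; clear -kn j0; lia.
  have -> : (k == n.+1 - j)%N = (j == n.+1 - k)%N by apply/eqP/eqP; clear -kn jn; lia.
  case: eqP => [jE|_]; last by rewrite !mul0r addr0 mulr0.
  rewrite mul0r add0r mul1r /fejer_weight jE natrB//; congr (_ * _).
  have : n.+1%:R != 0 :> R by rewrite pnatr_eq0.
  by move: (n.+1%:R : R) => N N0; field.
rewrite (eq_big_nat _ _ S) -big_mkcond/=.
(* The frequency n + 1 comes from the constant 1 / 2 of the kernel, every smaller one from a single
   j >= 1. *)
have [->|kn'] := eqVneq k n.+1.
  rewrite subnn big1_seq ?addr0 ?mulfV ?pnatr_eq0// ?mul1r ?mulr1//.
  by move=> j /andP[/eqP ->]; rewrite mem_index_iota.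
rewrite mul0r add0r big_nat1_eq; have -> : (1 <= n.+1 - k < n.+1)%N.
  by clear -kn kn' k0; lia.
by rewrite mulrC.
Qed.

(* Bernstein's inequality, as convolution with 2 sin((n+1) t) K_n(t), whose sine
   coefficients are k/(n+1) for k <= n+1. *)
Lemma bernstein h m n x B : (forall y, `|\sum_(m.+1 <= k < n.+2) harm h k y| <= B) ->
  `|\sum_(m.+1 <= k < n.+2) k%:R * conj_harm h k x| <= 2 * n.+1%:R * B.
Proof.
move=> TB; pose T y := \sum_(m.+1 <= k < n.+2) harm h k y.
pose L t : R := 2 * sin (n.+1%:R * t) * fejer_kernel n t.
have cL : continuous L.
  move=> t; apply: cvgM; last exact: continuous_fejer_kernel.
  by apply: cvgM; [exact: cvg_cst|exact: continuous_sinM].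
have TE t : T (x + t) - T (x - t) = \sum_(m.+1 <= k < n.+2)
    - 2 * conj_harm h k x * sin (k%:R * t).
  rewrite /T -sumrB; apply: eq_bigr => k _.
  by rewrite /harm /conj_harm mulrDr mulrBr cosD cosB sinD sinB; ring.
have E : Int 0 pi (fun t => (T (x + t) - T (x - t)) * L t) =
    - pi / n.+1%:R * \sum_(m.+1 <= k < n.+2) k%:R * conj_harm h k x.
  have F t : (T (x + t) - T (x - t)) * L t = \sum_(m.+1 <= k < n.+2)
      - 2 * conj_harm h k x * (sin (k%:R * t) * L t).
    by rewrite TE mulr_suml; apply: eq_bigr => k _; exact/esym/mulrA.
  under [X in Int _ _ X]eq_fun do rewrite F.
  have I k : intble 0 pi (fun t => sin (k%:R * t) * L t).
    by apply: intble_continuous => t; apply: cvgM; [exact: continuous_sinM|exact: cL].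
  rewrite Int_sum ?pi_ge0//; last by move=> k _; exact: intbleZ.
  rewrite mulr_sumr; apply: eq_big_nat => k /andP[mk kn].
  rewrite IntZ// Int_sin_bernstein_kernel ?(leq_trans _ mk)//.
  have : n.+1%:R != 0 :> R by rewrite pnatr_eq0.
  by move: (n.+1%:R : R) => N N0; field.
have B0 : 0 <= B by exact: le_trans (normr_ge0 _) (TB 0).
have cT : continuous T by apply: continuous_bigsum => k; exact: continuous_harm.
have HI : `|Int 0 pi (fun t => (T (x + t) - T (x - t)) * L t)| <= 2 * B * (2 * (pi / 2)).
  rewrite -(Int_fejer_kernel n) -IntZ; last exact/intble_continuous/continuous_fejer_kernel.
  rewrite -IntZ; last by apply: intbleZ; exact/intble_continuous/continuous_fejer_kernel.
  apply: le_norm_Int2.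
  - apply: intble_continuous => t; apply: cvgM; last exact: cL.
    apply: cvgB; (apply: continuous_comp; last exact: cT).
      by apply: cvgD; [exact: cvg_cst|exact: cvg_id].
    by apply: cvgB; [exact: cvg_cst|exact: cvg_id].
  - by do 2 apply: intbleZ; exact/intble_continuous/continuous_fejer_kernel.
  move=> t tp; rewrite normrM; apply: ler_pM => //.
    by rewrite mulrDl mul1r; apply: le_trans (ler_normB _ _) _; apply: lerD; exact: TB.
  rewrite /L !normrM (ger0_norm (fejer_kernel_ge0 n tp)) ger0_norm//.
  by rewrite ler_wpM2r ?fejer_kernel_ge0// ler_piMr// norm_sin_le1.
have p0 := @pi_gt0 R; move: HI.
rewrite E !mulNr normrN normrM [X in X * _ <= _]gtr0_norm ?divr_gt0//.
set S := `|_ |%R => HI; have : S = n.+1%:R / pi * (pi / n.+1%:R * S).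
  have cancel (N p y : R) : N != 0 -> p != 0 -> y = N / p * (p / N * y).
    by move=> ? ?; field; apply/andP.
  by apply: cancel; rewrite ?pnatr_eq0// gt_eqF.
move=> ->; apply: (@le_trans _ _ (n.+1%:R / pi * (2 * B * (2 * (pi / 2))))).
  by rewrite ler_wpM2l// divr_ge0// ltW.
have cancel (N p y : R) : p != 0 -> N / p * (2 * y * (2 * (p / 2))) = 2 * N * y.
  by move=> ?; field.
by rewrite cancel// gt_eqF.
Qed.

(** The partial sum of g minus its Fejer mean is, up to sign, the derivative of the partial sum of h
    divided by n + 1. [bernstein] is applied only to the harmonics from m + 1 to n, whose sum is
    uniformly at most e / 16; the first m harmonics contribute at most a constant, negligible after
    the division. *)
Lemma fourier_sum_unif_conj h g : periodic g (pi *+ 2) -> continuous g ->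
  {uniform, fourier_sum h @ \oo --> h} ->
  (forall k x, (0 < k)%N -> harm g k x = conj_harm h k x) ->
  {uniform, fourier_sum g @ \oo --> g}.
Proof.
move=> gT cg /cvg_uniformP hu gh; apply/cvg_uniformP => e e0.
have e2 : 0 < e / 2 by rewrite divr_gt0.
have e32 : 0 < e / 32 by rewrite divr_gt0.
have [N1 HN1] := fejer_sum_unif gT cg e2.
have [m Hm] := hu _ e32.
pose C := \sum_(1 <= k < m.+1) k%:R * amplitude h k.
have C0 : 0 <= C by apply: sumr_ge0 => k _; rewrite mulr_ge0// amplitude_ge0.
have [N2 HN2] : exists N, 4 * C / e <= N%:R.
  exists (Num.bound (4 * C / e)); apply/ltW/archi_boundP.
  by rewrite divr_ge0 ?mulr_ge0// ltW.
exists (maxn N1 (maxn N2 m.+1)) => n; rewrite !geq_max => /and3P[n1 n2 nm] x.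
have n0 : (0 < n)%N by exact: leq_trans nm.
pose S := \sum_(1 <= k < n.+1) k%:R * conj_harm h k x.
have E : fourier_sum g n x - fejer_sum g n x = n.+1%:R^-1 * S.
  rewrite /fourier_sum /fejer_sum opprD addrACA subrr add0r -sumrB /S mulr_sumr.
  apply: eq_big_nat => k /andP[k0 _]; rewrite -/(harm g k x) gh// /fejer_weight.
  by rewrite mulrA; move: (n.+1%:R^-1) => y; ring.
have head : `|\sum_(1 <= k < m.+1) k%:R * conj_harm h k x| <= C.
  apply: le_trans (ler_norm_sum _ _ _) _; apply: ler_sum => k _.
  by rewrite normrM ger0_norm// ler_wpM2l// norm_conj_harm_le.
have tail : `|\sum_(m.+1 <= k < n.+1) k%:R * conj_harm h k x| <= 2 * n%:R * (e / 16).
  rewrite -(prednK n0); apply: bernstein => y; rewrite prednK//.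
  have -> : \sum_(m.+1 <= k < n.+1) harm h k y =
      (fourier_sum h n y - h y) - (fourier_sum h m y - h y).
    have -> (a b c : R) : (a - c) - (b - c) = a - b by ring.
    rewrite /fourier_sum [X in _ = _ + X - _](@big_cat_nat _ _ _ m.+1)//=; last exact: leqW.
    by rewrite addrA [RHS]addrAC subrr add0r.
  have -> : e / 16 = e / 32 + e / 32 by field.
  by apply: le_trans (ler_normB _ _) _; apply: lerD; apply: Hm => //; exact: ltnW.
have SE : `|S| <= C + 2 * n%:R * (e / 16).
  rewrite /S (@big_cat_nat _ _ _ m.+1)//=; last exact: leqW.
  by apply: le_trans (ler_normD _ _) _; exact: lerD.
have -> : fourier_sum g n x - g x =
    (fourier_sum g n x - fejer_sum g n x) + (fejer_sum g n x - g x) by ring.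
apply: le_trans (ler_normD _ _) _; rewrite [leRHS]splitr; apply: lerD; last exact: HN1.
rewrite E normrM ger0_norm ?invr_ge0// mulrC ler_pdivrMr//.
apply: le_trans SE _; have C4 : 4 * C <= n%:R * e.
  by rewrite -ler_pdivrMr//; apply: le_trans HN2 _; rewrite ler_nat.
rewrite -(natr1 n); have : 0 <= n%:R * e by rewrite mulr_ge0// ltW.
have -> : 2 * n%:R * (e / 16) = n%:R * e / 8 by field.
have -> : e / 2 * (n%:R + 1) = n%:R * e / 2 + e / 2 by field.
by move: e0 C4; move: (n%:R * e) => y; clear; intros; lra.
Qed.

Lemma classU_conjugate (f ft : R -> R) : conjugate_of f ft -> classHBV f -> classW ft ->
  classU f /\ classU ft.
Proof.
move=> fft [f1 [g [gT gV fg]]] ftW.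
have gB := hbv_hvar_bounded gT gV.
have fW : classW f by split=> //; exists g; split=> //; exact: hvar_bounded_regulated.
have [[_ [h [hT ch fh]]] [ft1 [q [qT cq ftq]]]] := classC_conjugate fft fW ftW.
have hB : hvar_bounded h.
  apply: hvar_bounded_ae ch gB.
  by apply: filterS2 fg fh => x /= H1 H2 _; rewrite -H1// H2.
have hu := fourier_sum_unif hT ch hB.
split; split=> //; first by exists h; split.
exists q; split=> //; split=> //; apply: (fourier_sum_unif_conj qT cq hu) => k x k0.
have [c1 s1] := conjugate_fourier f1 ft1 fft k0.
have [c2 s2] := ae_eq_fourier k f1 (L1_continuous hT ch) fh.
have [c3 s3] := ae_eq_fourier k ft1 (L1_continuous qT cq) ftq.
by rewrite /harm /conj_harm -c3 -s3 c1 s1 c2 s2; ring.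
Qed.

End uniform_convergence.

Theorem theorem4p1 (R : realType) (lam : R) (lam_ge1 : 1 <= lam) :
  [/\ classW `&` classS_ae lam = classS_uniform lam,
      forall f ft : R -> R, conjugate_of f ft ->
        classW f -> classW ft -> classC f /\ classC ft,
      forall f ft : R -> R, conjugate_of f ft ->
        classS_ae lam f -> classW ft -> classS_uniform lam ft &
      forall f ft : R -> R, conjugate_of f ft ->
        classHBV f -> classW ft -> classU f /\ classU ft].
Proof.
split.
- exact: classW_classS_ae.
- move=> f ft; exact: classC_conjugate.
- move=> f ft; exact: classS_conjugate.
- move=> f ft; exact: classU_conjugate.
Qed.
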